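(* Let $c=c(n)$ be such that $p=p(n)=\frac{c\log n}{n}\in[0,1]$ and $\omega=(c-1)\log n\to\infty$ as $n\to\infty$, and let $G\sim G_{n,p}$. Then with high probability $\overline{C}(G)\approx n\log n$; that is, for every fixed $\delta>0$, $$\Pr\left[(1-\delta)\,n\log n\le \overline{C}(G)\le (1+\delta)\,n\log n\right]\to 1\quad\text{as } n\to\infty .$$
   Context: $G_{n,p}$ is the Erdős–Rényi random graph on vertex set $[n]$ in which each of the $\binom n2$ possible edges is present independently with probability $p$. ''With high probability'' means with probability tending to $1$ as $n\to\infty$; $\log$ is the natural logarithm; $A_n\approx B_n$ means $A_n=(1+o(1))B_n$. For a graph $G=(V,E)$, $d(v)$ is the degree of $v$ and $N(v)$ its set of neighbours. For $\{v,w\}\in E$ let $\psi(v,w)=\frac{1}{\min\{d(v),d(w)\}}$, and let $\Psi(v)=\sum_{w\in N(v)}\psi(v,w)$. The biased random walk $\mathcal W_u=(X_0=u,X_1,X_2,\ldots)$ on $G$ started at $u\in V$ is the Markov chain on $V$ with $$\Pr[X_{t+1}=w\mid X_t=v]=\begin{cases}\psi(v,w)/\Psi(v)& w\in N(v),\\ 0& w\notin N(v).\end{cases}$$ For a connected graph $G$, $C_u(G)$ is the expected (over the walk, with $G$ fixed) number of steps for $\mathcal W_u$ to visit all of $V$, and $\overline{C}(G)=\max_{u\in V}C_u(G)$. (For $G$ not connected set $\overline{C}(G)=\infty$; under the hypotheses $G$ is connected with high probability.) *)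

(* Defs.v *)
From HB Require Import structures.
From mathcomp Require Import all_boot all_order all_algebra.
From mathcomp Require Import all_classical all_reals all_analysis.
Set Implicit Arguments.
Unset Strict Implicit.
Unset Printing Implicit Defensive.
Import Order.TTheory GRing.Theory Num.Theory.
Import numFieldNormedType.Exports.
Local Open Scope ring_scope.

(* A finite graph is given by its adjacency relation
   [e : rel V], meant to be symmetric and irreflexive; all graphs drawn from
   G_{n,p} below are. *)

Definition deg (V : finType) (e : rel V) (v : V) : nat := #|[set w | e v w]|.

Definition connected_graph (V : finType) (e : rel V) : bool :=
  [forall u, forall v, connect e u v].

Definition psi (R : realType) (V : finType) (e : rel V) (v w : V) : R :=
  (minn (deg e v) (deg e w))%:R^-1.

Definition Psi (R : realType) (V : finType) (e : rel V) (v : V) : R :=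
  \sum_(w | e v w) psi R e v w.

Definition walk_step (R : realType) (V : finType) (e : rel V) (v w : V) : R :=
  if e v w then psi R e v w / Psi R e v else 0.

(* Pr[X_1 = x_1, ..., X_t = x_t] for the walk with X_0 = u, where
   x = (x_1, ..., x_t); thus nth u (u :: x) i is x_i, with x_0 = u. *)
Definition walk_law (R : realType) (V : finType) (e : rel V) (u : V)
    (t : nat) (x : t.-tuple V) : R :=
  \prod_(i < t) walk_step R e (nth u (u :: x) i) (nth u (u :: x) i.+1).

(* The trajectory X_0 = u, X_1 = x_1, ..., X_t = x_t has visited every vertex
   by time t, and for no s < t had it done so by time s. *)
Definition covers_first_at (V : finType) (u : V) (t : nat)
    (x : t.-tuple V) : bool :=
  [forall v, v \in u :: x] &&
  [forall s : 'I_t, ~~ [forall v, v \in take s.+1 (u :: x)]].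

(* Pr[T = t], with T the first time at which the walk from u has visited
   all of V. *)
Definition cover_time_pmf (R : realType) (V : finType) (e : rel V) (u : V)
    (t : nat) : R :=
  \sum_(x : t.-tuple V | covers_first_at u x) walk_law R e u x.

(* E[T] = sum_t t Pr[T = t] + (+oo) Pr[T = +oo], where
   Pr[T = +oo] = 1 - sum_t Pr[T = t] and +oo * 0 = 0 in \bar R. *)
Definition expected_cover_time (R : realType) (V : finType) (e : rel V)
    (u : V) : \bar R :=
  (\sum_(0 <= t <oo) (t%:R * cover_time_pmf R e u t)%:E
   + +oo * (1 - \sum_(0 <= t <oo) (cover_time_pmf R e u t)%:E))%E.

(* Cover times are nonnegative, so starting the maximum at 0 only matters when
   V is empty. *)
Definition max_cover_time (R : realType) (V : finType) (e : rel V) : \bar R :=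
  if connected_graph e
  then \big[maxe/0%E]_(u : V) expected_cover_time R e u
  else +oo%E.

Definition all_edges (n : nat) : {set {set 'I_n}} :=
  [set f : {set 'I_n} | #|f| == 2].

(* Since [set v; v] is a singleton, this is irreflexive when
   E \subset all_edges n. *)
Definition adj (n : nat) (E : {set {set 'I_n}}) : rel 'I_n :=
  fun v w => [set v; w] \in E.

Definition Gnp_weight (R : realType) (n : nat) (p : R)
    (E : {set {set 'I_n}}) : R :=
  \prod_(f in all_edges n) (if f \in E then p else 1 - p).

(* Pr[A G] for G ~ G_{n,p}, the property A being a predicate of the adjacency
   relation of G. *)
Definition Gnp_prob (R : realType) (n : nat) (p : R)
    (A : rel 'I_n -> bool) : R :=
  \sum_(E in powerset (all_edges n) | A (adj E)) Gnp_weight p E.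

(* Main.v *)
(* The walk is reversible with stationary weights [Psi v >= 1], whose sum is
   (1 + o(1)) n.  Suppose that it has a spectral gap bounded below.  The Green
   function G_v u = sum_(t < T) L^t(u, v) of the lazy walk L = (1 + P) / 2, with T
   of order log n, satisfies (1 - P) G_v = 2 (delta_v - L^T(., v)), where L^T(., v)
   is close to Psi v / sum Psi, at least about 1 / n.  If all transitions into [v]
   are unlikely, G_v v is close to 2 and G_v is close to 0 at other such vertices,
   so [v] is hit within about n steps; for any [v], G_v v is bounded.  Averages of
   the normalised G_v over the unvisited vertices, combined with harmonic numbers,
   are explicit super- and subsolutions for the expected remaining cover time,
   which gives n log n because only n^{o(1)} vertices are exceptional.

   The spectral gap follows from Cheeger's inequality for the unweighted graph on
   the vertices of degree at least d / 380, d = n p: with high probability this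
   graph has edge expansion of order d, while the remaining vertices are pairwise
   non-adjacent and have no common neighbour, and thus are controlled by their
   neighbours.  The properties of the random graph all follow from first moments of
   exponentials of edge counts. *)

Require Import Defs.
From HB Require Import structures.
From mathcomp Require Import all_boot all_order all_algebra.
From mathcomp Require Import all_classical all_reals all_analysis.
(* [finset] comes again so that its names take precedence over classical_sets. *)
From mathcomp Require Import finset ring lra zify.
Import Order.TTheory GRing.Theory Num.Theory.
Import numFieldNormedType.Exports.
Set Implicit Arguments.
Unset Strict Implicit.
Unset Printing Implicit Defensive.
Local Open Scope ring_scope.

(** * Exhaustion times *)

(** The bias is what makes the answer independent of [c]: on the good event a vertex of low degree
    has only neighbours of larger degree, so all terms of [Psi v] are [1 / deg v] and its weight is
    1. No vertex is therefore much rarer than [1 / n] in stationarity. The obstacle is [c] close to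
    1, when vertices of bounded degree occur. Returns to such a vertex are frequent, so [G_v v] is
    bounded but not near 2, and they also spoil edge expansion. For the cover time they are given a
    separate, larger rate; being few, they only add this rate times a small multiple of log n. For
    the spectral gap they are removed and their energy is charged to their neighbours. The rate of a
    typical vertex is [G_v v / (2 L^T(., v))], about [2 / (2 / n) = n]: the 2 due to resting
    cancels. The horizon [T] faces opposite demands: [rho ^ T] must be small against [1 / n], and
    [T / n] must be small. A large multiple of log n meets both. All estimates hold for finite [n]
    with explicit constants; a limit is taken only in the theorem. *)

Section CoverLaw.
Context (R : realType) (V : finType) (P : V -> V -> R).

(* Law of the first time at which the walk started at [u \notin S] has
   visited all of [S]. *)
Fixpoint exhaust_pmf (t : nat) (u : V) (S : {set V}) : R :=
  if t is t'.+1 then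
    if S == set0 then 0 else \sum_w P u w * exhaust_pmf t' w (S :\ w)
  else (S == set0)%:R.

Definition exhausts_first_at (S : {set V}) (t : nat) (x : t.-tuple V) : bool :=
  [forall v in S, v \in x] &&
  [forall s : 'I_t, ~~ [forall v in S, v \in take s x]].

Lemma big_tuple_cons (t : nat) (F : t.+1.-tuple V -> R) :
  \sum_x F x = \sum_w \sum_(x : t.-tuple V) F [tuple of w :: x].
Proof.
rewrite pair_big /= (reindex (fun q : V * t.-tuple V => [tuple of q.1 :: q.2])) //=.
exists (fun x => (thead x, [tuple of behead x])) => x _ /=.
  by case: x => w x; congr pair; apply/val_inj.
by rewrite [RHS]tuple_eta.
Qed.

Lemma forall_in_cons (S : {set V}) (w : V) (s : seq V) :
  [forall v in S, v \in w :: s] = [forall v in S :\ w, v \in s].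
Proof.
apply: eq_forallb => v; rewrite in_setD1 inE.
by case: eqVneq => //=; rewrite implybT.
Qed.

Lemma forall_in_nil (S : {set V}) : [forall v in S, v \in [::]] = (S == set0).
Proof.
apply/forallP/eqP => [h | -> v]; last by rewrite inE.
by apply/setP => v; have := h v; rewrite !inE; case: (v \in S).
Qed.

Lemma exhausts_first_at_cons (S : {set V}) (t : nat) (w : V) (x : t.-tuple V) :
  exhausts_first_at S [tuple of w :: x] =
  (S != set0) && exhausts_first_at (S :\ w) x.
Proof.
rewrite /exhausts_first_at /= forall_in_cons.
case: eqVneq => [->|S0] /=.
  apply/negP => /andP[_ /forallP /(_ ord0)] /negP[].
  by apply/forallP => v; rewrite inE.
congr (_ && _); apply/forallP/forallP => h s.
  by have := h (lift ord0 s); rewrite -forall_in_cons.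
case: (unliftP ord0 s) => [s' ->|->] /=.
  by rewrite forall_in_cons; exact: h.
by rewrite forall_in_nil.
Qed.

(** Conditioning on the first step turns the sum over trajectories into a recursion on the pair
    (position, unvisited set). From here on, arguments are inductions on [t] and no path space is
    needed. *)
Lemma exhaust_pmfE (t : nat) (u : V) (S : {set V}) :
  \sum_(x : t.-tuple V | exhausts_first_at S x)
     \prod_(i < t) P (nth u (u :: x) i) (nth u (u :: x) i.+1) =
  exhaust_pmf t u S.
Proof.
elim: t u S => [|t IH] u S.
  have ex (x : 0.-tuple V) : exhausts_first_at S x = (S == set0) && (x == [tuple]).
    have -> : (x == [tuple]) = true by apply/eqP; exact: tuple0.
    rewrite andbT /exhausts_first_at (tuple0 x) forall_in_nil.
    by rewrite [X in _ && X](_ : _ = true) ?andbT //; apply/forallP => -[].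
  rewrite (eq_bigl _ _ ex) /=; case: (S == set0) => /=; last by rewrite big_pred0.
  by rewrite big_pred1_eq big_ord0.
rewrite big_mkcond big_tuple_cons /=.
under eq_bigr => w _ do under eq_bigr => x _ do
  rewrite exhausts_first_at_cons big_ord_recl /=.
have [->|S0] := eqVneq S set0; first by rewrite big1 // => w _; rewrite big1.
apply: eq_bigr => w _; rewrite -IH big_distrr /= -big_mkcond /=.
apply: eq_bigr => x _; congr (_ * _); apply: eq_bigr => i _.
have hx : (i < size (w :: x))%N by rewrite /= size_tuple ltnS ltnW.
congr (P _ _); first exact: set_nth_default.
by rewrite add0n (set_nth_default w) ?size_tuple.
Qed.

(** * Comparison principle for truncated means *)

Section Comparison.
Hypothesis P_ge0 : forall u w, 0 <= P u w.
Hypothesis P_sum1 : forall u, \sum_w P u w = 1.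

Lemma exhaust_pmf_ge0 t u S : 0 <= exhaust_pmf t u S.
Proof.
elim: t u S => [|t IH] u S /=; first exact: ler0n.
by case: ifP => // _; apply: sumr_ge0 => w _; exact: mulr_ge0.
Qed.

(** [Pr[T > t]] for the exhaustion time [T]. As the complement of a partial sum it includes any mass
    at infinity, so finiteness of [T] is not presupposed. *)
Definition exhaust_tail (t : nat) (u : V) (S : {set V}) : R :=
  1 - \sum_(0 <= s < t.+1) exhaust_pmf s u S.

Lemma exhaust_tail0 u S : exhaust_tail 0 u S = (S != set0)%:R.
Proof. by rewrite /exhaust_tail big_nat1 /=; case: eqP; rewrite ?subrr ?subr0. Qed.

Lemma exhaust_tailS t u S : exhaust_tail t.+1 u S =
  if S == set0 then 0 else \sum_w P u w * exhaust_tail t w (S :\ w).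
Proof.
rewrite /exhaust_tail big_nat_recl //=.
case: eqP => [_|_].
  by rewrite big1 ?addr0 ?subrr.
rewrite add0r exchange_big /= -{1}(P_sum1 u) -sumrB.
by apply: eq_bigr => w _; rewrite mulrBr mulr1 big_distrr.
Qed.

Lemma exhaust_tail_ge0 t u S : 0 <= exhaust_tail t u S.
Proof.
elim: t u S => [|t IH] u S; first by rewrite exhaust_tail0 ler0n.
by rewrite exhaust_tailS; case: ifP => // _; apply: sumr_ge0 => w _; exact: mulr_ge0.
Qed.

Lemma exhaust_tail_anti u S : {homo (fun t => exhaust_tail t u S) : s t / (s <= t)%N >-> t <= s}.
Proof.
apply: homo_leq => [//|x y z h1 h2|t]; first exact: le_trans h2 h1.
rewrite /exhaust_tail [in leLHS]big_nat_recr // opprD addrA gerDl oppr_le0.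
exact: exhaust_pmf_ge0.
Qed.

(* [E[min (T, t)]] for the exhaustion time [T]. *)
Definition trunc_mean (t : nat) (u : V) (S : {set V}) : R :=
  \sum_(0 <= s < t) exhaust_tail s u S.

Lemma trunc_meanS t u S : trunc_mean t.+1 u S =
  if S == set0 then 0 else 1 + \sum_w P u w * trunc_mean t w (S :\ w).
Proof.
rewrite /trunc_mean big_nat_recl // exhaust_tail0.
case: ifP => S0 /=.
  by rewrite add0r big1 // => s _; rewrite exhaust_tailS S0.
congr (1 + _); under eq_bigr => s _ do rewrite exhaust_tailS S0.
by rewrite exchange_big /=; apply: eq_bigr => w _; rewrite big_distrr.
Qed.

Lemma trunc_meanE t u S : trunc_mean t u S =
  \sum_(0 <= s < t.+1) s%:R * exhaust_pmf s u S + t%:R * exhaust_tail t u S.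
Proof.
elim: t => [|t IH]; first by rewrite /trunc_mean big_geq // big_nat1 !mul0r addr0.
rewrite /trunc_mean big_nat_recr //= -/(trunc_mean _ _ _) IH [in RHS]big_nat_recr //.
have -> : exhaust_tail t u S = exhaust_tail t.+1 u S + exhaust_pmf t.+1 u S.
  by rewrite /exhaust_tail [in RHS]big_nat_recr // opprD addrA subrK.
rewrite -natr1; set f := exhaust_pmf t.+1 u S; rewrite /=; ring.
Qed.

(** The recursion [trunc_meanS] is monotone in the values after the step, and the truncated mean
    starts from 0. The bound is uniform in [t], so it also yields finiteness of the expectation. *)
Lemma trunc_mean_le (Phi : V -> {set V} -> R) :
  (forall u S, 0 <= Phi u S) ->
  (forall (u : V) (S : {set V}), u \notin S -> S != set0 ->
     1 + \sum_w P u w * Phi w (S :\ w) <= Phi u S) ->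
  forall t (u : V) (S : {set V}), u \notin S -> trunc_mean t u S <= Phi u S.
Proof.
move=> Phi0 sup; elim=> [|t IH] u S uS.
  by rewrite /trunc_mean big_geq.
rewrite trunc_meanS; case: eqVneq => [_|S0]; first exact: Phi0.
apply: le_trans (sup _ _ uS S0); rewrite lerD2l; apply: ler_sum => w _.
by apply: (ler_wpM2l (P_ge0 _ _)); apply: IH; rewrite !inE eqxx.
Qed.

(** At the horizon the walk may still owe up to [M], but only on the event [T > t]. This debt
    vanishes as [t] grows once the truncated means are known to be bounded. *)
Lemma le_trunc_mean (Phi : V -> {set V} -> R) (M : R) :
  (forall u, Phi u set0 <= 0) -> (forall u S, Phi u S <= M) -> 0 <= M ->
  (forall (u : V) (S : {set V}), u \notin S -> S != set0 ->
     Phi u S <= 1 + \sum_w P u w * Phi w (S :\ w)) ->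
  forall t (u : V) (S : {set V}), u \notin S -> Phi u S <= trunc_mean t u S + M * exhaust_tail t u S.
Proof.
move=> Phi0 PhiM M0 sub; elim=> [|t IH] u S uS.
  rewrite /trunc_mean big_geq // add0r exhaust_tail0.
  by case: eqVneq => [->|_]; rewrite ?mulr0 ?mulr1.
rewrite trunc_meanS exhaust_tailS; case: eqVneq => [->|S0].
  by rewrite mulr0 addr0.
apply: le_trans (sub _ _ uS S0) _; rewrite -addrA lerD2l mulr_sumr -big_split /=.
apply: ler_sum => w _; rewrite mulrCA -mulrDr; apply: (ler_wpM2l (P_ge0 _ _)).
by apply: IH; rewrite !inE eqxx.
Qed.

(** * From truncated means to the expectation *)

Section Expectation.
Variables (u : V) (S : {set V}) (B : R).
Hypothesis trunc_mean_leB : forall t, trunc_mean t u S <= B.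

(** Markov's inequality for the truncated time. *)
Lemma exhaust_tail_leM t : t%:R * exhaust_tail t u S <= B.
Proof.
apply: le_trans (trunc_mean_leB t).
by rewrite trunc_meanE lerDr sumr_ge0 // => s _; rewrite mulr_ge0 ?exhaust_pmf_ge0.
Qed.

Lemma mean_bound_ge0 : 0 <= B.
Proof. by apply: le_trans (exhaust_tail_leM 0); rewrite mul0r. Qed.

Lemma exhaust_tail_small (eps : R) : 0 < eps -> exists t, exhaust_tail t u S <= eps.
Proof.
move=> eps0; pose t := (Num.truncn (B / eps)).+1.
have ht : B / eps <= t%:R.
  by apply: ltW; rewrite /t truncnS_gt.
exists t; have t0 : 0 < t%:R :> R by rewrite ltr0n.
rewrite -(ler_pM2l t0); apply: le_trans (exhaust_tail_leM t) _.
by rewrite -ler_pdivrMr.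
Qed.

Lemma nneseries_exhaust_pmf :
  (\sum_(0 <= t <oo) (exhaust_pmf t u S)%:E = 1)%E.
Proof.
apply/eqP; rewrite eq_le; apply/andP; split.
  apply: lime_le.
    by apply: is_cvg_nneseries => t _ _; rewrite lee_fin exhaust_pmf_ge0.
  apply: nearW => t; rewrite sumEFin lee_fin.
  case: t => [|t]; first by rewrite big_geq ?ler01.
  by have := exhaust_tail_ge0 t u S; rewrite /exhaust_tail subr_ge0.
apply/lee_addgt0Pr => eps eps0; have [t ht] := exhaust_tail_small eps0.
rewrite -leeBlDr //; apply: le_trans (nneseries_lim_ge t.+1 _); last first.
  by move=> s _ _; rewrite lee_fin exhaust_pmf_ge0.
by rewrite sumEFin -EFinB lee_fin; move: ht; rewrite /exhaust_tail; lra.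
Qed.

Lemma nneseries_mean_le :
  (\sum_(0 <= t <oo) (t%:R * exhaust_pmf t u S)%:E <= B%:E)%E.
Proof.
apply: lime_le.
  by apply: is_cvg_nneseries => t _ _; rewrite lee_fin mulr_ge0 ?exhaust_pmf_ge0.
apply: nearW => t; rewrite sumEFin lee_fin.
case: t => [|t]; first by rewrite big_geq ?mean_bound_ge0.
apply: le_trans (trunc_mean_leB t); rewrite trunc_meanE lerDl.
by rewrite mulr_ge0 ?exhaust_tail_ge0.
Qed.

Lemma le_nneseries_mean t :
  ((trunc_mean t u S)%:E <= \sum_(0 <= t <oo) (t%:R * exhaust_pmf t u S)%:E)%E.
Proof.
apply/lee_addgt0Pr => eps eps0.
(* The partial series up to [t2] misses [t2 * Pr[T > t2]]. Of this, [t2 - t] copies of the tail are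
   absorbed by the tails between [t] and [t2], which are at least as large; the remaining [t] copies
   are at most [eps] by the choice of [t1]. *)
have [|t1 ht1] := @exhaust_tail_small (eps / t.+1%:R); first by rewrite divr_gt0.
pose t2 := maxn t t1.
have ht2 : exhaust_tail t2 u S <= eps / t.+1%:R.
  by apply: le_trans ht1; apply: exhaust_tail_anti; rewrite leq_maxr.
rewrite -leeBlDr //; apply: le_trans (nneseries_lim_ge t2.+1 _); last first.
  by move=> s _ _; rewrite lee_fin mulr_ge0 ?exhaust_pmf_ge0.
rewrite sumEFin -EFinB lee_fin.
have := trunc_meanE t2 u S; rewrite {1}/trunc_mean (@big_cat_nat _ _ _ t) ?leq_maxl //=.
rewrite -/(trunc_mean _ _ _) => /(congr1 (fun x => x - t2%:R * exhaust_tail t2 u S)).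
rewrite addrK => <-; rewrite -addrA lerD2l.
have : (t2%:R - t%:R) * exhaust_tail t2 u S <= \sum_(t <= s < t2) exhaust_tail s u S.
  rewrite -natrB ?leq_maxl //.
  have -> : (t2 - t)%:R * exhaust_tail t2 u S = \sum_(t <= s < t2) exhaust_tail t2 u S.
    by rewrite sumr_const_nat mulr_natl.
  apply: ler_sum_nat => s /andP[_ st]; exact/exhaust_tail_anti/ltnW.
have : t%:R * exhaust_tail t2 u S <= eps.
  apply: le_trans (_ : t.+1%:R * exhaust_tail t2 u S <= _).
    by rewrite ler_wpM2r ?exhaust_tail_ge0 // ler_nat.
  by rewrite mulrC -ler_pdivlMr.
by rewrite mulrBl; lra.
Qed.

Lemma exhaust_mean_ge (t0 : R) (M : R) : 0 <= M ->
  (forall t, t0 <= trunc_mean t u S + M * exhaust_tail t u S) ->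
  (t0%:E <= \sum_(0 <= t <oo) (t%:R * exhaust_pmf t u S)%:E)%E.
Proof.
move=> M0 ht0; apply/lee_addgt0Pr => eps eps0.
have [|t ht] := @exhaust_tail_small (eps / (M + 1)).
  by rewrite divr_gt0 // ltr_wpDl.
apply: le_trans (leeD2r _ (le_nneseries_mean t)).
rewrite -EFinD lee_fin; apply: le_trans (ht0 t) _; rewrite lerD2l.
apply: le_trans (_ : (M + 1) * exhaust_tail t u S <= _).
  by rewrite ler_wpM2r ?exhaust_tail_ge0 // lerDl.
by rewrite mulrC -ler_pdivlMr // ltr_wpDl.
Qed.

End Expectation.
End Comparison.
End CoverLaw.

Section ExpectedCoverTime.
Context (R : realType) (V : finType) (e : rel V).
Hypothesis P_ge0 : forall u w, 0 <= walk_step R e u w.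
Hypothesis P_sum1 : forall u, \sum_w walk_step R e u w = 1.

Lemma cover_time_pmfE (u : V) (t : nat) :
  cover_time_pmf R e u t = exhaust_pmf (walk_step R e) t u [set~ u].
Proof.
rewrite -exhaust_pmfE; apply: eq_bigl => x.
have eqf (s : seq V) : [forall v, v \in u :: s] = [forall v in [set~ u], v \in s].
  by apply: eq_forallb => v; rewrite !inE; case: eqP.
rewrite /covers_first_at /exhausts_first_at eqf; congr (_ && _).
by apply: eq_forallb => s; rewrite -eqf.
Qed.

(** Bounded truncated means force total mass 1, so the infinite term becomes [+oo * 0 = 0]. *)
Lemma expected_cover_timeE (u : V) (B : R) :
  (forall t, trunc_mean (walk_step R e) t u [set~ u] <= B) ->
  expected_cover_time R e u =
  (\sum_(0 <= t <oo) (t%:R * exhaust_pmf (walk_step R e) t u [set~ u])%:E)%E.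
Proof.
move=> hB; rewrite /expected_cover_time.
under eq_eseriesr => t _ do rewrite cover_time_pmfE.
under [X in (1 - X)%E]eq_eseriesr => t _ do rewrite cover_time_pmfE.
by rewrite (nneseries_exhaust_pmf P_ge0 P_sum1 hB) subee // mule0 adde0.
Qed.

Lemma expected_cover_time_le (Phi : V -> {set V} -> R) :
  (forall u S, 0 <= Phi u S) ->
  (forall (u : V) (S : {set V}), u \notin S -> S != set0 ->
     1 + \sum_w walk_step R e u w * Phi w (S :\ w) <= Phi u S) ->
  forall u, (expected_cover_time R e u <= (Phi u [set~ u])%:E)%E.
Proof.
move=> Phi0 sup u.
have hB t : trunc_mean (walk_step R e) t u [set~ u] <= Phi u [set~ u].
  by apply: trunc_mean_le => //; rewrite !inE eqxx.
rewrite (expected_cover_timeE hB); exact: nneseries_mean_le.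
Qed.

(** The supersolution [Phi'] supplies the a priori finiteness that lets the debt [M * Pr[T > t]] of
    the subsolution vanish. *)
Lemma expected_cover_time_ge (Phi Phi' : V -> {set V} -> R) (M : R) :
  (forall u S, 0 <= Phi' u S) ->
  (forall (u : V) (S : {set V}), u \notin S -> S != set0 ->
     1 + \sum_w walk_step R e u w * Phi' w (S :\ w) <= Phi' u S) ->
  (forall u, Phi u set0 <= 0) -> (forall u S, Phi u S <= M) -> 0 <= M ->
  (forall (u : V) (S : {set V}), u \notin S -> S != set0 ->
     Phi u S <= 1 + \sum_w walk_step R e u w * Phi w (S :\ w)) ->
  forall u, ((Phi u [set~ u])%:E <= expected_cover_time R e u)%E.
Proof.
move=> Phi0' sup Phi0 PhiM M0 sub u.
have hB t : trunc_mean (walk_step R e) t u [set~ u] <= Phi' u [set~ u].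
  by apply: trunc_mean_le => //; rewrite !inE eqxx.
rewrite (expected_cover_timeE hB); apply: (exhaust_mean_ge P_ge0 P_sum1 hB M0) => t.
by apply: le_trunc_mean => //; rewrite !inE eqxx.
Qed.

End ExpectedCoverTime.

(** * Green function of the lazy walk *)

Section Potential.
Context (R : realType) (V : finType) (P : V -> V -> R) (Q : V -> R).
Hypothesis P_ge0 : forall u w, 0 <= P u w.
Hypothesis P_sum1 : forall u, \sum_w P u w = 1.
Hypothesis Q_ge1 : forall u, 1 <= Q u.
Hypothesis P_rev : forall u w, Q u * P u w = Q w * P w u.

Let Q_gt0 u : 0 < Q u. Proof. exact: lt_le_trans ltr01 (Q_ge1 u). Qed.
Let Q_ge0 u : 0 <= Q u. Proof. exact: ltW. Qed.

Definition avg (f : V -> R) (u : V) : R := \sum_w P u w * f w.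

Definition lazy (f : V -> R) (u : V) : R := (f u + avg f u) / 2.

Definition dirichlet (f : V -> R) : R := \sum_u Q u * f u * (f u - avg f u).

Lemma Q_avg f : \sum_u Q u * avg f u = \sum_u Q u * f u.
Proof.
rewrite /avg; under eq_bigr => u _ do rewrite mulr_sumr.
rewrite exchange_big /=; apply: eq_bigr => w _.
under eq_bigr => u _ do rewrite mulrA P_rev -mulrA [P _ _ * _]mulrC mulrA.
by rewrite -mulr_sumr P_sum1 mulr1.
Qed.

Lemma Q_lazy f : \sum_u Q u * lazy f u = \sum_u Q u * f u.
Proof.
rewrite /lazy; under eq_bigr => u _ do rewrite mulrA mulrDr.
by rewrite -mulr_suml big_split /= Q_avg; field.
Qed.

Lemma sqr_avg_le f u : avg f u ^+ 2 <= avg (fun w => f w ^+ 2) u.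
Proof.
have : 0 <= \sum_w P u w * (f w - avg f u) ^+ 2.
  by apply: sumr_ge0 => w _; rewrite mulr_ge0 ?sqr_ge0.
have -> : \sum_w P u w * (f w - avg f u) ^+ 2 =
    \sum_w (P u w * f w ^+ 2 - P u w * f w * (2 * avg f u) + P u w * avg f u ^+ 2).
  by apply: eq_bigr => w _; ring.
rewrite big_split sumrB /= -!mulr_suml P_sum1 -/(avg _ _) -/(avg (fun w => f w ^+ 2) _).
set a := avg _ _; set b := avg _ _; nra.
Qed.

(** In the norm weighted by [Q], expand [|(f + P f) / 2|^2] and use [|P f| <= |f|] (Jensen and
    stationarity): the result is at most [|f|^2 - dirichlet f / 2]. Laziness makes eigenvalues of
    [P] near -1 harmless. *)
Lemma lazy_contract (C : R) f : 0 < C ->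
  \sum_u Q u * f u ^+ 2 <= C * dirichlet f ->
  \sum_u Q u * lazy f u ^+ 2 <= (1 - (2 * C)^-1) * \sum_u Q u * f u ^+ 2.
Proof.
move=> C0 hC.
have h1 : \sum_u Q u * lazy f u ^+ 2 <=
    \sum_u (Q u * f u ^+ 2 / 2 + Q u * f u * avg f u / 2).
  have e1 : \sum_u Q u * avg (fun w => f w ^+ 2) u = \sum_u Q u * f u ^+ 2 := Q_avg _.
  apply: (le_trans (y := \sum_u (Q u * f u ^+ 2 / 4 + Q u * f u * avg f u / 2
            + Q u * avg (fun w => f w ^+ 2) u / 4))).
    apply: ler_sum => u _; rewrite /lazy.
    have := ler_wpM2l (Q_ge0 u) (sqr_avg_le f u).
    set a := avg f u; set b := avg _ _; nra.
  rewrite big_split big_split [leRHS]big_split /= -!mulr_suml e1; lra.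
apply: le_trans h1 _; rewrite big_split /= -!mulr_suml.
have -> : \sum_u Q u * f u * avg f u = \sum_u Q u * f u ^+ 2 - dirichlet f.
  by rewrite /dirichlet -sumrB; apply: eq_bigr => u _; ring.
have : (2 * C)^-1 * \sum_u Q u * f u ^+ 2 <= dirichlet f / 2.
  have -> : dirichlet f / 2 = (2 * C)^-1 * (C * dirichlet f).
    by field; rewrite gt_eqF.
  by rewrite ler_wpM2l // invr_ge0 mulr_ge0 // ltW.
set s := \sum_u _; lra.
Qed.

Section Target.
Variable v : V.

Definition delta_at (u : V) : R := (u == v)%:R.

(* [lazy_prob t u] is the [t]-step transition probability from [u] to [v] of
   the walk that rests with probability 1/2. *)
Definition lazy_prob (t : nat) : V -> R := iter t lazy delta_at.

Definition green (T : nat) (u : V) : R := \sum_(0 <= t < T) lazy_prob t u.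

Lemma lazy_probS t u : lazy_prob t.+1 u = lazy (lazy_prob t) u.
Proof. by []. Qed.

Lemma lazy_prob_ge0 t u : 0 <= lazy_prob t u.
Proof.
elim: t u => [|t IH] u; first exact: ler0n.
by rewrite lazy_probS divr_ge0 // addr_ge0 // sumr_ge0 // => w _; rewrite mulr_ge0.
Qed.

Lemma green_ge0 T u : 0 <= green T u.
Proof. by apply: sumr_ge0 => t _; exact: lazy_prob_ge0. Qed.

Lemma avg_le f g u : (forall w, f w <= g w) -> avg f u <= avg g u.
Proof. by move=> h; apply: ler_sum => w _; rewrite ler_wpM2l. Qed.

Lemma avg_cst c u : avg (fun=> c) u = c.
Proof. by rewrite /avg -mulr_suml P_sum1 mul1r. Qed.

Lemma lazy_le f g u : (forall w, f w <= g w) -> lazy f u <= lazy g u.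
Proof. by move=> h; rewrite ler_pM2r ?invr_gt0 // lerD // avg_le. Qed.

Lemma lazy_cst c u : lazy (fun=> c) u = c.
Proof. by rewrite /lazy avg_cst; field. Qed.

Lemma lazy_sum T (F : nat -> V -> R) u :
  lazy (fun w => \sum_(0 <= t < T) F t w) u = \sum_(0 <= t < T) lazy (F t) u.
Proof.
rewrite /lazy -mulr_suml big_split /=; congr ((_ + _) / 2).
rewrite /avg exchange_big /=; apply: eq_bigr => w _.
by rewrite mulr_sumr.
Qed.

Lemma greenS T u : green T.+1 u = delta_at u + lazy (green T) u.
Proof. by rewrite /green big_nat_recl // lazy_sum. Qed.

(** Peel [green T.+1] at its first term and at its last term and compare. The factors 2 come from
    the resting probability. *)
Lemma green_poisson T u :
  avg (green T) u = green T u - 2 * delta_at u + 2 * lazy_prob T u.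
Proof.
have := greenS T u; rewrite {1}/green big_nat_recr //= -/(green T u) {1}/lazy.
set a := avg _ _; set b := green _ _; lra.
Qed.

Lemma green_mono T u : green T u <= green T.+1 u.
Proof. by rewrite [leRHS]/green big_nat_recr //= lerDl lazy_prob_ge0. Qed.

(** Maximum principle: off [v], the Green function for one more step is an average of the previous
    values, all at most the one at [v] by induction. *)
Lemma green_le_diag T u : green T u <= green T v.
Proof.
elim: T u => [|T IH] u; first by rewrite /green !big_geq.
have [->//|uv] := eqVneq u v.
apply: le_trans (green_mono T v); rewrite greenS /delta_at (negbTE uv) add0r.
by rewrite -[leRHS](lazy_cst _ u); exact: lazy_le.
Qed.

Lemma lazy_prob_ge t : 2^-1 ^+ t <= lazy_prob t v.
Proof.
elim: t => [|t IH]; first by rewrite expr0 /lazy_prob /= /delta_at eqxx.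
rewrite lazy_probS exprS mulrC ler_pM2r ?invr_gt0 //.
by apply: le_trans IH _; rewrite lerDl sumr_ge0 // => w _; rewrite mulr_ge0 ?lazy_prob_ge0.
Qed.

Lemma geo_half T : \sum_(0 <= t < T) 2^-1 ^+ t = 2 - 2 * 2^-1 ^+ T :> R.
Proof.
elim: T => [|T IH]; first by rewrite big_geq // expr0; lra.
rewrite big_nat_recr //= IH exprS; lra.
Qed.

Lemma green_diag_ge T : 2 - 2 * 2^-1 ^+ T <= green T v.
Proof. by rewrite -geo_half; apply: ler_sum => t _; exact: lazy_prob_ge. Qed.

(** Unless the walk rests all the time, its last real step must enter [v], which has probability at
    most [eps]. *)
Lemma lazy_prob_le (eps : R) t u : (forall w, P w v <= eps) ->
  lazy_prob t u <= 2^-1 ^+ t * (u == v)%:R + eps * (1 - 2^-1 ^+ t).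
Proof.
move=> heps; elim: t u => [|t IH] u; first by rewrite expr0 subrr mulr0 addr0 mul1r.
rewrite lazy_probS; apply: le_trans (lazy_le _ IH) _.
rewrite /lazy /avg; set c := eps * _.
have -> : \sum_w P u w * (2^-1 ^+ t * (w == v)%:R + c) = 2^-1 ^+ t * P u v + c.
  under eq_bigr => w _ do rewrite mulrDr.
  rewrite big_split /= -mulr_suml P_sum1 mul1r (bigD1 v) //= eqxx big1.
    by rewrite mulr1 addr0 mulrC.
  by move=> w /negbTE ->; rewrite !mulr0.
have h0 : 0 <= 2^-1 ^+ t :> R by rewrite exprn_ge0.
have := ler_wpM2l h0 (heps u); rewrite /c exprS.
set x := 2^-1 ^+ t; set b := (u == v)%:R; nra.
Qed.

(** * Mixing from a Poincare inequality *)

Section Mixing.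
Variables (C kappa rho : R).
Hypothesis C_gt0 : 0 < C.
Hypothesis poincare : forall f, \sum_u Q u * f u = 0 ->
  \sum_u Q u * f u ^+ 2 <= C * dirichlet f.
Hypothesis Q_le : forall u, Q u <= kappa.
Hypothesis rho_ge0 : 0 <= rho.
Hypothesis rho_lt1 : rho < 1.
Hypothesis rhoC : 1 - (2 * C)^-1 <= rho ^+ 2.

Let W := \sum_u Q u.
Let q := Q v / W.

Lemma total_weight_gt0 : 0 < W.
Proof.
rewrite /W (bigD1 v) //=; apply: ltr_pwDl => //.
by apply: sumr_ge0.
Qed.

Let dev t u := lazy_prob t u - q.

Lemma dev_mean0 t : \sum_u Q u * dev t u = 0.
Proof.
rewrite /dev; under eq_bigr => u _ do rewrite mulrBr.
rewrite sumrB -mulr_suml -/W /q mulrCA divff ?gt_eqF ?total_weight_gt0 // mulr1.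
apply/eqP; rewrite subr_eq0; apply/eqP.
elim: t => [|t IH]; last by rewrite Q_lazy.
rewrite (bigD1 v) //= /lazy_prob /= /delta_at eqxx mulr1 big1 ?addr0 // => u /negbTE ->.
by rewrite mulr0.
Qed.

Lemma dev_energy t : \sum_u Q u * dev t u ^+ 2 <= (rho ^+ 2) ^+ t * Q v.
Proof.
elim: t => [|t IH].
  rewrite expr0 mul1r.
  (* As [delta_at] takes only the values 0 and 1, the square of [delta - q] is
     [delta * (1 - q) - q * (delta - q)], and the last term has [Q]-mean zero. *)
  have -> : \sum_u Q u * dev 0 u ^+ 2 = \sum_u (Q u * delta_at u * (1 - q)
       - q * (Q u * dev 0 u)).
    by apply: eq_bigr => u _; rewrite /dev /lazy_prob /= /delta_at; case: eqP => _ /=; ring.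
  rewrite sumrB -mulr_sumr dev_mean0 mulr0 subr0 -mulr_suml.
  rewrite (bigD1 v) //= /delta_at eqxx mulr1 big1 ?addr0 => [|u /negbTE ->]; last first.
    by rewrite mulr0.
  rewrite ler_piMr // gerBl divr_ge0 // ltW //; exact: total_weight_gt0.
have e u : dev t.+1 u = lazy (dev t) u.
  rewrite /dev lazy_probS /lazy /avg.
  under [in RHS]eq_bigr => w _ do rewrite mulrBr.
  have -> : \sum_w (P u w * lazy_prob t w - P u w * q) = avg (lazy_prob t) u - q.
    by rewrite sumrB -mulr_suml P_sum1 mul1r.
  by rewrite /avg; field.
under eq_bigr => u _ do rewrite e.
apply: le_trans (lazy_contract C_gt0 (poincare (dev_mean0 t))) _.
apply: le_trans (ler_wpM2r _ rhoC) _.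
  by apply: sumr_ge0 => u _; rewrite mulr_ge0 ?sqr_ge0.
by rewrite [(rho ^+ 2) ^+ t.+1]exprS -mulrA ler_wpM2l ?sqr_ge0.
Qed.

Lemma kappa_ge1 : 1 <= kappa. Proof. exact: le_trans (Q_ge1 v) (Q_le v). Qed.

(** The weighted energy dominates each single squared deviation because [Q u >= 1]; its initial
    value is at most [Q v <= kappa <= kappa ^+ 2]. *)
Lemma lazy_prob_mixing t u : `|lazy_prob t u - q| <= kappa * rho ^+ t.
Proof.
have k0 : 0 <= kappa by apply: le_trans kappa_ge1.
rewrite -ler_sqr ?nnegrE ?mulr_ge0 ?exprn_ge0 // real_normK ?num_real //.
apply: le_trans (_ : Q u * dev t u ^+ 2 <= _).
  by rewrite ler_peMl ?sqr_ge0.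
apply: le_trans (_ : \sum_u Q u * dev t u ^+ 2 <= _).
  rewrite (bigD1 u) //= lerDl; apply: sumr_ge0 => w _.
  by rewrite mulr_ge0 ?sqr_ge0.
apply: le_trans (dev_energy t) _.
rewrite [leRHS]exprMn exprAC mulrC ler_wpM2r ?sqr_ge0 //.
by apply: le_trans (Q_le v) _; rewrite ler_eXnr ?kappa_ge1.
Qed.

Lemma geo_tail a T : \sum_(a <= t < T) kappa * rho ^+ t <= kappa * rho ^+ a / (1 - rho).
Proof.
have r1 : 0 < 1 - rho by rewrite subr_gt0.
have k0 : 0 <= kappa by apply: le_trans kappa_ge1.
have [Ta|aT] := leqP T a.
  by rewrite big_geq // divr_ge0 ?mulr_ge0 ?exprn_ge0 // ltW.
rewrite -mulr_sumr -mulrA ler_wpM2l // ler_pdivlMr // mulr_suml.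
rewrite (@telescope_sumr_eq _ _ _ (fun t => - rho ^+ t) _ (ltnW aT)).
  by rewrite opprK addrC gerBl exprn_ge0.
by move=> t _; rewrite exprS; ring.
Qed.

Lemma lazy_prob_le_mixing t u : lazy_prob t u <= q + kappa * rho ^+ t.
Proof. by have := lazy_prob_mixing t u; rewrite ler_norml => /andP[_]; lra. Qed.

Lemma green_le_tail a T u :
  \sum_(a <= t < T) lazy_prob t u <= T%:R * q + kappa * rho ^+ a / (1 - rho).
Proof.
apply: le_trans (_ : \sum_(a <= t < T) (q + kappa * rho ^+ t) <= _).
  by apply: ler_sum => t _; exact: lazy_prob_le_mixing.
rewrite big_split /= lerD ?geo_tail // sumr_const_nat -[q *+ _]mulr_natl ler_wpM2r //.
  by rewrite divr_ge0 // ltW // total_weight_gt0.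
by rewrite ler_nat leq_subr.
Qed.

Lemma green_le T u : green T u <= T%:R * q + kappa / (1 - rho).
Proof. by have := green_le_tail 0 T u; rewrite expr0 mulr1. Qed.

(** Before [T0] real entries into [v] are rare; after [T0] the mixing bound applies. [T0] is later a
    constant chosen before [eps], so that [T0 * eps] and [rho ^+ T0] are both small. *)
Lemma green_le_good (eps : R) (T0 T : nat) u : (forall w, P w v <= eps) ->
  (T0 <= T)%N ->
  green T u <= 2 * (u == v)%:R + T0%:R * eps +
    (T%:R * q + kappa * rho ^+ T0 / (1 - rho)).
Proof.
move=> heps T0T; have eps0 : 0 <= eps := le_trans (P_ge0 v v) (heps v).
rewrite /green (@big_cat_nat _ _ _ T0) //= lerD ?green_le_tail //.
apply: le_trans (_ : \sum_(0 <= t < T0) (2^-1 ^+ t * (u == v)%:R + eps) <= _).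
  apply: ler_sum => t _; apply: le_trans (lazy_prob_le t u heps) _.
  by rewrite lerD2l ler_piMr // gerBl exprn_ge0.
rewrite big_split /= sumr_const_nat subn0 -[eps *+ _]mulr_natl lerD2r -mulr_suml geo_half.
by rewrite ler_wpM2r // gerBl mulr_ge0 // exprn_ge0.
Qed.

End Mixing.
End Target.
End Potential.

(** * Matthews' bounds *)

Section Harmonic.
Context (R : realType).

Definition harmonic_number (k : nat) : R := \sum_(j < k) j.+1%:R^-1.

Lemma harmonic_numberS k : harmonic_number k.+1 = harmonic_number k + k.+1%:R^-1.
Proof. by rewrite /harmonic_number big_ord_recr. Qed.

Lemma le_harmonic_number : {homo harmonic_number : j k / (j <= k)%N >-> j <= k}.
Proof.
apply: homo_leq => [//|x y z|k]; first exact: le_trans.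
by rewrite harmonic_numberS lerDl invr_ge0.
Qed.

Lemma harmonic_number_ge0 k : 0 <= harmonic_number k.
Proof. by apply: sumr_ge0 => j _; rewrite invr_ge0. Qed.

Lemma harmonic_number_ge1 k : (0 < k)%N -> 1 <= harmonic_number k.
Proof.
move=> k0; apply: le_trans (le_harmonic_number k0).
by rewrite harmonic_numberS /harmonic_number big_ord0 add0r invr1.
Qed.

Lemma ln_le_subr1 (x : R) : 0 < x -> ln x <= x - 1.
Proof. by move=> x0; have := expR_ge1Dx (ln x); rewrite lnK ?posrE //; lra. Qed.

Lemma ln_succ_le (k : nat) : ln (k.+2%:R : R) - ln k.+1%:R <= k.+1%:R^-1.
Proof.
have k0 : 0 < k.+1%:R :> R by rewrite ltr0n.
rewrite -ln_div ?posrE //.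
apply: le_trans (ln_le_subr1 _) _; first by rewrite divr_gt0 ?ltr0n.
by rewrite -[k.+2%:R]natr1 mulrDl divff ?gt_eqF // mul1r addrC addKr.
Qed.

Lemma ln_succ_ge (k : nat) : k.+2%:R^-1 <= ln (k.+2%:R : R) - ln k.+1%:R.
Proof.
have k0 : 0 < k.+1%:R :> R by rewrite ltr0n.
have k1 : 0 < k.+2%:R :> R by rewrite ltr0n.
rewrite -opprB -ln_div ?posrE // lerNr.
apply: le_trans (ln_le_subr1 _) _; first by rewrite divr_gt0.
rewrite (_ : k.+1%:R = k.+2%:R - 1); last by rewrite -[k.+2%:R]natr1 addrK.
by rewrite mulrDl divff ?gt_eqF // mulN1r addrAC subrr add0r.
Qed.

Lemma ln_le_harmonic_number k : ln (k.+1%:R : R) <= harmonic_number k.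
Proof.
elim: k => [|k IH]; first by rewrite ln1 harmonic_number_ge0.
by rewrite harmonic_numberS; apply: le_trans (lerD IH (ln_succ_le k)); rewrite addrC subrK.
Qed.

Lemma harmonic_number_le k : (0 < k)%N -> harmonic_number k <= 1 + ln (k%:R : R).
Proof.
case: k => // k _; elim: k => [|k IH].
  by rewrite harmonic_numberS /harmonic_number big_ord0 add0r invr1 ln1 addr0.
rewrite harmonic_numberS; apply: le_trans (lerD IH (ln_succ_ge k)) _.
by rewrite -addrA lerD2l addrC subrK.
Qed.

End Harmonic.

(* Potentials [gam v] that grow at a known rate away from [v] turn into super-
   and subsolutions for the exhaustion time of a set [D]; this is Matthews'
   bound without conditioning on the order of the visits. *)
Section MatthewsPotential.
Context (R : realType) (V : finType) (P : V -> V -> R) (gam : V -> V -> R).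
Hypothesis P_ge0 : forall u w, 0 <= P u w.
Hypothesis P_sum1 : forall u, \sum_w P u w = 1.
Hypothesis gam_ge0 : forall v u, 0 <= gam v u.
Hypothesis gam_le1 : forall v u, gam v u <= 1.

(** If [gam v] is 1 at [v] and has drift [1 / alpha] elsewhere, then [alpha * (1 - gam v u)] is the
    expected time from [u] to [v]; this is the case [D = [set v]], [beta = 1]. Supersolutions use
    [beta = 1], subsolutions [beta = 1 - eps]. *)
Definition matthews_potential (alpha beta : R) (u : V) (D : {set V}) : R :=
  alpha * (beta * harmonic_number R #|D| - #|D|%:R^-1 * \sum_(v in D) gam v u).

Lemma matthews_potential0 alpha beta u : matthews_potential alpha beta u set0 = 0.
Proof.
by rewrite /matthews_potential cards0 big_set0 /harmonic_number big_ord0; ring.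
Qed.

Lemma gam_mean_ge0 (D : {set V}) u : 0 <= #|D|%:R^-1 * \sum_(v in D) gam v u.
Proof. by rewrite mulr_ge0 ?invr_ge0 ?sumr_ge0. Qed.

Lemma gam_mean_le1 (D : {set V}) u : #|D|%:R^-1 * \sum_(v in D) gam v u <= 1.
Proof.
have [->|D0] := eqVneq D set0; first by rewrite big_set0 mulr0.
have D1 : 0 < #|D|%:R :> R by rewrite ltr0n card_gt0.
rewrite mulrC ler_pdivrMr // mul1r -sum1_card natr_sum.
exact: ler_sum.
Qed.

Lemma matthews_potential_ge0 (alpha : R) (u : V) (D : {set V}) : 0 <= alpha ->
  0 <= matthews_potential alpha 1 u D.
Proof.
have [->|D0] := eqVneq D set0; first by rewrite matthews_potential0.
move=> a0; apply: mulr_ge0 => //; rewrite mul1r subr_ge0.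
by apply: le_trans (gam_mean_le1 _ _) _; rewrite harmonic_number_ge1 ?card_gt0.
Qed.

Lemma matthews_potential_le (alpha beta : R) (u : V) (D : {set V}) : 0 <= alpha ->
  matthews_potential alpha beta u D <= alpha * (beta * harmonic_number R #|D|).
Proof. by move=> a0; rewrite ler_wpM2l // gerBl gam_mean_ge0. Qed.

Lemma matthews_potential_ge (alpha beta : R) (u : V) (D : {set V}) : 0 <= alpha ->
  alpha * (beta * harmonic_number R #|D| - 1) <= matthews_potential alpha beta u D.
Proof. by move=> a0; rewrite ler_wpM2l // lerD2l lerN2 gam_mean_le1. Qed.

Lemma avg_matthews_potential (alpha beta : R) (D : {set V}) u :
  \sum_w P u w * matthews_potential alpha beta w D =
  matthews_potential alpha beta u D -
  #|D|%:R^-1 * \sum_(v in D) alpha * (\sum_w P u w * gam v w - gam v u).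
Proof.
rewrite /matthews_potential.
under eq_bigr => w _ do rewrite mulrCA mulrBr.
rewrite -mulr_sumr sumrB -mulr_sumr sumrB -mulr_suml P_sum1 mul1r.
have -> : \sum_w P u w * (#|D|%:R^-1 * \sum_(v in D) gam v w) =
    #|D|%:R^-1 * \sum_(v in D) \sum_w P u w * gam v w.
  rewrite exchange_big mulr_sumr; apply: eq_bigr => w _.
  by rewrite mulrCA mulr_sumr.
ring.
Qed.

Lemma cardsD1_pred (D : {set V}) w : w \in D -> #|D| = #|D :\ w|.+1.
Proof. by move=> wD; rewrite (cardsD1 w D) wD. Qed.

(** Deleting [w] lowers the harmonic number by [1 / #|D|], at least the share [gam w w / #|D|] that
    leaves the mean; the other terms are then divided by a smaller number and only grow. *)
Lemma matthews_potential_setD1_le (alpha : R) (w : V) (D : {set V}) : 0 <= alpha ->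
  matthews_potential alpha 1 w (D :\ w) <= matthews_potential alpha 1 w D.
Proof.
move=> a0; have [wD|wD] := boolP (w \in D); last first.
  by rewrite (_ : D :\ w = D) //; apply/setDidPl; rewrite disjoint_sym disjoints1.
rewrite ler_wpM2l // !mul1r (cardsD1_pred wD) harmonic_numberS [\sum_(v in D) _](big_setD1 w) //=.
set D' := D :\ w; set s := \sum_(v in D') _.
have [D0|D0] := eqVneq D' set0.
  rewrite /s D0 big_set0 cards0 /harmonic_number big_ord0 addr0 mulr0 invr1 mul1r.
  by rewrite subr0 add0r subr_ge0.
have s0 : 0 <= s by apply: sumr_ge0.
have k0 : 0 < #|D'|%:R :> R by rewrite ltr0n card_gt0.
have h1 : #|D'|.+1%:R^-1 * gam w w <= #|D'|.+1%:R^-1 by rewrite ler_piMr ?invr_ge0.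
have h2 : #|D'|.+1%:R^-1 * s <= #|D'|%:R^-1 * s.
  by rewrite ler_wpM2r // lef_pV2 ?posrE // ler_nat.
move: h1 h2; rewrite mulrDr; set x := _.+1%:R^-1; set y := _^-1; set h := harmonic_number _ _.
set g := gam w w; lra.
Qed.

(** The drift of the mean over [D] pays for one step. The cost is charged only while [D] is
    nonempty, which allows the potentials of two groups to be added. *)
Lemma matthews_potential_super (alpha : R) (D : {set V}) (u : V) : 0 <= alpha ->
  (forall v, v \in D -> 1 <= alpha * (\sum_w P u w * gam v w - gam v u)) ->
  (D != set0)%:R + \sum_w P u w * matthews_potential alpha 1 w (D :\ w) <=
  matthews_potential alpha 1 u D.
Proof.
move=> a0 drift.
apply: le_trans (_ : (D != set0)%:R + \sum_w P u w * matthews_potential alpha 1 w D <= _).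
  rewrite lerD2l; apply: ler_sum => w _.
  by rewrite ler_wpM2l // matthews_potential_setD1_le.
rewrite avg_matthews_potential addrCA gerDl subr_le0.
have [->|D0] := eqVneq D set0; first by rewrite big_set0 mulr0.
have D1 : 0 < #|D|%:R :> R by rewrite ltr0n card_gt0.
rewrite mulrC ler_pdivlMr // mul1r -sum1_card natr_sum.
exact: ler_sum.
Qed.

(** Dividing the remaining terms by [#|D| - 1] instead of [#|D|] raises the mean by at most
    [eps / #|D|], as each of them is at most [eps]; the factor [1 - eps] on the harmonic number
    compensates exactly this. *)
Lemma matthews_potential_setD1_ge (alpha eps : R) (w : V) (D : {set V}) : 0 <= alpha -> 0 <= eps ->
  (w \in D -> forall v, v \in D -> v != w -> gam v w <= eps) ->
  matthews_potential alpha (1 - eps) w D <= matthews_potential alpha (1 - eps) w (D :\ w)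
    + alpha * ((w \in D)%:R * (1 - gam w w)).
Proof.
move=> a0 e0 heps; have [wD|wD] := boolP (w \in D); last first.
  rewrite (_ : D :\ w = D) ?mul0r ?mulr0 ?addr0 //.
  by apply/setDidPl; rewrite disjoint_sym disjoints1.
rewrite mul1r -mulrDr ler_wpM2l // (cardsD1_pred wD) harmonic_numberS [\sum_(v in D) _](big_setD1 w) //=.
set D' := D :\ w; set s := \sum_(v in D') _.
have k1 : 0 < #|D'|.+1%:R^-1 :> R by rewrite invr_gt0 ltr0n.
have k2 : #|D'|.+1%:R^-1 <= 1 :> R by rewrite invf_le1 ?ler1n ?ltr0n.
have hs : #|D'|%:R^-1 * s <= #|D'|.+1%:R^-1 * s + #|D'|.+1%:R^-1 * eps.
  have [D0|D0] := eqVneq D' set0.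
    by rewrite /s D0 big_set0 !mulr0 add0r mulr_ge0 // invr_ge0.
  have k0 : 0 < #|D'|%:R :> R by rewrite ltr0n card_gt0.
  have s1 : s <= #|D'|%:R * eps.
    rewrite -sum1_card natr_sum mulr_suml; apply: ler_sum => v; rewrite mul1r.
    by rewrite in_setD1 => /andP[vw vD]; exact: heps.
  rewrite -mulrDr mulrC ler_pdivrMr //.
  rewrite -(ler_pM2l (x := #|D'|.+1%:R)) ?ltr0n // !mulrA mulfV ?gt_eqF ?ltr0n //.
  by rewrite mul1r -natr1; lra.
have hg : #|D'|.+1%:R^-1 * (1 - gam w w) <= 1 - gam w w.
  by rewrite ler_piMl // subr_ge0.
move: hs hg; set x := _.+1%:R^-1; set y := _^-1.
set h := harmonic_number _ _; set g := gam w w; nra.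
Qed.

End MatthewsPotential.

(** * The degree-biased walk *)

Section WalkKernel.
Context (R : realType) (V : finType) (e : rel V).
Hypothesis e_sym : symmetric e.
Hypothesis deg_gt0 : forall v, (0 < deg e v)%N.

Lemma psi_gt0 v w : 0 < psi R e v w.
Proof. by rewrite invr_gt0 ltr0n leq_min !deg_gt0. Qed.

Lemma psi_sym v w : psi R e v w = psi R e w v.
Proof. by rewrite /psi minnC. Qed.

Lemma sum_adj_cst (v : V) (x : R) : \sum_(w | e v w) x = (deg e v)%:R * x.
Proof.
rewrite /deg -sum1_card natr_sum mulr_suml.
by apply: eq_big => [w|w _]; rewrite ?inE ?mul1r.
Qed.

Lemma Psi_ge1 v : 1 <= Psi R e v.
Proof.
have d0 : 0 < (deg e v)%:R :> R by rewrite ltr0n.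
rewrite -[leLHS](mulfV (lt0r_neq0 d0)) -sum_adj_cst; apply: ler_sum => w _.
by rewrite lef_pV2 ?posrE ?ltr0n ?leq_min ?deg_gt0 // ler_nat geq_minl.
Qed.

Lemma Psi_gt0 v : 0 < Psi R e v.
Proof. exact: lt_le_trans ltr01 (Psi_ge1 v). Qed.

Lemma walk_step_ge0 v w : 0 <= walk_step R e v w.
Proof. by rewrite /walk_step; case: ifP => // _; rewrite divr_ge0 ?ltW ?psi_gt0 ?Psi_gt0. Qed.

Lemma walk_step_sum1 v : \sum_w walk_step R e v w = 1.
Proof.
rewrite /walk_step -big_mkcond /= -mulr_suml -/(Psi R e v).
by rewrite divff // gt_eqF ?Psi_gt0.
Qed.

Lemma Psi_walk_step v w : Psi R e v * walk_step R e v w = if e v w then psi R e v w else 0.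
Proof.
rewrite /walk_step; case: ifP => _; last by rewrite mulr0.
by rewrite mulrC divfK // gt_eqF ?Psi_gt0.
Qed.

Lemma walk_step_rev v w :
  Psi R e v * walk_step R e v w = Psi R e w * walk_step R e w v.
Proof. by rewrite !Psi_walk_step e_sym psi_sym. Qed.

Lemma walk_step_le (K : R) v w : 0 < K -> (e v w -> K <= (deg e v)%:R /\ K <= (deg e w)%:R) ->
  walk_step R e v w <= K^-1.
Proof.
rewrite /walk_step => K0; case: ifP => [evw /(_ isT)[h1 h2]|_ _]; last by rewrite invr_ge0 ltW.
rewrite ler_pdivrMr ?Psi_gt0 //; apply: le_trans (_ : K^-1 <= _).
  rewrite lef_pV2 ?posrE ?ltr0n ?leq_min ?deg_gt0 //.
  by rewrite /minn; case: ifP.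
by rewrite ler_peMr ?Psi_ge1 // invr_ge0 ltW.
Qed.

Local Notation P := (walk_step R e).
Let P_ge0 := walk_step_ge0.
Let P_sum1 := walk_step_sum1.

Section Bounds.
Variable T : nat.
Hypothesis T_gt0 : (0 < T)%N.

Definition hit_potential (v u : V) : R := green P v T u / green P v T v.

Lemma green_diag_ge1 v : 1 <= green P v T v.
Proof.
apply: le_trans (green_diag_ge P_ge0 v T).
have : 2^-1 ^+ T <= 2^-1 :> R.
  by case: T T_gt0 => // t _; rewrite exprS ler_piMr // exprn_ile1 // invf_le1 // ler1n.
lra.
Qed.

Let green_diag_gt0 v : 0 < green P v T v.
Proof. exact: lt_le_trans ltr01 (green_diag_ge1 v). Qed.

Lemma hit_potential_ge0 v u : 0 <= hit_potential v u.
Proof. by rewrite divr_ge0 ?(green_ge0 P_ge0). Qed.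

Lemma hit_potential_le1 v u : hit_potential v u <= 1.
Proof. by rewrite ler_pdivrMr // mul1r green_le_diag. Qed.

Lemma hit_potential_diag v : hit_potential v v = 1.
Proof. by rewrite /hit_potential divff // gt_eqF. Qed.

(** This is [green_poisson] off [v]. For large [T] the right-hand side hardly depends on [u], so
    [hit_potential v] grows at a nearly constant rate. *)
Lemma hit_potential_drift v u : u != v ->
  \sum_w P u w * hit_potential v w - hit_potential v u =
  2 * lazy_prob P v T u / green P v T v.
Proof.
move=> uv; rewrite /hit_potential; under eq_bigr => w _ do rewrite mulrA.
rewrite -mulr_suml -/(avg P (green P v T) u) green_poisson.
by rewrite /delta_at (negbTE uv) mulr0 subr0 -mulrBl addrAC subrr add0r.
Qed.

Lemma setI_setD1_in (S A : {set V}) w : (S :\ w) :&: A = (S :&: A) :\ w.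
Proof. by rewrite setDE setIAC -setDE. Qed.

(* The few vertices outside [A] get their own rate [a2]: they then cost only
   [a2] times the harmonic number of their cardinality. *)
Definition two_group_potential (A : {set V}) (a1 a2 : R) (u : V) (S : {set V}) : R :=
  matthews_potential hit_potential a1 1 u (S :&: A) +
  matthews_potential hit_potential a2 1 u (S :&: ~: A).

Section Upper.
Variables (A : {set V}) (M1 M2 c : R).
Hypothesis c_gt0 : 0 < c.
Hypothesis prob_ge : forall v u, c <= lazy_prob P v T u.
Hypothesis green_le1 : forall v, v \in A -> green P v T v <= M1.
Hypothesis green_le2 : forall v, v \notin A -> green P v T v <= M2.
Hypothesis M1_ge0 : 0 <= M1.
Hypothesis M2_ge0 : 0 <= M2.

Let a1 := M1 / (2 * c).
Let a2 := M2 / (2 * c).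

Lemma hit_potential_drift_ge (M : R) v u : u != v -> green P v T v <= M ->
  1 <= M / (2 * c) * (\sum_w P u w * hit_potential v w - hit_potential v u).
Proof.
move=> uv gM; rewrite hit_potential_drift //.
have -> : M / (2 * c) * (2 * lazy_prob P v T u / green P v T v) =
    (M / green P v T v) * (lazy_prob P v T u / c) by field; rewrite !gt_eqF.
rewrite -[leLHS]mulr1; apply: ler_pM => //; rewrite ler_pdivlMr // mul1r //.
Qed.

Lemma two_group_potential_ge0 u S : 0 <= two_group_potential A a1 a2 u S.
Proof.
by apply: addr_ge0; apply: matthews_potential_ge0;
  rewrite ?divr_ge0 ?mulr_ge0 ?(ltW c_gt0) //; exact: hit_potential_le1.
Qed.

Lemma two_group_potential_super (u : V) (S : {set V}) : u \notin S -> S != set0 ->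
  1 + \sum_w P u w * two_group_potential A a1 a2 w (S :\ w) <=
  two_group_potential A a1 a2 u S.
Proof.
move=> uS S0; rewrite /two_group_potential.
under eq_bigr => w _ do rewrite mulrDr !setI_setD1_in.
rewrite big_split /=.
have sup a (D : {set V}) (M : R) : 0 <= M -> D \subset S -> a = M / (2 * c) ->
   (forall v, v \in D -> green P v T v <= M) ->
   (D != set0)%:R + \sum_w P u w * matthews_potential hit_potential a 1 w (D :\ w) <=
   matthews_potential hit_potential a 1 u D.
  move=> M0 DS -> hM; apply: matthews_potential_super => //.
  - exact: hit_potential_ge0.
  - exact: hit_potential_le1.
  - by rewrite divr_ge0 ?mulr_ge0 ?(ltW c_gt0).
  - move=> v vD; apply: hit_potential_drift_ge; last exact: hM.
    by apply: contraNneq uS => ->; exact: (fintype.subsetP DS _ vD).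
have := sup a1 (S :&: A) M1 M1_ge0 (subsetIl _ _) erefl.
have := sup a2 (S :&: ~: A) M2 M2_ge0 (subsetIl _ _) erefl.
move=> /(_ _)/wrap[v|h2]; first by rewrite !inE => /andP[_]; exact: green_le2.
move=> /(_ _)/wrap[v|h1]; first by rewrite !inE => /andP[_]; exact: green_le1.
(* A nonempty [S] meets [A] or its complement, so at least one group pays for the step. *)
have h0 : 1 <= (S :&: A != set0)%:R + (S :&: ~: A != set0)%:R :> R.
  rewrite -natrD ler1n; case: eqP => [hA|_] //=; case: eqP => [hB|_] //=.
  by move: S0; rewrite -(setID S A) setDE hA hB setU0 eqxx.
apply: le_trans (lerD h1 h2); move: h0; lra.
Qed.

Lemma expected_cover_time_upper u :
  (expected_cover_time R e u <=
   (a1 * harmonic_number R #|V| + a2 * harmonic_number R #|~: A|)%:E)%E.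
Proof.
apply: le_trans (expected_cover_time_le P_ge0 P_sum1 two_group_potential_ge0
  two_group_potential_super u) _.
have a10 : 0 <= a1 by rewrite divr_ge0 ?mulr_ge0 ?(ltW c_gt0).
have a20 : 0 <= a2 by rewrite divr_ge0 ?mulr_ge0 ?(ltW c_gt0).
rewrite lee_fin lerD //;
  (apply: le_trans (matthews_potential_le hit_potential_ge0 _ _ _ _) _; first by []);
  rewrite mul1r ler_wpM2l // le_harmonic_number //.
  exact: max_card.
by rewrite subset_leq_card // subsetIr.
Qed.

Section Lower.
Variables (A' : {set V}) (m c' eps : R).
Hypothesis c'_gt0 : 0 < c'.
Hypothesis m_ge0 : 0 <= m.
Hypothesis eps_ge0 : 0 <= eps.
Hypothesis eps_le1 : eps <= 1.
Hypothesis prob_le : forall v u, v \in A' -> lazy_prob P v T u <= c'.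
Hypothesis green_ge : forall v, v \in A' -> m <= green P v T v.
Hypothesis green_small : forall v w, v \in A' -> w \in A' -> v != w ->
  green P v T w <= eps.

Let a := m / (2 * c').

Let a_ge0 : 0 <= a. Proof. by rewrite divr_ge0 ?mulr_ge0 ?(ltW c'_gt0). Qed.

(** Only the time to exhaust [A'] is bounded from below; other visits are ignored. The error term of
    [matthews_potential_setD1_ge] vanishes because the potential of a vertex is exactly 1 at that
    vertex. *)
Lemma lower_potential_sub (u : V) (S : {set V}) : u \notin S -> S != set0 ->
  matthews_potential hit_potential a (1 - eps) u (S :&: A') <=
  1 + \sum_w P u w * matthews_potential hit_potential a (1 - eps) w ((S :\ w) :&: A').
Proof.
move=> uS S0; under eq_bigr => w _ do rewrite setI_setD1_in.
set D := S :&: A'.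
apply: le_trans (_ : 1 + \sum_w P u w * matthews_potential hit_potential a (1 - eps) w D <= _).
  rewrite avg_matthews_potential // addrCA lerDl subr_ge0.
  have [->|D0] := eqVneq D set0; first by rewrite big_set0 mulr0.
  have D1 : 0 < #|D|%:R :> R by rewrite ltr0n card_gt0.
  rewrite mulrC ler_pdivrMr // mul1r -sum1_card natr_sum.
  apply: ler_sum => v; rewrite inE => /andP[vS vA]; rewrite hit_potential_drift; last first.
    by apply: contraNneq uS => ->.
  have -> : a * (2 * lazy_prob P v T u / green P v T v) =
    (m / green P v T v) * (lazy_prob P v T u / c') by rewrite /a; field; rewrite !gt_eqF.
  rewrite -[leRHS]mulr1; apply: ler_pM.
  - by rewrite divr_ge0 // ltW.
  - by rewrite divr_ge0 ?(ltW c'_gt0) ?(lazy_prob_ge0 P_ge0).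
  - by rewrite ler_pdivrMr // mul1r green_ge.
  - by rewrite ler_pdivrMr // mul1r prob_le.
rewrite lerD2l; apply: ler_sum => w _; rewrite ler_wpM2l ?P_ge0 //.
apply: le_trans (matthews_potential_setD1_ge hit_potential_le1 a_ge0 eps_ge0 _) _.
- rewrite inE => /andP[_ wA] v; rewrite inE => /andP[_ vA] vw.
  rewrite ler_pdivrMr //; apply: le_trans (green_small vA wA vw) _.
  by rewrite ler_peMr // green_diag_ge1.
- by rewrite hit_potential_diag subrr !mulr0 addr0.
Qed.

(** The predecessor accounts for a start inside [A'], visited at time 0; the last [- 1] bounds the
    mean potential at the start. *)
Lemma expected_cover_time_lower u :
  ((a * ((1 - eps) * harmonic_number R #|A'|.-1 - 1))%:E <= expected_cover_time R e u)%E.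
Proof.
pose Phi u (S : {set V}) := matthews_potential hit_potential a (1 - eps) u (S :&: A').
have e1 : 0 <= 1 - eps by rewrite subr_ge0.
apply: le_trans (expected_cover_time_ge (Phi := Phi)
    (M := a * ((1 - eps) * harmonic_number R #|V|)) P_ge0 P_sum1
    two_group_potential_ge0 two_group_potential_super _ _ _ _ u).
- rewrite lee_fin; apply: le_trans (matthews_potential_ge hit_potential_le1 _ _ _ _) => //.
  rewrite ler_wpM2l // lerD2r ler_wpM2l // le_harmonic_number //.
  by rewrite setIC -setDE (cardsD1 u A'); case: (u \in A');
    rewrite ?add1n ?add0n /= ?leqnn ?leq_pred.
- by move=> w; rewrite /Phi set0I matthews_potential0.
- move=> w S; apply: le_trans (matthews_potential_le hit_potential_ge0 _ _ _ _) _ => //.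
  by rewrite !ler_wpM2l // le_harmonic_number // max_card.
- by rewrite mulr_ge0 // mulr_ge0 // harmonic_number_ge0.
- exact: lower_potential_sub.
Qed.

End Lower.
End Upper.
End Bounds.
End WalkKernel.

(** * Cheeger's inequality *)

Lemma sqr_pos_part_le (R : realType) (a b : R) :
  (Num.max 0 a - Num.max 0 b) ^+ 2 <= (a - b) ^+ 2.
Proof.
case: (leP 0 a) => ha; case: (leP 0 b) => hb.
- by [].
- by rewrite subr0 ler_sqr ?nnegrE; lra.
- by rewrite sub0r sqrrN -[leRHS]sqrrN ler_sqr ?nnegrE; lra.
- by rewrite subrr expr0n sqr_ge0.
Qed.

Section Cheeger.
Context (R : realType) (V : finType) (e : rel V) (H : {set V}).
Variables (kap Dlt : R).
Hypothesis e_sym : symmetric e.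
Hypothesis kap_gt0 : 0 < kap.
Hypothesis Dlt_gt0 : 0 < Dlt.
Hypothesis degH_le : forall x, \sum_(y in H | e x y) 1 <= Dlt.
Hypothesis expansion : forall S : {set V}, S \subset H -> (2 * #|S| <= #|H|)%N ->
  kap * #|S|%:R <= \sum_(x in S) \sum_(y in H :\: S | e x y) 1.

(* Induction on the support: subtracting the least positive value of [phi]
   peels off one level set, to which [expansion] applies. *)
Lemma coarea (phi : V -> R) : (forall x, 0 <= phi x) ->
  (2 * #|[set x in H | (0 < phi x)%R]| <= #|H|)%N ->
  kap * \sum_(x in H) phi x <=
  \sum_(x in H) \sum_(y in H | e x y) Num.max 0 (phi x - phi y).
Proof.
have [n] := ubnP #|[set x in H | (0 < phi x)%R]|; elim: n phi => // n IH phi.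
set S := [set x in H | _]; rewrite ltnS => Sn phi0 SH.
have phiS x : x \in H -> x \notin S -> phi x = 0.
  move=> xH; rewrite inE xH /= -leNgt => h; apply/eqP.
  by rewrite eq_le h phi0.
have sSH : S \subset H by apply/fintype.subsetP => x; rewrite inE => /andP[].
have [S0|[x0 x0S]] := set_0Vmem S.
  rewrite big1 => [|x xH]; last by apply: phiS => //; rewrite S0 inE.
  rewrite mulr0; apply: sumr_ge0 => x _; apply: sumr_ge0 => y _.
  by rewrite le_max lexx.
have [z zS zmin] : exists2 z, z \in S & forall x, x \in S -> phi z <= phi x.
  by case: (arg_minP phi x0S) => z zS zmin; exists z.
set a := phi z; have a0 : 0 < a by move: zS; rewrite inE => /andP[].
pose psi x := if x \in S then phi x - a else phi x.
have psi0 x : 0 <= psi x.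
  by rewrite /psi; case: ifP => // xS; rewrite subr_ge0; exact: zmin.
have hS : [set x in H | 0 < psi x] \subset S :\ z.
  apply/fintype.subsetP => x; rewrite !inE /psi => /andP[xH].
  case: ifP => xS; last by rewrite phiS ?ltxx ?xS.
  rewrite xH /=; move: xS; rewrite inE xH /= => ->; rewrite andbT.
  by apply: contraTneq => ->; rewrite subrr ltxx.
have hcard : (#|[set x in H | (0 < psi x)%R]| < #|S|)%N.
  by rewrite (cardsD1 z S) zS ltnS subset_leq_card.
have := IH psi (leq_trans hcard Sn) psi0; rewrite -/S => /(_ _)/wrap[|hpsi].
  by apply: leq_trans SH; rewrite leq_pmul2l // ltnW.
have -> : \sum_(x in H) phi x = \sum_(x in H) psi x + a * #|S|%:R.
  have -> : a * #|S|%:R = \sum_(x in H) (if x \in S then a else 0).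
    rewrite -big_mkcondr /= (eq_bigl (mem S)) => [|x]; first by rewrite sumr_const mulr_natr.
    by apply: andb_idl; exact: (fintype.subsetP sSH).
  rewrite -big_split /=; apply: eq_bigr => x xH.
  by rewrite /psi; case: ifP => _; rewrite ?subrK ?addr0.
rewrite mulrDr mulrCA; apply: le_trans (lerD hpsi (ler_wpM2l (ltW a0) (expansion sSH SH))) _.
have -> : \sum_(x in S) \sum_(y in H :\: S | e x y) 1 =
   \sum_(x in H) \sum_(y in H | e x y) ((x \in S) && (y \notin S))%:R :> R.
  rewrite [RHS](bigID (mem S)) /= [X in _ + X]big1 ?addr0 => [|x /andP[_ /negbTE ->]]; last first.
    by rewrite big1.
  apply: eq_big => [x|x xS].
    by rewrite andb_idl //; exact: (fintype.subsetP sSH).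
  rewrite xS /= [RHS](bigID (mem S)) /= [X in X + _]big1 ?add0r => [|y /andP[_ ->]] //.
  apply: eq_big => [y|y]; first by rewrite inE -andbA andbC.
  by rewrite inE => /andP[/andP[-> _] _].
rewrite mulr_sumr -big_split /=; apply: ler_sum => x xH.
rewrite mulr_sumr -big_split /=; apply: ler_sum => y /andP[yH _].
rewrite /psi; case: ifP => xS; case: ifP => yS /=.
- by rewrite mulr0 addr0 opprB addrA subrK.
- rewrite mulr1 (phiS y yH) ?yS // !subr0.
  have h1 : 0 <= phi x - a by rewrite subr_ge0 zmin.
  by rewrite !max_r ?subrK.
- rewrite mulr0 addr0 (phiS x xH) ?xS // !sub0r.
  have h1 : a <= phi y by rewrite zmin.
  by rewrite !max_l ?oppr_le0 ?subr_ge0 // phi0.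
- by rewrite mulr0 addr0.
Qed.

(** Apply [coarea] to [g ^+ 2], factor [g x ^+ 2 - g y ^+ 2], and separate the factors by a weighted
    AM-GM inequality. *)
Lemma cheeger_halfspace (g : V -> R) : (forall x, 0 <= g x) ->
  (2 * #|[set x in H | (0 < g x)%R]| <= #|H|)%N ->
  \sum_(x in H) g x ^+ 2 <=
  4 * Dlt / kap ^+ 2 * \sum_(x in H) \sum_(y in H | e x y) (g x - g y) ^+ 2.
Proof.
move=> g0 gH.
have := @coarea (fun x => g x ^+ 2) (fun x => sqr_ge0 _).
rewrite (_ : [set x in H | 0 < g x ^+ 2] = [set x in H | 0 < g x]); last first.
  by apply/setP => x; rewrite !inE exprn_even_gt0 // lt_def g0 andbT.
move=> /(_ gH) hco.
(* With this weight the terms [g x ^+ 2 + g y ^+ 2] cost at most [2 * t * Dlt * s = kap / 2 * s],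
   half of the left-hand side of [hco]. *)
pose t := kap / (4 * Dlt); have t0 : 0 < t by rewrite divr_gt0 ?mulr_gt0.
set E := \sum_(x in H) \sum_(y in H | e x y) (g x - g y) ^+ 2.
set s := \sum_(x in H) g x ^+ 2 in hco *.
have s0 : 0 <= s by apply: sumr_ge0 => x _; exact: sqr_ge0.
have hs1 : \sum_(x in H) \sum_(y in H | e x y) g x ^+ 2 <= Dlt * s.
  rewrite mulr_sumr; apply: ler_sum => x _.
  under eq_bigr => y _ do rewrite -[g x ^+ 2]mul1r.
  by rewrite -mulr_suml ler_wpM2r ?sqr_ge0.
have hs2 : \sum_(x in H) \sum_(y in H | e x y) g y ^+ 2 <= Dlt * s.
  rewrite (exchange_big_dep (mem H)) /=; last by move=> x y _ /andP[].
  apply: le_trans hs1; apply: ler_sum => y yH; rewrite le_eqVlt; apply/orP; left.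
  by apply/eqP; apply: eq_bigl => x; rewrite yH e_sym.
have hAG : \sum_(x in H) \sum_(y in H | e x y) Num.max 0 (g x ^+ 2 - g y ^+ 2) <=
    (2 * t)^-1 * E + t * (Dlt * s + Dlt * s).
  apply: (le_trans (y := (2 * t)^-1 * E + t * (\sum_(x in H) \sum_(y in H | e x y) g x ^+ 2
      + \sum_(x in H) \sum_(y in H | e x y) g y ^+ 2))); last first.
    by rewrite lerD2l ler_wpM2l ?(ltW t0) // lerD.
  rewrite -big_split /= !mulr_sumr -big_split /=; apply: ler_sum => x _.
  rewrite -big_split /= !mulr_sumr -big_split /=; apply: ler_sum => y _.
  have k0 : 0 < (2 * t)^-1 by rewrite invr_gt0 mulr_gt0.
  have h1 : 0 <= (2 * t)^-1 * (g x - g y) ^+ 2 by rewrite mulr_ge0 ?sqr_ge0 ?ltW.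
  have h2 : 0 <= t * (g x ^+ 2 + g y ^+ 2).
    by rewrite mulr_ge0 ?(ltW t0) // addr_ge0 // sqr_ge0.
  rewrite ge_max addr_ge0 //=.
  have kt : (2 * t)^-1 * (2 * t) = 1 by rewrite mulVf // gt_eqF // mulr_gt0.
  set k := (2 * t)^-1 in k0 h1 kt *.
  have : 0 <= k * ((g x - g y) - t * (g x + g y)) ^+ 2 by rewrite mulr_ge0 ?sqr_ge0 ?ltW.
  have -> : k * ((g x - g y) - t * (g x + g y)) ^+ 2 =
     k * (g x - g y) ^+ 2 - (k * (2 * t)) * (g x ^+ 2 - g y ^+ 2)
       + (k * (2 * t)) * (t / 2) * (g x + g y) ^+ 2 by field.
  rewrite kt !mul1r.
  have : 0 <= t / 2 * (g x - g y) ^+ 2 by rewrite mulr_ge0 ?sqr_ge0 // divr_ge0 // ltW.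
  nra.
have hh := le_trans hco hAG.
have e1 : t * (Dlt * s + Dlt * s) = kap / 2 * s by rewrite /t; field; rewrite gt_eqF.
have e2 : (2 * t)^-1 = 2 * Dlt / kap by rewrite /t; field; rewrite !gt_eqF.
rewrite e1 e2 in hh.
have : kap / 2 * s <= 2 * Dlt / kap * E by lra.
rewrite -(ler_pM2l (_ : 0 < 2 / kap)) ?divr_gt0 //.
have -> : 2 / kap * (kap / 2 * s) = s by field; rewrite gt_eqF.
by have -> : 2 / kap * (2 * Dlt / kap * E) = 4 * Dlt / kap ^+ 2 * E by field; rewrite gt_eqF.
Qed.

(** Take the least value [f z] on [H] that is exceeded on at most half of [H]. The largest value
    [f y] below it is exceeded on more than half, and the vertices below [f z] are all among the
    others. *)
Lemma median_exists (f : V -> R) : exists m : R,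
  (2 * #|[set x in H | (m < f x)%R]| <= #|H|)%N /\
  (2 * #|[set x in H | (f x < m)%R]| <= #|H|)%N.
Proof.
have [H0|[x0 x0H]] := set_0Vmem H.
  by exists 0; rewrite H0; split; rewrite eq_card0 // => x; rewrite !inE.
pose up x := [set y in H | (f x < f y)%R].
pose ok x := (x \in H) && (2 * #|up x| <= #|H|)%N.
have [x1 x1ok] : exists x1, ok x1.
  case: (arg_maxP f x0H) => z zH zmax; exists z; apply/andP; split=> //.
  rewrite (_ : up z = set0) ?cards0 ?muln0 //; apply/setP => y; rewrite !inE.
  by apply/negP => /andP[yH]; rewrite ltNge => /negP[]; exact: zmax.
case: (arg_minP f x1ok) => z /andP[zH zup] zmin; exists (f z); split => //.
set B := [set _ in H | _].
have [->|[y0 y0B]] := set_0Vmem B; first by rewrite cards0.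
case: (arg_maxP f y0B) => y yB ymax.
have /andP[yH yz] : (y \in H) && (f y < f z) by have : y \in B := yB; rewrite inE.
have : ~~ ok y by apply/negP => hy; have : f z <= f y := zmin _ hy; rewrite leNgt yz.
rewrite /ok yH /= -ltnNge => hup.
have : (#|up y| + #|B| <= #|H|)%N.
  rewrite -cardsUI (_ : up y :&: B = set0); last first.
    apply/setP => x; rewrite !inE; apply/negP => /andP[/andP[xH]].
    by rewrite ltNge => /negP h h2; apply: h; apply: ymax; suff: x \in B by []; rewrite inE.
  rewrite cards0 addn0; apply: subset_leq_card; apply/fintype.subsetP => x.
  by rewrite !inE => /orP[] /andP[].
move: hup; lia.
Qed.

(** At a median, the positive and negative parts of [f - m] each live on at most half of [H], and
    neither has more energy than [f]; hence 8 = 4 + 4. *)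
Lemma cheeger_poincare (f : V -> R) : exists m : R,
  \sum_(x in H) (f x - m) ^+ 2 <=
  8 * Dlt / kap ^+ 2 * \sum_(x in H) \sum_(y in H | e x y) (f x - f y) ^+ 2.
Proof.
have [m [m1 m2]] := median_exists f; exists m.
pose gp x := Num.max 0 (f x - m); pose gm x := Num.max 0 (m - f x).
have gp0 x : 0 <= gp x by rewrite le_max lexx.
have gm0 x : 0 <= gm x by rewrite le_max lexx.
have := cheeger_halfspace gp0; rewrite (_ : [set x in H | 0 < gp x] = [set x in H | m < f x]); last first.
  by apply/setP => x; rewrite !inE lt_max ltxx /= subr_gt0.
move=> /(_ m1) h1.
have := cheeger_halfspace gm0; rewrite (_ : [set x in H | 0 < gm x] = [set x in H | f x < m]); last first.
  by apply/setP => x; rewrite !inE lt_max ltxx /= subr_gt0.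
move=> /(_ m2) h2.
have c0 : 0 <= 4 * Dlt / kap ^+ 2 by rewrite divr_ge0 ?mulr_ge0 ?sqr_ge0 // ltW.
have -> : \sum_(x in H) (f x - m) ^+ 2 = \sum_(x in H) gp x ^+ 2 + \sum_(x in H) gm x ^+ 2.
  rewrite -big_split; apply: eq_bigr => x _; rewrite /gp /gm /=.
  by case: (leP 0 (f x - m)) => h; case: (leP 0 (m - f x)) => h'; nra.
have hE (g : V -> R) : (forall x y, (g x - g y) ^+ 2 <= (f x - f y) ^+ 2) ->
   4 * Dlt / kap ^+ 2 * \sum_(x in H) \sum_(y in H | e x y) (g x - g y) ^+ 2 <=
   4 * Dlt / kap ^+ 2 * \sum_(x in H) \sum_(y in H | e x y) (f x - f y) ^+ 2.
  by move=> hg; rewrite ler_wpM2l //; apply: ler_sum => x _; apply: ler_sum.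
apply: le_trans (lerD (le_trans h1 (hE _ _)) (le_trans h2 (hE _ _))) _.
- move=> x y; apply: le_trans (sqr_pos_part_le _ _) _.
  by rewrite (_ : f x - m - (f y - m) = f x - f y) //; ring.
- move=> x y; apply: le_trans (sqr_pos_part_le _ _) _.
  by rewrite (_ : (m - f x - (m - f y)) ^+ 2 = (f x - f y) ^+ 2) //; ring.
- by rewrite le_eqVlt; apply/orP; left; apply/eqP; field; rewrite gt_eqF.
Qed.

End Cheeger.

(** * Poincare inequality for the biased walk *)

Section GraphPoincare.
Context (R : realType) (V : finType) (e : rel V) (d eta K kap : R).
Hypothesis e_sym : symmetric e.
Hypothesis deg_gt0 : forall v, (0 < deg e v)%N.
Hypothesis d_gt0 : 0 < d.
Hypothesis eta_gt0 : 0 < eta.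
Hypothesis kap_gt0 : 0 < kap.
Hypothesis K_gt0 : 0 < K.

Let d_ge0 : 0 <= d := ltW d_gt0.
Let eta_ge0 : 0 <= eta := ltW eta_gt0.
Let K_ge0 : 0 <= K := ltW K_gt0.

Definition high_deg : {set V} := [set v | eta * d <= (deg e v)%:R].
Local Notation H := high_deg.

Hypothesis deg_le : forall v, (deg e v)%:R <= K * d.
Hypothesis low_indep : forall v w, v \notin H -> e v w -> w \in H.
Hypothesis low_nbr_le1 : forall w, (#|[set u | e w u & u \notin H]| <= 1)%N.
Hypothesis expansion : forall S : {set V}, S \subset H -> (2 * #|S| <= #|H|)%N ->
  kap * d * #|S|%:R <= \sum_(x in S) \sum_(y in H :\: S | e x y) 1.

Lemma psi_le1 v w : psi R e v w <= 1.
Proof. by rewrite invf_le1 ?ltr0n ?ler1n ?leq_min ?deg_gt0. Qed.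

Lemma psi_ge v w : (K * d)^-1 <= psi R e v w.
Proof.
rewrite lef_pV2 ?posrE ?mulr_gt0 ?ltr0n ?leq_min ?deg_gt0 //.
by rewrite /minn; case: ifP.
Qed.

(** The high neighbours give at most [deg / (eta * d) <= K / eta]; there is at most one low
    neighbour, and it gives at most 1. *)
Lemma Psi_high_le v : v \in H -> Psi R e v <= K / eta + 1.
Proof.
move=> vH; rewrite /Psi (bigID (mem H)) /=; apply: lerD.
  apply: le_trans (_ : \sum_(w | e v w) (eta * d)^-1 <= _).
    rewrite big_mkcondr /=; apply: ler_sum => w _; case: ifP => wH; last first.
      by rewrite invr_ge0 mulr_ge0.
    rewrite lef_pV2 ?posrE ?mulr_gt0 ?ltr0n ?leq_min ?deg_gt0 //.
    by move: vH wH; rewrite !inE /minn; case: ifP.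
  rewrite sum_adj_cst ler_pdivrMr ?mulr_gt0 //.
  have -> : K / eta * (eta * d) = K * d by field; rewrite gt_eqF.
  exact: deg_le.
apply: le_trans (_ : \sum_(w | e v w && (w \notin H)) 1 <= _).
  by apply: ler_sum => w _; exact: psi_le1.
rewrite sumr_const lern1; move: (low_nbr_le1 v).
by rewrite (@eq_card _ _ [pred w | e v w && (w \notin H)]) // => w; rewrite !inE.
Qed.

Lemma Psi_low v : v \notin H -> Psi R e v = 1.
Proof.
move=> vH; have d0 : 0 < (deg e v)%:R :> R by rewrite ltr0n.
rewrite -[RHS](mulfV (lt0r_neq0 d0)) -sum_adj_cst; apply: eq_bigr => w evw.
rewrite /psi (minn_idPl _) // -(ler_nat R).
have := low_indep vH evw; move: vH; rewrite !inE -ltNge => h1 h2.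
exact: le_trans (ltW h1) h2.
Qed.

Lemma Psi_le v : Psi R e v <= K / eta + 1.
Proof.
have [vH|vH] := boolP (v \in H); first exact: Psi_high_le.
by rewrite Psi_low // lerDr divr_ge0.
Qed.

Definition pair_energy (f : V -> R) : R :=
  \sum_x \sum_(y | e x y) psi R e x y * (f x - f y) ^+ 2.

Lemma dirichlet_pair_energy f :
  dirichlet (walk_step R e) (Psi R e) f = pair_energy f / 2.
Proof.
have -> : dirichlet (walk_step R e) (Psi R e) f =
    \sum_x \sum_y (if e x y then psi R e x y else 0) * (f x * (f x - f y)).
  apply: eq_bigr => x _; rewrite mulrAC mulrBr {1}/Psi big_mkcond /=.
  rewrite [Psi _ _ _ * avg _ _ _]mulr_sumr mulr_suml -sumrB mulr_suml.
  apply: eq_bigr => y _.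
  rewrite mulrA Psi_walk_step //; ring.
have -> : pair_energy f =
    \sum_x \sum_y (if e x y then psi R e x y else 0) * (f x - f y) ^+ 2.
  apply: eq_bigr => x _; rewrite big_mkcond; apply: eq_bigr => y _.
  by case: ifP => _; rewrite ?mul0r.
have sym : \sum_x \sum_y (if e x y then psi R e x y else 0) * (f x * (f x - f y)) =
   \sum_x \sum_y (if e x y then psi R e x y else 0) * (f y * (f y - f x)).
  rewrite exchange_big; apply: eq_bigr => x _; apply: eq_bigr => y _.
  by rewrite e_sym psi_sym.
set s := (X in X = _ / 2) in sym *.
suff -> : \sum_x \sum_y (if e x y then psi R e x y else 0) * (f x - f y) ^+ 2 = s + s by field.
rewrite [X in _ = _ + X]sym /s -big_split; apply: eq_bigr => x _; rewrite -big_split.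
by apply: eq_bigr => y _; rewrite /=; ring.
Qed.

Let B := 8 * K ^+ 2 / kap ^+ 2.

Let B_ge0 : 0 <= B. Proof. by rewrite /B divr_ge0 ?sqr_ge0 // mulr_ge0 ?sqr_ge0. Qed.

(** Cheeger's inequality concerns unweighted edges. Each weight [psi] is at least [1 / (K * d)], and
    the powers of [d] cancel against degree bound [K * d] and expansion [kap * d]. *)
Lemma high_energy f : exists m : R,
  \sum_(x in H) (f x - m) ^+ 2 <= B * pair_energy f.
Proof.
have Kd0 : 0 < K * d by rewrite mulr_gt0.
have kd0 : 0 < kap * d by rewrite mulr_gt0.
have degH x : \sum_(y in H | e x y) 1 <= K * d.
  apply: le_trans (deg_le x); rewrite -[leRHS]mulr1 -sum_adj_cst.
  by rewrite [leLHS]big_mkcondl; apply: ler_sum => y _; case: ifP.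
have [m hm] := cheeger_poincare e_sym kd0 Kd0 degH expansion f.
exists m; apply: le_trans hm _.
have -> : B * pair_energy f = 8 * (K * d) / (kap * d) ^+ 2 * (K * d * pair_energy f).
  by rewrite /B; field; rewrite !gt_eqF.
rewrite ler_wpM2l ?divr_ge0 ?sqr_ge0 ?mulr_ge0 ?(ltW Kd0) ?(ltW d_gt0) ?(ltW K_gt0) //.
rewrite mulr_sumr [leLHS]big_mkcond; apply: ler_sum => x _.
rewrite mulr_sumr; case: ifP => _; last first.
  by apply: sumr_ge0 => y _; rewrite mulr_ge0 ?(ltW Kd0) // mulr_ge0 ?sqr_ge0 // ltW // psi_gt0.
rewrite [leLHS]big_mkcondl; apply: ler_sum => y _.
have h : 1 <= K * d * psi R e x y.
  by have := ler_wpM2l (ltW Kd0) (psi_ge x y); rewrite mulfV ?gt_eqF.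
have := ler_wpM2r (sqr_ge0 (f x - f y)) h; rewrite mul1r -[leRHS]mulrA.
by move=> hh; case: ifP => // _; exact: le_trans (sqr_ge0 _) hh.
Qed.

(** The high vertices contribute [(K / eta + 1) * B], the low ones [2 + 2 * B]; the outer 2 is there
    because the Dirichlet form is half of [pair_energy]. *)
Definition poincare_cst : R := 2 * ((K / eta + 1) * B + 2 + 2 * B).

(** Average [(f x - m)^2 <= 2 (f x - f w)^2 + 2 (f w - m)^2] over the neighbours [w] of [x] with
    weights [psi]. Each [w] is high and has at most one low neighbour, so it is charged at most
    once, with weight at most 1. *)
Lemma low_energy f m :
  \sum_(x in ~: H) Psi R e x * (f x - m) ^+ 2 <=
  2 * pair_energy f + 2 * \sum_(x in H) (f x - m) ^+ 2.
Proof.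
apply: (le_trans (y := \sum_(x in ~: H) \sum_(w | e x w)
    (2 * (psi R e x w * (f x - f w) ^+ 2) + 2 * (psi R e x w * (f w - m) ^+ 2)))).
  apply: ler_sum => x xH; rewrite /Psi mulr_suml; apply: ler_sum => w exw.
  have p0 := ltW (psi_gt0 R deg_gt0 x w).
  rewrite -mulrDr -mulrDr [leRHS]mulrCA ler_wpM2l //.
  have := sqr_ge0 (f x - f w - (f w - m)); nra.
under eq_bigr => x _ do rewrite big_split -!mulr_sumr /=.
rewrite big_split -!mulr_sumr /=; apply: lerD; rewrite ler_pM2l //.
  rewrite /pair_energy [leLHS]big_mkcond; apply: ler_sum => x _; case: ifP => // _.
  by apply: sumr_ge0 => w _; rewrite mulr_ge0 ?sqr_ge0 // ltW // psi_gt0.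
rewrite (exchange_big_dep (mem H)) /=; last first.
  by move=> x w; rewrite inE; exact: low_indep.
apply: ler_sum => w wH; rewrite -mulr_suml ler_piMl ?sqr_ge0 //.
apply: le_trans (_ : \sum_(x | (x \in ~: H) && e x w) 1 <= _).
  by apply: ler_sum => x _; exact: psi_le1.
rewrite sumr_const lern1; move: (low_nbr_le1 w).
rewrite (@eq_card _ _ [pred x | (x \in ~: H) && e x w]) // => x.
by rewrite !inE andbC e_sym.
Qed.

Lemma graph_poincare f : \sum_x Psi R e x * f x = 0 ->
  \sum_x Psi R e x * f x ^+ 2 <=
  poincare_cst * dirichlet (walk_step R e) (Psi R e) f.
Proof.
move=> f0; have [m hm] := high_energy f.
have E0 : 0 <= pair_energy f.
  by apply: sumr_ge0 => x _; apply: sumr_ge0 => y _; rewrite mulr_ge0 ?sqr_ge0 // ltW // psi_gt0.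
(* The weighted mean of [f] is 0, so recentring at any [m] can only increase the second moment. *)
apply: le_trans (_ : \sum_x Psi R e x * (f x - m) ^+ 2 <= _).
  have -> : \sum_x Psi R e x * (f x - m) ^+ 2 = \sum_x Psi R e x * f x ^+ 2
     - 2 * m * (\sum_x Psi R e x * f x) + \sum_x Psi R e x * m ^+ 2.
    by rewrite mulr_sumr -sumrB -big_split; apply: eq_bigr => x _; rewrite /=; ring.
  rewrite f0 mulr0 subr0 lerDl; apply: sumr_ge0 => x _.
  by rewrite mulr_ge0 ?sqr_ge0 // ltW // Psi_gt0.
rewrite (bigID (mem H)) /=.
have h1 : \sum_(x in H) Psi R e x * (f x - m) ^+ 2 <= (K / eta + 1) * (B * pair_energy f).
  apply: le_trans (_ : (K / eta + 1) * \sum_(x in H) (f x - m) ^+ 2 <= _).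
    by rewrite mulr_sumr; apply: ler_sum => x _; rewrite ler_wpM2r ?sqr_ge0 ?Psi_le.
  by rewrite ler_wpM2l // addr_ge0 // divr_ge0.
have h2 : \sum_(x | x \notin H) Psi R e x * (f x - m) ^+ 2 <=
    2 * pair_energy f + 2 * (B * pair_energy f).
  rewrite (eq_bigl (fun x => x \in ~: H)) => [|x]; last by rewrite [RHS]inE.
  by apply: le_trans (low_energy f m) _; rewrite lerD2l ler_pM2l.
apply: le_trans (lerD h1 h2) _; rewrite dirichlet_pair_energy /poincare_cst.
by rewrite le_eqVlt; apply/orP; left; apply/eqP; field; rewrite !gt_eqF.
Qed.

End GraphPoincare.

(** * Cover time of a graph satisfying the Poincare inequality *)

Section TotalWeight.
Context (R : realType) (V : finType) (e : rel V) (d eps K : R).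
Hypothesis e_sym : symmetric e.
Hypothesis deg_gt0 : forall v, (0 < deg e v)%N.
Hypothesis d_gt0 : 0 < d.
Hypothesis eps_gt0 : 0 < eps.
Hypothesis eps_le : eps <= 2^-1.
Hypothesis deg_le : forall v, (deg e v)%:R <= K * d.

Definition atypical : {set V} := [set v | eps * d < `|(deg e v)%:R - d|].

Lemma typical_deg_le v : v \notin atypical -> (deg e v)%:R <= 2 * d.
Proof.
rewrite inE -leNgt ler_norml => /andP[_ h].
have h2 := ler_wpM2r (ltW d_gt0) eps_le.
have : eps * d <= d by apply: le_trans h2 _; rewrite mulrC ler_pdivrMr // ler_pMr // ler1n.
lra.
Qed.

(* The left-hand side is positive only if [deg w < deg v]; it is then charged
   to an atypical endpoint, or is small because both degrees are close to [d]. *)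
Lemma psi_excess_le v w : e v w ->
  psi R e v w - (deg e v)%:R^-1 <=
  (4 * eps / d * (v \notin atypical)%:R + (w \in atypical)%:R / (deg e w)%:R)
   + (v \in atypical)%:R * (2 / d).
Proof.
have e1 : 0 < 1 - eps by move: eps_le; lra.
have e2 : 0 < 1 + eps by rewrite addr_gt0.
have e3 : 2^-1 <= (1 - eps) * (1 + eps) by move: eps_le eps_gt0; nra.
move=> evw; have dv : 0 < (deg e v)%:R :> R by rewrite ltr0n.
have dw : 0 < (deg e w)%:R :> R by rewrite ltr0n.
have iv : 0 < (deg e v)%:R^-1 :> R by rewrite invr_gt0.
have iw : 0 < (deg e w)%:R^-1 :> R by rewrite invr_gt0.
have id0 : 0 < d^-1 by rewrite invr_gt0.
have ed : 0 < eps / d by rewrite divr_gt0.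
have rhs0 : 0 <= (4 * eps / d * (v \notin atypical)%:R + (w \in atypical)%:R / (deg e w)%:R)
   + (v \in atypical)%:R * (2 / d).
  apply: addr_ge0; first apply: addr_ge0; apply: mulr_ge0; rewrite ?ler0n ?invr_ge0 //.
    by rewrite mulr_ge0 ?mulr_ge0 ?(ltW id0) ?(ltW eps_gt0).
  by rewrite mulr_ge0 ?(ltW id0).
rewrite /psi /minn; case: ltnP => [_|hwv]; first by rewrite subrr.
have hvw : (deg e w)%:R <= (deg e v)%:R :> R by rewrite ler_nat.
have low u : u \notin atypical -> (1 - eps) * d <= (deg e u)%:R <= (1 + eps) * d.
  by rewrite inE -leNgt ler_norml => /andP[]; lra.
have typ u : u \notin atypical -> (deg e u)%:R^-1 <= 2 / d.
  move=> /low/andP[h _]; have -> : 2 / d = (d / 2)^-1 by rewrite invfM invrK mulrC.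
  rewrite lef_pV2 ?posrE ?divr_gt0 ?ltr0n //; apply: le_trans h.
  have := ler_wpM2r (ltW d_gt0) eps_le; lra.
case: (boolP (w \in atypical)) => wA /=.
  move: iv iw; set a := (deg e v)%:R^-1; set b := (deg e w)%:R^-1 => a0 b0.
  by case: (v \in atypical); rewrite /= ?mul1r ?mul0r ?mulr0 ?mulr1; lra.
case: (boolP (v \in atypical)) => vA /=.
  move: iv iw (typ w wA); set a := (deg e v)%:R^-1; set b := (deg e w)%:R^-1 => a0 b0 hb.
  by rewrite ?mul1r ?mul0r ?mulr0 ?mulr1; lra.
rewrite mul0r mulr1 mul0r !addr0.
have /andP[hw _] := low w wA; have /andP[_ hv] := low v vA.
have h1 : (deg e w)%:R^-1 <= ((1 - eps) * d)^-1.
  by rewrite lef_pV2 ?posrE ?mulr_gt0.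
have h2 : ((1 + eps) * d)^-1 <= (deg e v)%:R^-1.
  by rewrite lef_pV2 ?posrE ?mulr_gt0 ?addr_gt0.
apply: le_trans (lerB h1 h2) _; rewrite !invfM -mulrBl.
rewrite ler_pM2r //.
have -> : (1 - eps)^-1 - (1 + eps)^-1 = 2 * eps / ((1 - eps) * (1 + eps)).
  by field; rewrite !gt_eqF.
rewrite ler_pdivrMr ?mulr_gt0 //.
have e4 : 0 <= 4 * eps by rewrite mulr_ge0 // ltW.
by apply: le_trans (ler_wpM2l e4 e3); move: e4; lra.
Qed.

(** Write [Psi v] as 1 plus excesses. A typical vertex has at most [2 * d] edges of excess
    [4 * eps / d]; the terms [1 / deg w] over the neighbours of an atypical [w] add up to 1; an
    atypical [v] has at most [K * d] edges costing [2 / d]. *)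
Lemma total_weight_le : \sum_v Psi R e v <=
  #|V|%:R * (1 + 8 * eps) + (1 + 2 * K) * #|atypical|%:R.
Proof.
have hv v : Psi R e v = 1 + \sum_(w | e v w) (psi R e v w - (deg e v)%:R^-1).
  rewrite sumrB sum_adj_cst mulfV ?pnatr_eq0 -?lt0n //; rewrite /Psi; lra.
under eq_bigr => v _ do rewrite hv.
rewrite big_split /= sumr_const.
have h : \sum_v \sum_(w | e v w) (psi R e v w - (deg e v)%:R^-1) <=
   \sum_v \sum_(w | e v w) (4 * eps / d * (v \notin atypical)%:R)
   + \sum_v \sum_(w | e v w) (w \in atypical)%:R / (deg e w)%:R
   + \sum_v \sum_(w | e v w) (v \in atypical)%:R * (2 / d).
  rewrite -big_split /= -big_split /=; apply: ler_sum => v _.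
  rewrite -big_split /= -big_split /=; apply: ler_sum => w evw.
  exact: psi_excess_le.
have h1 : \sum_v \sum_(w | e v w) (4 * eps / d * (v \notin atypical)%:R) <= #|V|%:R * (8 * eps).
  rewrite -sum1_card natr_sum mulr_suml; apply: ler_sum => v _.
  rewrite sum_adj_cst mul1r; case: (boolP (v \in atypical)) => vA /=.
    by rewrite !mulr0 mulr_ge0 // ltW.
  rewrite mulr1 mulrA ler_pdivrMr // mulrC.
  have -> : 8 * eps * d = 4 * eps * (2 * d) by ring.
  rewrite ler_wpM2l ?mulr_ge0 ?(ltW eps_gt0) //.
  exact: typical_deg_le.
have h2 : \sum_v \sum_(w | e v w) (w \in atypical)%:R / (deg e w)%:R = #|atypical|%:R :> R.
  rewrite (exchange_big_dep predT) //= -sum1_card natr_sum [RHS]big_mkcond /=.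
  apply: eq_bigr => w _; rewrite (eq_bigl (fun v => e w v)) => [|v]; last exact: e_sym.
  rewrite sum_adj_cst mulrC divfK ?pnatr_eq0 -?lt0n //.
  by case: (w \in atypical).
have h3 : \sum_v \sum_(w | e v w) (v \in atypical)%:R * (2 / d) <= 2 * K * #|atypical|%:R.
  rewrite -sum1_card natr_sum mulr_sumr [leRHS]big_mkcond /=; apply: ler_sum => v _.
  rewrite sum_adj_cst; case: (v \in atypical); last by rewrite mul0r mulr0.
  rewrite mul1r mulr1 mulrA ler_pdivrMr // mulrC -mulrA ler_pM2l //; exact: deg_le.
rewrite h2 in h.
apply: le_trans (_ : #|V|%:R + (#|V|%:R * (8 * eps) + #|atypical|%:R
  + 2 * K * #|atypical|%:R) <= _); last first.
  by rewrite le_eqVlt; apply/orP; left; apply/eqP; ring.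
by rewrite lerD2l; apply: le_trans h _; rewrite lerD // lerD.
Qed.

End TotalWeight.

Section CoverTimeOfGraph.
Context (R : realType) (V : finType) (e : rel V) (C kq rho eps eps1 : R) (T0 T : nat).
Variable B : {set V}.
Hypothesis e_sym : symmetric e.
Hypothesis deg_gt0 : forall v, (0 < deg e v)%N.
Local Notation P := (walk_step R e).
Local Notation Q := (Psi R e).
Let W := \sum_v Q v.
Hypothesis C_gt0 : 0 < C.
Hypothesis poincare : forall f, \sum_u Q u * f u = 0 ->
  \sum_u Q u * f u ^+ 2 <= C * dirichlet P Q f.
Hypothesis Q_le : forall u, Q u <= kq.
Hypothesis rho_ge0 : 0 <= rho.
Hypothesis rho_lt1 : rho < 1.
Hypothesis rhoC : 1 - (2 * C)^-1 <= rho ^+ 2.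
Hypothesis eps_gt0 : 0 < eps.
Hypothesis eps_le : eps <= 4^-1.
Hypothesis V_gt0 : (0 < #|V|)%N.
Local Notation n := (#|V|%:R : R).
Hypothesis W_le : W <= (1 + eps ^+ 2) * n.
Hypothesis step_le : forall v w, v \notin B -> P w v <= eps1.
Hypothesis T0T : (T0 <= T)%N.
Hypothesis T_large : 2 * 2^-1 ^+ T <= eps.
Hypothesis T_mix : kq * rho ^+ T * W <= eps.
Hypothesis T_small : T%:R * (kq / n) <= eps / 3.
Hypothesis T0_mix : kq * rho ^+ T0 / (1 - rho) <= eps / 3.
Hypothesis eps1_small : T0%:R * eps1 <= eps / 3.

Let P_ge0 v w : 0 <= P v w. Proof. exact: walk_step_ge0. Qed.
Let P_sum1 v : \sum_w P v w = 1. Proof. exact: walk_step_sum1. Qed.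
Let Q_ge1 v : 1 <= Q v. Proof. exact: Psi_ge1. Qed.
Let P_rev u w : Q u * P u w = Q w * P w u. Proof. exact: walk_step_rev. Qed.

Let n_gt0 : 0 < n. Proof. by rewrite ltr0n. Qed.

Lemma le_total_weight : n <= W.
Proof. by rewrite -sum1_card natr_sum; exact: ler_sum. Qed.

Let W_gt0 : 0 < W. Proof. exact: lt_le_trans n_gt0 le_total_weight. Qed.

Let T_gt0 : (0 < T)%N.
Proof.
rewrite lt0n; apply/eqP => T0'; move: T_large; rewrite T0' expr0.
by move: eps_le; lra.
Qed.

Let mixing v u : `|lazy_prob P v T u - Q v / W| <= eps / W.
Proof.
apply: le_trans (lazy_prob_mixing P_ge0 P_sum1 Q_ge1 P_rev v C_gt0 poincare Q_le rho_ge0 rhoC T u) _.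
by rewrite ler_pdivlMr.
Qed.

Lemma lazy_prob_lower v u : (1 - eps) / W <= lazy_prob P v T u.
Proof.
have := mixing v u; rewrite ler_norml => /andP[h _].
have : 1 / W <= Q v / W by rewrite ler_pM2r ?invr_gt0.
by move: h; rewrite mulrBl; lra.
Qed.

Lemma lazy_prob_upper v u : Q v <= 1 + eps ->
  lazy_prob P v T u <= (1 + 2 * eps) / W.
Proof.
move=> Qv; have := mixing v u; rewrite ler_norml => /andP[_ h].
have : Q v / W <= (1 + eps) / W by rewrite ler_pM2r ?invr_gt0.
by move: h; rewrite !mulrDl; lra.
Qed.

Let stationary_small v : T%:R * (Q v / W) <= eps / 3.
Proof.
apply: le_trans T_small; rewrite ler_wpM2l //; apply: ler_pM => //.
- exact: le_trans ler01 (Q_ge1 v).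
- by rewrite invr_ge0 ltW.
- by rewrite lef_pV2 ?posrE // le_total_weight.
Qed.

(** One third of [eps] each for real entries before [T0], for mixing after [T0], and for the
    stationary part over [T] steps. *)
Lemma green_good v u : v \notin B -> green P v T u <= 2 * (u == v)%:R + eps.
Proof.
move=> vB.
apply: le_trans (green_le_good P_ge0 P_sum1 Q_ge1 P_rev C_gt0 poincare Q_le rho_ge0
  rho_lt1 rhoC u (fun w => step_le w vB) T0T) _.
by have := stationary_small v; move: T0_mix eps1_small; lra.
Qed.

Lemma green_all v u : green P v T u <= 1 + kq / (1 - rho).
Proof.
apply: le_trans (green_le P_ge0 P_sum1 Q_ge1 P_rev v C_gt0 poincare Q_le rho_ge0
  rho_lt1 rhoC T u) _.
by have := stationary_small v; move: eps_le; lra.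
Qed.

(** Markov's inequality for the nonnegative excess [Q v - 1], whose sum is at most [eps ^+ 2 * n];
    this is why [W_le] has a square. *)
Lemma good_card :
  n - #|B|%:R - eps * n <= #|[set v | Q v <= 1 + eps] :\: B|%:R.
Proof.
set G := [set v | _]; set A := G :\: B.
have h1 : eps * #|~: G|%:R <= eps ^+ 2 * n.
  apply: le_trans (_ : \sum_v (Q v - 1) <= _); last first.
    rewrite sumrB sumr_const -/W; move: W_le; rewrite -[1 *+ _]/(n); lra.
  rewrite -sum1_card natr_sum mulr_sumr [leLHS]big_mkcond /=; apply: ler_sum => v _.
  case: ifP; last by rewrite subr_ge0.
  by rewrite !inE -ltNge mulr1 => h; rewrite lerBrDl ltW.
have h2 : #|~: G|%:R <= eps * n.
  by rewrite -(ler_pM2l eps_gt0) mulrA -expr2.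
have h3 : (#|V| <= #|~: G| + #|B| + #|A|)%N.
  rewrite -(cardsC A) addnC leq_add2r; apply: leq_trans (leq_card_setU _ _).
  by rewrite subset_leq_card // /A setCD setUC.
move: h3; rewrite -(ler_nat R) !natrD; lra.
Qed.

Lemma graph_cover_time_upper u :
  (expected_cover_time R e u <=
   ((2 + eps) * W / (2 * (1 - eps)) * harmonic_number R #|V| +
   (1 + kq / (1 - rho)) * W / (2 * (1 - eps)) * harmonic_number R #|B|)%:E)%E.
Proof.
have e1 : 0 < 1 - eps by move: eps_le; lra.
have kq0 : 0 <= kq by apply: le_trans (Q_le u); apply: le_trans (Q_ge1 u).
have hM : 0 <= 1 + kq / (1 - rho) by rewrite addr_ge0 // divr_ge0 // subr_ge0 ltW.
have c0 : 0 < (1 - eps) / W by rewrite divr_gt0.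
apply: le_trans (expected_cover_time_upper deg_gt0 T_gt0 (A := ~: B) (M1 := 2 + eps)
  (M2 := 1 + kq / (1 - rho)) c0 lazy_prob_lower _ _ _ _ u) _ => //.
- by move=> v; rewrite inE => /(green_good v); rewrite eqxx mulr1.
- by move=> v _; exact: green_all.
- by rewrite addr_ge0 // ltW.
- have eM (M : R) : M / (2 * ((1 - eps) / W)) = M * W / (2 * (1 - eps)).
    by field; rewrite !gt_eqF.
  by rewrite setCK !eM.
Qed.

Lemma graph_cover_time_lower u :
  (((2 - eps) * W / (2 * (1 + 2 * eps)) *
    ((1 - eps) * harmonic_number R #|[set v | (Q v <= 1 + eps)%R] :\: B|.-1 - 1))%:E
   <= expected_cover_time R e u)%E.
Proof.
set A' := _ :\: B.
have e1 : 0 < 1 - eps by move: eps_le; lra.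
have e2 : 0 < 1 + 2 * eps by move: eps_gt0; lra.
have kq0 : 0 <= kq by apply: le_trans (Q_le u); apply: le_trans (Q_ge1 u).
have hM : 0 <= 1 + kq / (1 - rho) by rewrite addr_ge0 // divr_ge0 // subr_ge0 ltW.
have c0 : 0 < (1 - eps) / W by rewrite divr_gt0.
have c'0 : 0 < (1 + 2 * eps) / W by rewrite divr_gt0.
apply: le_trans (expected_cover_time_lower deg_gt0 T_gt0 (A := ~: B) (M1 := 2 + eps)
  (M2 := 1 + kq / (1 - rho)) c0 lazy_prob_lower _ _ _ _ (A' := A') (m := 2 - eps)
  c'0 _ (ltW eps_gt0) _ _ _ _ u).
- have eM (M : R) : M / (2 * ((1 + 2 * eps) / W)) = M * W / (2 * (1 + 2 * eps)).
    by field; rewrite !gt_eqF.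
  by rewrite eM.
- by move=> v; rewrite inE => /(green_good v); rewrite eqxx mulr1.
- by move=> v _; exact: green_all.
- by rewrite addr_ge0 // ltW.
- by [].
- by move: eps_le; lra.
- by move: eps_le; lra.
- by move=> v w; rewrite !inE => /andP[_]; exact: lazy_prob_upper.
- move=> v _; apply: le_trans (green_diag_ge P_ge0 v T).
  by move: T_large; lra.
- move=> v w; rewrite !inE => /andP[vB _] _ vw.
  by apply: le_trans (green_good w vB) _; rewrite eq_sym (negbTE vw) mulr0 add0r.
Qed.

Lemma lazy_prob_connect v t u : lazy_prob P v t u != 0 -> connect e u v.
Proof.
elim: t u => [|t IH] u.
  by rewrite /lazy_prob /= /delta_at; case: (eqVneq u v) => [->|_]; rewrite ?connect0 ?eqxx.
rewrite lazy_probS /lazy; have [h0|] := eqVneq (lazy_prob P v t u) 0; last by move/IH.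
have [ha|] := eqVneq (avg P (lazy_prob P v t) u) 0; first by rewrite h0 ha addr0 mul0r eqxx.
rewrite /avg => hs _; have : ~~ [forall w, P u w * lazy_prob P v t w == 0].
  apply: contraNN hs => /forallP h; rewrite big1 // => w _; exact/eqP.
case/forallPn => w; rewrite mulf_eq0 negb_or /walk_step => /andP[].
by case: ifP => [euw _ /IH|]; [exact: connect_trans (connect1 euw)|rewrite eqxx].
Qed.

(** No separate argument is needed: a positive [T]-step probability between any two vertices yields
    a path. *)
Lemma graph_connected : connected_graph e.
Proof.
apply/forallP => u; apply/forallP => v; apply: (@lazy_prob_connect _ T).
rewrite gt_eqF //; apply: lt_le_trans (lazy_prob_lower v u).
by rewrite divr_gt0 //; move: eps_le; lra.
Qed.

Lemma max_cover_time_bounds (L U : R) : 0 <= U ->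
  (forall u, (L%:E <= expected_cover_time R e u)%E) ->
  (forall u, (expected_cover_time R e u <= U%:E)%E) ->
  (L%:E <= max_cover_time R e)%E && (max_cover_time R e <= U%:E)%E.
Proof.
move=> U0 hL hU; rewrite /max_cover_time graph_connected; apply/andP; split.
  have [u _] := card_gt0P V_gt0.
  by apply: le_trans (hL u) _; apply: le_bigmax.
apply: bigmax_le => [|u _]; last exact: hU.
by rewrite lee_fin.
Qed.

End CoverTimeOfGraph.

(** * First moments in the random graph *)

Section GnpMean.
Context (R : realType) (n : nat) (p : R).
Implicit Types (E F Q : {set {set 'I_n}}) (D : {set 'I_n * 'I_n}) (S : {set 'I_n}).

Definition Gnp_mean (X : {set {set 'I_n}} -> R) : R :=
  \sum_(E in powerset (all_edges n)) Gnp_weight p E * X E.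

(** Independence of the edges, by expanding a product of two-term sums over subsets. The values 0
    and 1 of [a] and [b] off [all_edges] eliminate the subsets that are not edge sets. *)
Lemma Gnp_mean_prod (h : {set 'I_n} -> bool -> R) :
  Gnp_mean (fun E => \prod_(f in all_edges n) h f (f \in E)) =
  \prod_(f in all_edges n) (p * h f true + (1 - p) * h f false).
Proof.
rewrite [RHS]big_mkcond /=.
pose a f := if f \in all_edges n then p * h f true else 0.
pose b f := if f \in all_edges n then (1 - p) * h f false else 1.
rewrite (eq_bigr (fun f => a f + b f)) => [|f _]; last first.
  by rewrite /a /b; case: ifP => _; rewrite ?add0r.
rewrite bigA_distr [RHS](bigID (mem (powerset (all_edges n)))) /= [X in _ = _ + X]big1.
  rewrite addr0; apply: eq_bigr => E; rewrite inE => sE.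
  rewrite /Gnp_weight -big_split [LHS]big_mkcond /=; apply: eq_bigr => f _.
  rewrite /a /b; case: (boolP (f \in E)) => fE; first by rewrite (fintype.subsetP sE).
  by case: ifP.
move=> E; rewrite inE => /subsetPn[f fE fA].
by rewrite (bigD1 f) //= fE /a (negbTE fA) mul0r.
Qed.

Lemma Gnp_mean_forced Q F (x : R) : Q \subset all_edges n -> F \subset all_edges n ->
  [disjoint Q & F] ->
  Gnp_mean (fun E => (Q \subset E)%:R * x ^+ #|E :&: F|) =
  p ^+ #|Q| * (1 + p * (x - 1)) ^+ #|F|.
Proof.
move=> sQ sF dQF.
pose h (f : {set 'I_n}) (i : bool) : R :=
  (if f \in Q then i%:R else 1) * (if f \in F then (if i then x else 1) else 1).
have prodE (S : {set {set 'I_n}}) (y : {set 'I_n} -> R) : S \subset all_edges n ->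
    \prod_(f in all_edges n) (if f \in S then y f else 1) = \prod_(f in S) y f.
  move=> sS; rewrite -big_mkcondr /=; apply: eq_bigl => f.
  by apply: andb_idl; exact: (fintype.subsetP sS).
transitivity (Gnp_mean (fun E => \prod_(f in all_edges n) h f (f \in E))).
  apply: eq_bigr => E sE; congr (_ * _); rewrite /h big_split /= !prodE //; congr (_ * _).
    case: (boolP (Q \subset E)) => [QE|/subsetPn[f fQ fE]].
      by rewrite big1 // => f fQ; rewrite (fintype.subsetP QE).
    by rewrite (bigD1 f) //= (negbTE fE) mul0r.
  rewrite -big_mkcondr /= -prodr_const; apply: eq_bigl => f.
  by rewrite inE andbC.
rewrite Gnp_mean_prod (eq_bigr (fun f => (if f \in Q then p else 1) *
   (if f \in F then 1 + p * (x - 1) else 1))) => [|f _].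
  by rewrite big_split /= !prodE // !prodr_const.
rewrite /h; case: (boolP (f \in Q)) => fQ; last by case: ifP => _; ring.
by rewrite (disjointFr dQF fQ) /=; ring.
Qed.

Hypothesis p_ge0 : 0 <= p.
Hypothesis p_le1 : p <= 1.

Lemma Gnp_weight_ge0 E : 0 <= Gnp_weight p E.
Proof. by apply: prodr_ge0 => f _; case: ifP; rewrite ?subr_ge0. Qed.

Lemma Gnp_weight_sum1 : \sum_(E in powerset (all_edges n)) Gnp_weight p E = 1.
Proof.
have := @Gnp_mean_forced set0 set0 1 (sub0set _) (sub0set _).
rewrite -setI_eq0 setI0 eqxx cards0 !expr0 mulr1 => /(_ isT) <-.
by apply: eq_bigr => E _; rewrite sub0set setI0 cards0 expr0 !mulr1.
Qed.

Lemma Gnp_mean_le (X Y : {set {set 'I_n}} -> R) :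
  (forall E, E \subset all_edges n -> X E <= Y E) -> Gnp_mean X <= Gnp_mean Y.
Proof.
move=> h; apply: ler_sum => E; rewrite inE => sE.
by rewrite ler_wpM2l ?Gnp_weight_ge0 ?h.
Qed.

Lemma Gnp_mean_sum (I : finType) (P : pred I) (X : I -> {set {set 'I_n}} -> R) :
  Gnp_mean (fun E => \sum_(i | P i) X i E) = \sum_(i | P i) Gnp_mean (X i).
Proof.
rewrite /Gnp_mean exchange_big /=; apply: eq_bigr => E _; exact: mulr_sumr.
Qed.

Lemma Gnp_meanD (X Y : {set {set 'I_n}} -> R) :
  Gnp_mean (fun E => X E + Y E) = Gnp_mean X + Gnp_mean Y.
Proof. by rewrite -big_split; apply: eq_bigr => E _; exact: mulrDr. Qed.

Lemma Gnp_meanZ (a : R) (X : {set {set 'I_n}} -> R) :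
  Gnp_mean (fun E => a * X E) = a * Gnp_mean X.
Proof. by rewrite [RHS]mulr_sumr; apply: eq_bigr => E _; exact: mulrCA. Qed.

Lemma Gnp_prob_le1 (A : rel 'I_n -> bool) : Gnp_prob p A <= 1.
Proof.
rewrite -Gnp_weight_sum1 [leRHS](bigID (fun E => A (adj E))) /=.
by rewrite lerDl; apply: sumr_ge0 => E _; exact: Gnp_weight_ge0.
Qed.

(** First-moment method: where [A] fails, [X] is at least 1. *)
Lemma Gnp_prob_ge (A : rel 'I_n -> bool) (X : {set {set 'I_n}} -> R) :
  (forall E, E \subset all_edges n -> 0 <= X E) ->
  (forall E, E \subset all_edges n -> X E < 1 -> A (adj E)) ->
  1 - Gnp_mean X <= Gnp_prob p A.
Proof.
move=> X0 hX; rewrite lerBlDr -Gnp_weight_sum1 [leLHS](bigID (fun E => A (adj E))) /=.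
rewrite lerD2l [leRHS](bigID (fun E => A (adj E))) /=; apply: ler_wpDl.
  by apply: sumr_ge0 => E /andP[]; rewrite inE => sE _; rewrite mulr_ge0 ?Gnp_weight_ge0 ?X0.
apply: ler_sum => E /andP[]; rewrite inE => sE nA; rewrite ler_peMr ?Gnp_weight_ge0 //.
by rewrite leNgt; apply: contra nA; exact: hX.
Qed.

(* Sets of edges are encoded by sets of ordered pairs containing at most one
   orientation of each edge. *)
Definition antisym D := [forall q in D, (q.2, q.1) \notin D].

Definition adj_count E D : nat := #|[set q in D | adj E q.1 q.2]|.

Definition pair_edges D : {set {set 'I_n}} := [set [set q.1; q.2] | q in D].

Lemma antisymP D q : antisym D -> q \in D -> (q.2, q.1) \notin D.
Proof. by move=> /forallP/(_ q)/implyP; exact. Qed.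

Lemma antisym_neq D q : antisym D -> q \in D -> q.1 != q.2.
Proof.
case: q => x y aD qD; apply/eqP => /= exy; have := antisymP aD qD.
by move: qD => /=; rewrite exy => ->.
Qed.

Lemma pair_edge_inj D : antisym D -> {in D &, injective (fun q => [set q.1; q.2])}.
Proof.
move=> aD [x y] [x' y'] qD qD' /= /setP eqs.
have nxy := antisym_neq aD qD; have nxy' := antisym_neq aD qD'.
have := eqs x; rewrite !inE eqxx /= => /esym/orP[/eqP ex|/eqP ex].
  have := eqs y; rewrite !inE eqxx orbT => /esym/orP[/eqP ey|/eqP ->]; last by rewrite ex.
  by move: nxy; rewrite /= ex ey eqxx.
have := eqs y; rewrite !inE eqxx orbT => /esym/orP[/eqP ey|/eqP ey].
  by have := antisymP aD qD; rewrite /= ex ey qD'.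
by move: nxy; rewrite /= ex ey eqxx.
Qed.

Lemma pair_edges_sub D : antisym D -> pair_edges D \subset all_edges n.
Proof.
move=> aD; apply/fintype.subsetP => f /imsetP[q qD ->].
by rewrite inE cards2 (antisym_neq aD qD).
Qed.

Lemma card_pair_edges D : antisym D -> #|pair_edges D| = #|D|.
Proof. by move=> aD; apply: card_in_imset; exact: pair_edge_inj. Qed.

Lemma adj_countE E D : antisym D -> #|E :&: pair_edges D| = adj_count E D.
Proof.
move=> aD; rewrite /adj_count -(card_in_imset (f := fun q => [set q.1; q.2])); last first.
  move=> q q'; rewrite !inE => /andP[qD _] /andP[qD' _]; exact: (pair_edge_inj aD).
apply: eq_card => f; rewrite inE; apply/andP/imsetP => [[fE /imsetP[q qD ef]]|[q]].
  by exists q => //; rewrite inE qD /adj -ef.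
by rewrite inE => /andP[qD aq] ->; split => //; apply/imsetP; exists q.
Qed.

(** Chernoff's exponential moment together with the presence of prescribed edges; disjointness makes
    the two independent. *)
Lemma Gnp_mean_exp Q D (l m : R) : Q \subset all_edges n -> antisym D ->
  [disjoint Q & pair_edges D] ->
  Gnp_mean (fun E => (Q \subset E)%:R * expR (l * ((adj_count E D)%:R - m))) <=
  p ^+ #|Q| * expR (p * (expR l - 1) * #|D|%:R - l * m).
Proof.
move=> sQ aD dQ.
have -> : Gnp_mean (fun E => (Q \subset E)%:R * expR (l * ((adj_count E D)%:R - m))) =
   expR (- (l * m)) * Gnp_mean (fun E => (Q \subset E)%:R * expR l ^+ #|E :&: pair_edges D|).
  rewrite -Gnp_meanZ; apply: eq_bigr => E _; congr (_ * _).
  by rewrite adj_countE // -expRM_natr mulrCA -expRD mulrBr addrC.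
rewrite Gnp_mean_forced ?pair_edges_sub // card_pair_edges //.
rewrite expRD mulrCA ler_wpM2l ?exprn_ge0 // mulrC ler_pM2r ?expR_gt0 //.
rewrite expRM_natr lerXn2r ?nnegrE ?expR_ge0 ?expR_ge1Dx //.
rewrite mulrBr mulr1 addrCA addr_ge0 ?subr_ge0 //; first by rewrite mulr_ge0 ?expR_ge0.
Qed.

Lemma Gnp_mean_exp0 D (l m : R) : antisym D ->
  Gnp_mean (fun E => expR (l * ((adj_count E D)%:R - m))) <=
  expR (p * (expR l - 1) * #|D|%:R - l * m).
Proof.
move=> aD; have := @Gnp_mean_exp set0 D l m (sub0set _) aD.
rewrite -setI_eq0 set0I eqxx cards0 expr0 mul1r => /(_ isT); apply: le_trans.
by apply: Gnp_mean_le => E _; rewrite sub0set mul1r.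
Qed.

Lemma adj_sym E : symmetric (adj E).
Proof. by move=> v w; rewrite /adj setUC. Qed.

Lemma adj_irr E v : E \subset all_edges n -> adj E v v = false.
Proof.
move=> sE; apply/negP => /(fintype.subsetP sE).
by rewrite inE setUid cards1.
Qed.

Definition star_pairs (v : 'I_n) : {set 'I_n * 'I_n} := [set q | q.1 == v & q.2 != v].

Lemma antisym_star v : antisym (star_pairs v).
Proof.
apply/forallP => -[x y]; apply/implyP; rewrite !inE /= => /andP[/eqP -> yv].
by rewrite negb_and yv.
Qed.

Lemma card_star v : #|star_pairs v| = n.-1.
Proof.
have -> : star_pairs v = setX [set v] [set~ v] by apply/setP => -[x y]; rewrite !inE.
by rewrite cardsX cards1 mul1n cardsC1 card_ord.
Qed.

Lemma adj_count_star E v : E \subset all_edges n -> adj_count E (star_pairs v) = deg (adj E) v.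
Proof.
move=> sE; rewrite /deg -(card_imset (f := fun w => (v, w))); last by move=> x y [].
apply: eq_card => -[x y]; rewrite !inE /=; apply/idP/imsetP => [|[w]].
  by case/andP => /andP[/eqP -> yv] avy; exists y => //; rewrite inE.
rewrite inE => avw [-> ->]; rewrite eqxx avw andbT /=.
by apply: contraTneq avw => ->; rewrite adj_irr.
Qed.

Definition cut_pairs (S : {set 'I_n}) : {set 'I_n * 'I_n} := setX S (~: S).

Lemma antisym_cut S : antisym (cut_pairs S).
Proof.
apply/forallP => -[x y]; apply/implyP; rewrite !inE /= => /andP[xS yS].
by rewrite negb_and yS.
Qed.

Lemma adj_count_cut E S :
  (adj_count E (cut_pairs S))%:R = \sum_(x in S) \sum_(y in ~: S | adj E x y) 1 :> R.
Proof.
rewrite /adj_count -sum1_card natr_sum pair_big_dep /=; apply: eq_bigl => -[x y].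
by rewrite !inE /= andbA.
Qed.

Definition inner_pairs (S : {set 'I_n}) : {set 'I_n * 'I_n} :=
  [set q | [&& q.1 \in S, q.2 \in S & (q.1 < q.2)%N]].

Lemma antisym_inner S : antisym (inner_pairs S).
Proof.
apply/forallP => -[x y]; apply/implyP; rewrite !inE /= => /and3P[xS yS xy].
by rewrite !negb_and -leqNgt (ltnW xy) !orbT.
Qed.

Definition swap_pair (q : 'I_n * 'I_n) := (q.2, q.1).

Lemma swap_pair_inj : injective swap_pair.
Proof. by move=> [x y] [x' y'] [-> ->]. Qed.

Lemma adj_count_inner E S : E \subset all_edges n ->
  \sum_(x in S) \sum_(y in S | adj E x y) 1 = 2 * (adj_count E (inner_pairs S))%:R :> R.
Proof.
move=> sE; rewrite pair_big_dep /= (bigID (fun q : 'I_n * 'I_n => (q.1 < q.2)%N)) /= mulrDl mul1r.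
rewrite /adj_count -sum1_card natr_sum; congr (_ + _).
  by apply: eq_bigl => -[x y]; rewrite !inE /= -!andbA; congr (_ && _); rewrite andbCA andbC -andbA.
rewrite [LHS](reindex_inj swap_pair_inj) /=; apply: eq_bigl => -[x y]; rewrite !inE /=.
rewrite -leqNgt leq_eqVlt adj_sym; case: (eqVneq x y) => [->|nxy].
  by rewrite adj_irr ?andbF ?ltnn ?andbF.
rewrite val_eqE (negbTE nxy) /=.
by case: (x \in S); case: (y \in S); rewrite ?andbT ?andbF //= andbC.
Qed.

Lemma card_inner S : (2 * #|inner_pairs S| <= #|S| ^ 2)%N.
Proof.
have h : (#|inner_pairs S| + #|[set swap_pair q | q in inner_pairs S]| <= #|setX S S|)%N.
  rewrite -cardsUI (_ : _ :&: _ = set0) ?cards0 ?addn0; last first.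
    apply/setP => -[x y]; rewrite !inE; apply/negP => /andP[/and3P[_ _ xy]].
    case/imsetP => -[x' y']; rewrite !inE /= => /and3P[_ _ xy'] [ex ey].
    by move: xy; rewrite ex ey /= ltnNge ltnW.
  apply: subset_leq_card; apply/fintype.subsetP => -[x y]; rewrite !inE /=.
  case/orP => [/and3P[-> -> _] //|/imsetP[[x' y']]].
  by rewrite !inE /= => /and3P[h1 h2 _] [-> ->]; rewrite h1 h2.
by rewrite mul2n -addnn -mulnn -cardsX -{2}(card_imset _ swap_pair_inj).
Qed.

(** Leaving out [x], [y] and [w] as endpoints keeps these pairs disjoint from the edges [xy], [xw]
    and [yw], whose presence is prescribed separately. *)
Definition double_star (x y w : 'I_n) : {set 'I_n * 'I_n} :=
  setX [set x; y] (~: [set x; y; w]).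

Lemma antisym_double_star x y w : antisym (double_star x y w).
Proof.
apply/forallP => -[a b]; apply/implyP; rewrite !inE /= => /andP[ha hb].
by move: hb; rewrite !negb_or => /andP[/andP[/negbTE -> /negbTE ->] _].
Qed.

Lemma card_double_star x y w : x != y -> (2 * (n - 3) <= #|double_star x y w|)%N.
Proof.
move=> xy; rewrite cardsX cards2 xy leq_pmul2l // cardsCs setCK card_ord leq_sub2l //.
apply: leq_trans (leq_card_setU _ _) _; rewrite cards1 addn1 ltnS.
by rewrite cards2; case: (x != y).
Qed.

Lemma adj_count_double_star E x y w : x != y -> E \subset all_edges n ->
  (adj_count E (double_star x y w) <= deg (adj E) x + deg (adj E) y)%N.
Proof.
move=> xy sE; rewrite -!adj_count_star // -cardsUI; apply: leq_trans (leq_addr _ _).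
apply: subset_leq_card; apply/fintype.subsetP => -[a b]; rewrite !inE /= !negb_or.
by case/andP => /andP[/orP[]/eqP -> /andP[/andP[-> ->] _]] ->; rewrite eqxx ?orbT.
Qed.

End GnpMean.

(** * Bad events *)

Lemma expR_le_quad (R : realType) (x : R) : x <= 2^-1 -> expR x <= 1 + x + 2 * x ^+ 2.
Proof.
move=> hx; have h1 : 0 < 1 - x by lra.
have h2 : expR x <= (1 - x)^-1.
  rewrite -[expR x]invrK -expRN lef_pV2 ?posrE ?expR_gt0 //.
  by have := expR_ge1Dx (- x).
apply: le_trans h2 _; rewrite -[leLHS]mul1r ler_pdivrMr //.
have : 0 <= x ^+ 2 * (1 - 2 * x) by rewrite mulr_ge0 ?sqr_ge0 //; lra.
lra.
Qed.

Lemma expR_half_le (R : realType) : expR 2^-1 <= 2 :> R.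
Proof. by apply: le_trans (expR_le_quad (lexx _)) _; lra. Qed.

Lemma expRN_le (R : realType) (x : R) : 0 <= x -> expR (- x) <= (1 + x)^-1.
Proof.
move=> x0; rewrite expRN lef_pV2 ?posrE ?expR_gt0 ?expR_ge1Dx //.
by rewrite ltr_wpDr.
Qed.

Lemma sum_subsets_exp (R : realType) (I : finType) (x : R) :
  \sum_(S : {set I}) x ^+ #|S| = (1 + x) ^+ #|I|.
Proof.
rewrite addrC -prodr_const bigA_distr; apply: eq_bigr => S _.
by rewrite -prodr_const [LHS]big_mkcond.
Qed.

Section Events.
Context (R : realType) (n : nat) (p : R).
Hypothesis p_ge0 : 0 <= p.
Hypothesis p_le1 : p <= 1.
Local Notation d := (n%:R * p).
Local Notation mean := (Gnp_mean p).
Implicit Types (E : {set {set 'I_n}}).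

Let d_ge0 : 0 <= d. Proof. by rewrite mulr_ge0. Qed.

Lemma pn1_le : p * n.-1%:R <= d.
Proof. by rewrite mulrC ler_wpM2r // ler_nat leq_pred. Qed.

Lemma pn_sub_ge k : d - k%:R <= p * (n - k)%:R.
Proof.
have h : n%:R - k%:R <= (n - k)%:R :> R.
  by rewrite lerBlDr -natrD ler_nat; lia.
have := ler_wpM2l p_ge0 h; rewrite mulrBr => h2.
have h3 : p * k%:R <= k%:R by rewrite ler_piMl.
by move: h2 h3; rewrite [p * n%:R]mulrC; lra.
Qed.

Lemma pn1_ge : d - 1 <= p * n.-1%:R.
Proof. by have := pn_sub_ge 1; rewrite subn1. Qed.

(** As [0 ^+ 0 = 1], each term is the indicator of degree 0. *)
Definition isolated_count E : R := \sum_v 0 ^+ deg (adj E) v.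

(** The bound is a constant times [expR (- (d - ln n))]: of all the bad events, only this one needs
    [d - ln n] to be large. *)
Lemma mean_isolated : mean isolated_count <= n%:R * expR (1 - d).
Proof.
rewrite Gnp_mean_sum -[n in n%:R * expR _]card_ord -sum1_card natr_sum mulr_suml.
apply: ler_sum => v _; rewrite mul1r.
have aS := antisym_star v.
have -> : mean (fun E => 0 ^+ deg (adj E) v) = (1 - p) ^+ n.-1.
  have := Gnp_mean_forced p 0 (sub0set (all_edges n)) (pair_edges_sub aS).
  rewrite -setI_eq0 set0I eqxx cards0 expr0 mul1r sub0r mulrN1 card_pair_edges // card_star.
  move=> /(_ isT) <-; apply: eq_bigr => E; rewrite inE => sE.
  by rewrite sub0set mul1r adj_countE // adj_count_star.
apply: le_trans (_ : expR (- p) ^+ n.-1 <= _).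
  by rewrite lerXn2r ?nnegrE ?subr_ge0 ?expR_ge0 // expR_ge1Dx.
by rewrite -expRM_natr ler_expR mulNr; have := pn1_ge; lra.
Qed.

(** As [expR 2^-1 <= 2], the exponent of the mean is at most [d - 6 * d / 2 = - 2 * d], which beats
    the [n <= expR d] choices of a vertex. *)
Definition large_degree E : R := \sum_v expR (2^-1 * ((deg (adj E) v)%:R - 6 * d)).

Lemma mean_star (l m : R) v :
  mean (fun E => expR (l * ((deg (adj E) v)%:R - m))) <=
  expR (p * (expR l - 1) * n.-1%:R - l * m).
Proof.
rewrite -(card_star v); apply: le_trans (Gnp_mean_exp0 p_ge0 p_le1 _ _ (antisym_star v)).
by apply: Gnp_mean_le => // E sE; rewrite adj_count_star.
Qed.

Lemma mean_large_degree : mean large_degree <= n%:R * expR (- 2 * d).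
Proof.
rewrite Gnp_mean_sum -[n in n%:R * expR _]card_ord -sum1_card natr_sum mulr_suml.
apply: ler_sum => v _; rewrite mul1r; apply: le_trans (mean_star _ _ _) _.
rewrite ler_expR mulrAC.
have h0 : 0 <= p * n.-1%:R by rewrite mulr_ge0.
have : p * n.-1%:R * (expR 2^-1 - 1) <= p * n.-1%:R.
  by rewrite ler_piMr //; have := expR_half_le R; lra.
by have := pn1_le; lra.
Qed.

(* At least 1 when [x] and [y] both have degree at most [d / 380]. *)
Definition low_exp (x y w : 'I_n) E : R :=
  expR (- 19 * ((adj_count E (double_star x y w))%:R - d / 190)).

Definition low_pairs E : R :=
  \sum_(x : 'I_n) \sum_(y : 'I_n | y != x)
    (([set [set x; y]] \subset E)%:R * low_exp x y x E +
     \sum_(w | (w != x) && (w != y))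
       ([set [set x; w]; [set y; w]] \subset E)%:R * low_exp x y w E).

(** As [expR (- 19) <= 1 / 20], about [2 * n] pairs give [- 19 / 10 * d], and the threshold returns
    [19 * d / 190 = d / 10]. The 6 covers the three omitted endpoints of each star. *)
Lemma mean_low_exp (Q : {set {set 'I_n}}) (x y w : 'I_n) : x != y ->
  Q \subset all_edges n -> [disjoint Q & pair_edges (double_star x y w)] ->
  mean (fun E => (Q \subset E)%:R * low_exp x y w E) <=
  p ^+ #|Q| * expR (6 - 9 / 5 * d).
Proof.
move=> xy sQ dQ; apply: le_trans (Gnp_mean_exp p_ge0 p_le1 _ _ sQ (antisym_double_star x y w) dQ) _.
rewrite ler_wpM2l ?exprn_ge0 // ler_expR.
have e19 : expR (- 19) <= 20^-1 :> R.
  by apply: le_trans (expRN_le _) _ => //; lra.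
have hc : 2 * (p * (n - 3)%:R) <= p * #|double_star x y w|%:R.
  by rewrite mulrCA ler_wpM2l // -natrM ler_nat card_double_star.
have := pn_sub_ge 3; have := d_ge0.
move: hc; rewrite mulrAC; set c := p * #|_|%:R; set q := p * (n - 3)%:R => hc hd hq.
have q0 : 0 <= q by rewrite mulr_ge0.
have : c * (expR (- 19) - 1) <= c * (20^-1 - 1).
  by rewrite ler_wpM2l ?lerD2r // mulr_ge0.
lra.
Qed.

Lemma disjoint_edge_double_star (x y w : 'I_n) (Q : {set {set 'I_n}}) :
  (forall f, f \in Q -> f \subset [set x; y; w]) ->
  [disjoint Q & pair_edges (double_star x y w)].
Proof.
move=> hQ; apply/pred0P => f /=; apply/negP => /andP[/hQ sf].
case/imsetP => -[a b]; rewrite !inE /= => /andP[_ hb] ef.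
by move/negP: hb; apply; have /fintype.subsetP/(_ b) := sf; rewrite ef !inE eqxx orbT; apply.
Qed.

Lemma mean_low_pairs : mean low_pairs <= n%:R * (d + d ^+ 2) * expR (6 - 9 / 5 * d).
Proof.
set c := expR _.
have c0 : 0 <= c by rewrite expR_ge0.
have sum_le (P : pred 'I_n) (a : R) (F : 'I_n -> R) : 0 <= a -> (forall i, P i -> F i <= a) ->
    \sum_(i | P i) F i <= n%:R * a.
  move=> a0 hF; rewrite -[n in n%:R * a]card_ord -sum1_card natr_sum mulr_suml.
  by rewrite [leLHS]big_mkcond /=; apply: ler_sum => i _; case: ifP => [/hF|_]; rewrite mul1r.
have -> : n%:R * (d + d ^+ 2) * c = n%:R * (n%:R * (p * c + n%:R * (p ^+ 2 * c))) by ring.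
have p2 : 0 <= p ^+ 2 by rewrite sqr_ge0.
have h0 : 0 <= p * c + n%:R * (p ^+ 2 * c) by rewrite addr_ge0 ?mulr_ge0.
rewrite Gnp_mean_sum; apply: (@sum_le) => [|x _]; first by rewrite mulr_ge0.
rewrite Gnp_mean_sum; apply: (@sum_le) => // y yx.
have xy : x != y by rewrite eq_sym.
rewrite Gnp_meanD; apply: lerD.
  apply: le_trans (mean_low_exp (w := x) (Q := [set [set x; y]]) xy _ _) _.
  - by apply/fintype.subsetP => f; rewrite !inE => /eqP ->; rewrite cards2 xy.
  - apply: disjoint_edge_double_star => // f; rewrite inE => /eqP ->.
    by apply/fintype.subsetP => z; rewrite !inE => ->.
  - by rewrite cards1 expr1.
rewrite Gnp_mean_sum; apply: (@sum_le) => [|w /andP[wx wy]]; first by rewrite mulr_ge0.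
have xw : x != w by rewrite eq_sym.
have yw : y != w by rewrite eq_sym.
apply: le_trans (mean_low_exp (w := w) (Q := [set [set x; w]; [set y; w]]) xy _ _) _.
- apply/fintype.subsetP => f; by rewrite !inE => /orP[]/eqP ->; rewrite cards2 ?xw ?yw.
- apply: disjoint_edge_double_star => // f; rewrite !inE => /orP[]/eqP ->;
    by apply/fintype.subsetP => z; rewrite !inE => /orP[]->; rewrite ?orbT.
- rewrite cards2 [[set x; w] != _](_ : _ = true) //; apply/eqP => /setP/(_ x).
  by rewrite !inE eqxx /= (negbTE xy) (negbTE xw).
Qed.

Variable th : R.

Definition dense_sets (l M : R) E : R :=
  \sum_(S : {set 'I_n} | (S != set0) && (#|S|%:R <= th * n%:R))
    expR (l * ((adj_count E (inner_pairs S))%:R - M * d * #|S|%:R)).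

(** A set of size [s] has at most [s * th * n / 2] inner pairs, so the exponent is at most
    [d * s / 2 - 5 / 2 * d * s = - 2 * d * s]. Summing over nonempty sets gives [(1 + x) ^+ n - 1]
    with [n * x <= expR (- d)]. *)
Lemma mean_dense_sets (l M : R) : l * M = 5 / 2 -> expR l * th <= 1 -> 0 <= l ->
  1 <= d -> n%:R <= expR d ->
  mean (dense_sets l M) <= 2 * expR (- d).
Proof.
move=> lM lth l0 d1 nd.
pose x : R := expR (- 2 * d).
have hS (S : {set 'I_n}) : #|S|%:R <= th * n%:R ->
    mean (fun E => expR (l * ((adj_count E (inner_pairs S))%:R - M * d * #|S|%:R))) <= x ^+ #|S|.
  move=> hs; apply: le_trans (Gnp_mean_exp0 p_ge0 p_le1 _ _ (antisym_inner S)) _.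
  rewrite -expRM_natr ler_expR.
  set s := #|S|%:R in hs *; have s0 : 0 <= s by rewrite ler0n.
  have hD : 2 * #|inner_pairs S|%:R <= s ^+ 2 :> R by rewrite -natrM -natrX ler_nat card_inner.
  have h1 : p * (expR l - 1) * (2 * #|inner_pairs S|%:R) <= p * expR l * (s * (th * n%:R)).
    apply: ler_pM => //.
    - by rewrite mulr_ge0 // subr_ge0 -expR0 ler_expR.
    - by rewrite ler_wpM2l // lerBlDr lerDl.
    - by apply: le_trans hD _; rewrite expr2 ler_wpM2l.
  have h2 : p * expR l * (s * (th * n%:R)) <= s * d.
    have -> : p * expR l * (s * (th * n%:R)) = (expR l * th) * (s * d) by ring.
    by rewrite ler_piMl // mulr_ge0.
  have -> : l * (M * d * s) = (l * M) * (d * s) by ring.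
  by rewrite lM; lra.
have x0 : 0 <= x by rewrite expR_ge0.
rewrite Gnp_mean_sum.
apply: le_trans (_ : \sum_(S : {set 'I_n} | S != set0) x ^+ #|S| <= _).
  rewrite big_mkcondr /=; apply: ler_sum => S _; case: ifP => [|_]; first exact: hS.
  by rewrite exprn_ge0.
have -> : \sum_(S : {set 'I_n} | S != set0) x ^+ #|S| = (1 + x) ^+ n - 1.
  rewrite -[n in RHS]card_ord -sum_subsets_exp [in RHS](bigD1 set0) //= cards0 expr0.
  by rewrite addrC addrK.
have h1 : (1 + x) ^+ n <= expR (expR (- d)).
  apply: le_trans (_ : expR x ^+ n <= _).
    by rewrite lerXn2r ?nnegrE ?addr_ge0 ?expR_ge0 // expR_ge1Dx.
  rewrite -expRM_natr ler_expR; apply: le_trans (ler_wpM2l x0 nd) _.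
  by rewrite -expRD ler_expR; lra.
have h2 : expR (- d) <= 2^-1.
  by apply: le_trans (expRN_le d_ge0) _; rewrite lef_pV2 ?posrE //; lra.
have h3 := expR_le_quad h2.
have h4 : expR (- d) ^+ 2 <= expR (- d) * 2^-1 by rewrite expr2 ler_wpM2l ?expR_ge0.
lra.
Qed.

Definition sparse_cuts E : R :=
  \sum_(S : {set 'I_n} | (th * n%:R < #|S|%:R) && (2 * #|S| <= n)%N)
    expR (- 1 * ((adj_count E (cut_pairs S))%:R - d / 8 * #|S|%:R)).

(** At most half of the vertices lie in [S], so at least [s * d / 2] cut edges are expected. The
    tilt -1 gives at most [- s * d / 4 + s * d / 8], hence at most [- th * d * n / 8], against at
    most [expR n] sets. *)
Lemma mean_sparse_cuts : (0 < n)%N -> 8 <= th * d ->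
  mean sparse_cuts <= expR (1 - th * d / 8).
Proof.
move=> n0 hd; rewrite Gnp_mean_sum.
have e1 : expR (- 1) <= 2^-1 :> R.
  by apply: le_trans (expRN_le _) _ => //; lra.
have e2 : 2 <= expR 1 :> R by have := expR_ge1Dx (1 : R); lra.
apply: le_trans (_ : \sum_(S : {set 'I_n}) expR (- (th * d * n%:R / 8)) <= _).
  rewrite big_mkcond /=; apply: ler_sum => S _; case: ifP => [/andP[s1 s2]|_]; last exact: expR_ge0.
  apply: le_trans (Gnp_mean_exp0 p_ge0 p_le1 _ _ (antisym_cut S)) _; rewrite ler_expR.
  rewrite cardsX (cardsCs (~: S)) setCK card_ord natrM.
  set s := #|S|%:R in s1 *; have s0 : 0 <= s by rewrite ler0n.
  have hns : n%:R / 2 <= (n - #|S|)%:R :> R.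
    by rewrite ler_pdivrMr // -natrM ler_nat; move: s2; move: #|S| => j; lia.
  have h1 : s * d / 2 <= p * (s * (n - #|S|)%:R).
    have -> : s * d / 2 = p * (s * (n%:R / 2)) by field.
    by rewrite ler_wpM2l // ler_wpM2l.
  have h2 : p * (s * (n - #|S|)%:R) * (expR (- 1) - 1) <= (s * d / 2) * (- 2^-1).
    apply: le_trans (_ : p * (s * (n - #|S|)%:R) * (- 2^-1) <= _).
      by rewrite ler_wpM2l ?mulr_ge0 //; lra.
    by rewrite ler_wnM2r // oppr_le0 invr_ge0.
  have h3 : th * d * n%:R <= s * d.
    have -> : th * d * n%:R = th * n%:R * d by ring.
    by rewrite ler_wpM2r // ltW.
  rewrite mulrAC; lra.
have cS : #|{: {set 'I_n}}| = (2 ^ n)%N by rewrite -cardsT -powersetT card_powerset cardsT card_ord.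
rewrite sumr_const -[_ *+ #|_|]mulr_natr cS natrX.
apply: le_trans (_ : expR (- (th * d * n%:R / 8)) * expR 1 ^+ n <= _).
  by rewrite ler_wpM2l ?expR_ge0 // lerXn2r ?nnegrE ?expR_ge0.
rewrite -expRM_natr mul1r -expRD ler_expR.
have n1 : 1 <= n%:R :> R by rewrite ler1n.
have : 0 <= (th * d / 8 - 1) * (n%:R - 1) by rewrite mulr_ge0 //; lra.
lra.
Qed.

Definition atypical_sum (eps : R) E : R :=
  (eps * n%:R)^-1 * \sum_v (expR (eps / 4 * ((deg (adj E) v)%:R - (1 + eps) * d)) +
    expR (- (eps / 4) * ((deg (adj E) v)%:R - (1 - eps) * d))).

(** With tilt [eps / 4] the linear terms cancel and [eps ^+ 2 * d / 8 - eps ^+ 2 * d / 4] remains.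
    The prefactor of [atypical_sum] makes a value below 1 mean fewer than [eps * n] atypical
    vertices. *)
Lemma mean_atypical_sum (eps : R) : (0 < n)%N -> 0 < eps -> eps <= 1 ->
  mean (atypical_sum eps) <= 2 / eps * expR (1 - eps ^+ 2 * d / 8).
Proof.
move=> n0 eps0 eps1; rewrite Gnp_meanZ Gnp_mean_sum.
set c := expR _.
have n1 : 0 < n%:R :> R by rewrite ltr0n.
have -> : 2 / eps * c = (eps * n%:R)^-1 * (n%:R * (c + c)).
  by field; rewrite !gt_eqF.
rewrite ler_wpM2l ?invr_ge0 ?mulr_ge0 ?(ltW eps0) //.
rewrite -[n in n%:R * (_ + _)]card_ord -sum1_card natr_sum mulr_suml.
apply: ler_sum => v _; rewrite mul1r Gnp_meanD.
have q0 : 0 <= p * n.-1%:R by rewrite mulr_ge0.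
apply: lerD; apply: le_trans (mean_star _ _ _) _; rewrite ler_expR mulrAC.
  have h := @expR_le_quad R (eps / 4).
  have : p * n.-1%:R * (expR (eps / 4) - 1) <= d * (eps / 4 + 2 * (eps / 4) ^+ 2).
    apply: ler_pM => //; first by rewrite subr_ge0 -expR0 ler_expR divr_ge0 // ltW.
      exact: pn1_le.
    by have := h _; lra.
  lra.
have h : expR (- (eps / 4)) - 1 <= - (eps / 4) + 2 * (eps / 4) ^+ 2.
  have : - (eps / 4) <= 2^-1 by lra.
  by move/expR_le_quad; rewrite sqrrN; lra.
have k0 : - (eps / 4) + 2 * (eps / 4) ^+ 2 <= 0 by nra.
have : p * n.-1%:R * (expR (- (eps / 4)) - 1) <= (d - 1) * (- (eps / 4) + 2 * (eps / 4) ^+ 2).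
  apply: le_trans (_ : p * n.-1%:R * (- (eps / 4) + 2 * (eps / 4) ^+ 2) <= _).
    by rewrite ler_wpM2l.
  by rewrite ler_wnM2r // pn1_ge.
have := sqr_ge0 (eps / 4); lra.
Qed.

(** The sum counts vertices of degree at most [K] with tilt [ln a <= 0]; its mean is of order [n] to
    the power [a] when [d >= ln n]. Dividing by [n] to the power [2 * a] leaves room for the
    first-moment method. *)
Definition tiny_degree (K : nat) (a : R) E : R :=
  expR (- 2 * a * ln n%:R) * \sum_v expR (ln a * ((deg (adj E) v)%:R - K%:R)).

Lemma mean_tiny_degree (K : nat) (a : R) : (0 < n)%N -> 0 < a -> a <= 1 -> ln n%:R <= d ->
  mean (tiny_degree K a) <= expR (1 - ln a * K%:R - a * ln n%:R).
Proof.
move=> n0 a0 a1 hd; rewrite Gnp_meanZ Gnp_mean_sum.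
set c := expR (1 - _ - _); set b := expR _.
have n1 : 0 < n%:R :> R by rewrite ltr0n.
have -> : c = b * (n%:R * expR (1 - ln a * K%:R - (1 - a) * ln n%:R)).
  have e : n%:R = expR (ln n%:R) :> R by rewrite lnK ?posrE.
  rewrite [X in _ * (X * _)]e /b -!expRD /c; congr expR; ring.
rewrite ler_wpM2l ?expR_ge0 //.
rewrite -[n in n%:R * _]card_ord -sum1_card natr_sum mulr_suml.
apply: ler_sum => v _; rewrite mul1r; apply: le_trans (mean_star _ _ _) _.
rewrite ler_expR lnK ?posrE // mulrAC.
have h0 : (1 - a) * (ln n%:R - 1) <= (1 - a) * (p * n.-1%:R).
  by rewrite ler_wpM2l ?subr_ge0 //; have := pn1_ge; lra.
lra.
Qed.

End Events.

(** * Consequences of the absence of bad events *)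

Lemma expR_ge1 (R : realType) (x : R) : 0 <= x -> 1 <= expR x.
Proof. by move=> x0; rewrite -expR0 ler_expR. Qed.

Lemma le_term_sum (R : numDomainType) (I : finType) (P : pred I) (F : I -> R) (i : I) :
  (forall j, 0 <= F j) -> P i -> F i <= \sum_(j | P j) F j.
Proof. by move=> F0 Pi; rewrite (bigD1 i) //= lerDl sumr_ge0. Qed.

Lemma card_le_sum (R : numDomainType) (I : finType) (A : {set I}) (F : I -> R) :
  (forall i, 0 <= F i) -> (forall i, i \in A -> 1 <= F i) -> #|A|%:R <= \sum_i F i.
Proof.
move=> F0 F1; rewrite -sum1_card natr_sum [leLHS]big_mkcond /=.
by apply: ler_sum => i _; case: ifP => [/F1|_].
Qed.

Section GoodGraph.
Context (R : realType) (n : nat) (p : R) (E : {set {set 'I_n}}).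
Local Notation d := (n%:R * p).
Local Notation e := (adj E).
Hypothesis sE : E \subset all_edges n.
Hypothesis d_ge : 1520 <= d.

Let d_gt0 : 0 < d. Proof. by apply: (lt_le_trans _ d_ge); rewrite ltr0n. Qed.

Lemma deg_gt0_of_isolated : isolated_count R E < 1 -> forall v, (0 < deg e v)%N.
Proof.
move=> h v; rewrite lt0n; apply: contraTneq h => dv; rewrite -leNgt.
apply: le_trans (le_term_sum (i := v) (P := predT) _ _) => //.
by rewrite dv expr0.
Qed.

Lemma deg_le_of_large : large_degree p E < 1 -> forall v, (deg e v)%:R <= 6 * d.
Proof.
move=> h v; rewrite leNgt; apply: contraTN h => dv; rewrite -leNgt.
apply: le_trans (le_term_sum (i := v) (P := predT) _ _) => //.
by rewrite expR_ge1 // mulr_ge0 // subr_ge0 ltW.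
Qed.

Let low v := v \notin high_deg e d 380^-1.

Let low_deg v : low v -> (deg e v)%:R <= d / 380.
Proof. by rewrite /low inE -ltNge => /ltW; rewrite mulrC. Qed.

Lemma low_exp_ge1 x y w : x != y -> low x -> low y -> 1 <= low_exp p x y w E.
Proof.
move=> xy /low_deg lx /low_deg ly; apply/expR_ge1/mulr_le0; first by rewrite oppr_le0 ler0n.
have := adj_count_double_star w xy sE; rewrite -(ler_nat R) natrD => h.
by rewrite subr_le0; apply: le_trans h _; apply: le_trans (lerD lx ly) _; lra.
Qed.

Lemma low_pairs_ge x y : y != x ->
  ([set [set x; y]] \subset E)%:R * low_exp p x y x E +
     \sum_(w | (w != x) && (w != y))
       ([set [set x; w]; [set y; w]] \subset E)%:R * low_exp p x y w E <= low_pairs p E.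
Proof.
move=> yx; have t0 (b : bool) u v w : 0 <= b%:R * low_exp p u v w E.
  by rewrite mulr_ge0 ?expR_ge0.
pose F u v := ([set [set u; v]] \subset E)%:R * low_exp p u v u E +
     \sum_(w | (w != u) && (w != v))
       ([set [set u; w]; [set v; w]] \subset E)%:R * low_exp p u v w E.
have F0 u v : 0 <= F u v by rewrite addr_ge0 // sumr_ge0.
apply: le_trans (le_term_sum (F := F x) (F0 x) yx) _.
exact: (le_term_sum (P := predT) (F := fun u => \sum_(v | v != u) F u v)
  (fun u => sumr_ge0 _ (fun v _ => F0 u v)) isT).
Qed.

Lemma low_not_adj : low_pairs p E < 1 -> forall x y, low x -> low y -> ~~ e x y.
Proof.
move=> h x y lx ly; apply/negP => exy.
have yx : y != x by apply: contraTneq exy => ->; rewrite adj_irr.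
have xy : x != y by rewrite eq_sym.
have := le_lt_trans (low_pairs_ge yx) h; rewrite sub1set [_ \in E]exy mul1r => h1.
have h2 := low_exp_ge1 x xy lx ly.
have : 0 <= \sum_(w | (w != x) && (w != y))
       ([set [set x; w]; [set y; w]] \subset E)%:R * low_exp p x y w E.
  by apply: sumr_ge0 => w _; rewrite mulr_ge0 ?expR_ge0.
by move: h1 h2; lra.
Qed.

Lemma low_no_common_nbr : low_pairs p E < 1 ->
  forall x y w, low x -> low y -> e x w -> e y w -> x = y.
Proof.
move=> h x y w lx ly exw eyw; apply/eqP; apply: contraTT h => xy; rewrite -leNgt.
have yx : y != x by rewrite eq_sym.
apply: le_trans (low_pairs_ge yx); rewrite ler_wpDl ?mulr_ge0 ?expR_ge0 //.
have ww : (w != x) && (w != y).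
  by apply/andP; split; [apply: contraTneq exw|apply: contraTneq eyw] => ->; rewrite adj_irr.
apply: le_trans (le_term_sum (i := w) _ ww); last by move=> z; rewrite mulr_ge0 ?expR_ge0.
have -> : [set [set x; w]; [set y; w]] \subset E.
  by apply/fintype.subsetP => f; rewrite !inE => /orP[]/eqP ->.
by rewrite mul1r low_exp_ge1.
Qed.

Lemma low_nbr_card : low_pairs p E < 1 ->
  forall w, (#|[set u | e w u & u \notin high_deg e d 380^-1]| <= 1)%N.
Proof.
move=> h w; apply/card_le1_eqP => x y; rewrite !inE -!/(low _) => /andP[wx lx] /andP[wy ly].
by apply: (low_no_common_nbr h (w := w)); rewrite /low ?inE // adj_sym.
Qed.

Variable th : R.

Lemma inner_le_of_dense (l M : R) (S : {set 'I_n}) : 0 <= l -> dense_sets p th l M E < 1 ->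
  S != set0 -> #|S|%:R <= th * n%:R ->
  (adj_count E (inner_pairs S))%:R <= M * d * #|S|%:R.
Proof.
move=> l0 h S0 Sth; rewrite leNgt; apply: contraTN h => hS; rewrite -leNgt.
apply: le_trans (le_term_sum (i := S) _ _); first 1 last.
- by move=> T; exact: expR_ge0.
- by rewrite S0.
- by rewrite expR_ge1 // mulr_ge0 // subr_ge0 ltW.
Qed.

Lemma cut_ge_of_sparse (S : {set 'I_n}) : sparse_cuts p th E < 1 ->
  th * n%:R < #|S|%:R -> (2 * #|S| <= n)%N ->
  d / 8 * #|S|%:R <= (adj_count E (cut_pairs S))%:R.
Proof.
move=> h S1 S2; rewrite leNgt; apply: contraTN h => hS; rewrite -leNgt.
apply: le_trans (le_term_sum (i := S) _ _); first 1 last.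
- by move=> T; exact: expR_ge0.
- by rewrite S1.
- by rewrite expR_ge1 // mulN1r oppr_ge0 subr_le0 ltW.
Qed.

Lemma atypical_card (eps : R) : (0 < n)%N -> 0 < eps -> atypical_sum p eps E < 1 ->
  #|atypical e d eps|%:R <= eps * n%:R.
Proof.
move=> n0 eps0; have en : 0 < eps * n%:R by rewrite mulr_gt0 ?ltr0n.
rewrite /atypical_sum mulrC ltr_pdivrMr // mul1r => /ltW; apply: le_trans.
apply: card_le_sum => [v|v]; first by rewrite addr_ge0 ?expR_ge0.
have e4 : 0 <= eps / 4 by rewrite divr_ge0 // ltW.
rewrite inE ltr_normr => /orP[hv|hv].
  by rewrite ler_wpDr ?expR_ge0 // expR_ge1 // mulr_ge0 // subr_ge0; lra.
by rewrite ler_wpDl ?expR_ge0 // expR_ge1 // mulr_le0 ?oppr_le0 // subr_le0; lra.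
Qed.

Lemma tiny_card (K : nat) (a : R) : (0 < n)%N -> 0 < a -> a <= 1 -> tiny_degree K a E < 1 ->
  #|[set v | (deg e v <= K)%N]|%:R <= expR (2 * a * ln n%:R).
Proof.
move=> n0 a0 a1; rewrite /tiny_degree -mulrA mulNr expRN mulrC ltr_pdivrMr ?expR_gt0 // mul1r mulrA.
move=> /ltW; apply: le_trans; apply: card_le_sum => [v|v]; first exact: expR_ge0.
rewrite inE => hv; rewrite expR_ge1 // mulr_le0 ?ln_le0 //.
by rewrite subr_le0 ler_nat.
Qed.

Lemma deg_split (S : {set 'I_n}) x : (deg e x)%:R =
  \sum_(y in S | e x y) 1 + \sum_(y in ~: S | e x y) 1 :> R.
Proof.
rewrite /deg -sum1_card natr_sum (bigID (mem S)) /=; congr (_ + _); apply: eq_bigl => y.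
  by rewrite inE andbC.
by rewrite !inE andbC.
Qed.

(** For small [S], degrees of at least [d / 380] less the inner edges, counted twice as
    [2 * d / 1520], leave [d / 760] per vertex towards the complement. At most one of these edges
    per vertex goes to a low vertex, and [1 <= d / 1520], so [d / 1520] remains. Large [S] are
    handled by the cut bound [d / 8]. *)
Lemma good_expansion : low_pairs p E < 1 ->
  dense_sets p th 3800 1520^-1 E < 1 -> sparse_cuts p th E < 1 ->
  forall S : {set 'I_n}, S \subset high_deg e d 380^-1 ->
  (2 * #|S| <= #|high_deg e d 380^-1|)%N ->
  1520^-1 * d * #|S|%:R <= \sum_(x in S) \sum_(y in high_deg e d 380^-1 :\: S | e x y) 1.
Proof.
move=> hl hd hs S sS cS; set H := high_deg _ _ _ in sS cS *.
have [->|S0] := eqVneq S set0; first by rewrite cards0 mulr0 big_set0.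
have low1 x : \sum_(y in ~: S | e x y) 1 <= \sum_(y in H :\: S | e x y) 1 + 1 :> R.
  rewrite (bigID (mem H)) /=; apply: lerD.
    rewrite le_eqVlt; apply/orP; left; apply/eqP; apply: eq_bigl => y.
    by rewrite !inE; case: (y \in S); case: (e x y); rewrite ?andbF ?andbT.
  rewrite sumr_const lern1; apply: leq_trans (low_nbr_card hl x).
  apply: subset_leq_card; apply/fintype.subsetP => y; rewrite unfold_in => /andP[/andP[_ exy] hy].
  by rewrite inE exy.
have s1 : \sum_(x in S) \sum_(y in ~: S | e x y) 1 <=
    \sum_(x in S) \sum_(y in H :\: S | e x y) 1 + #|S|%:R :> R.
  rewrite -[#|S|%:R]/(1 *+ #|S|) -sumr_const -big_split /=.
  by apply: ler_sum => x _; exact: low1.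
set g := \sum_(x in S) \sum_(y in H :\: S | e x y) 1 in s1 *.
set s := #|S|%:R in s1 *; have s0 : 0 <= s by rewrite ler0n.
have ds : 1520 * s <= d * s by rewrite ler_wpM2r.
have [hS|hS] := leP s (th * n%:R); last first.
  have := cut_ge_of_sparse hs hS (leq_trans cS (leq_trans (max_card _) _)).
  rewrite card_ord leqnn => /(_ isT); rewrite (adj_count_cut R) -/s => h.
  by move: h s1; lra.
have h1 := @inner_le_of_dense 3800 1520^-1 S (ler0n _ _) hd S0 hS.
have h2 : \sum_(x in S) (380^-1 * d) <= \sum_(x in S) (deg e x)%:R.
  by apply: ler_sum => x /(fintype.subsetP sS); rewrite inE.
have h3 : \sum_(x in S) (deg e x)%:R = 2 * (adj_count E (inner_pairs S))%:R
    + \sum_(x in S) \sum_(y in ~: S | e x y) 1 :> R.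
  by rewrite -adj_count_inner // -big_split; apply: eq_bigr => x _; exact: deg_split.
rewrite h3 sumr_const -[_ *+ #|S|]mulr_natr -/s in h2.
by move: h1 h2 s1; rewrite -/s; lra.
Qed.

(* Transitions into a vertex outside this set have probability at most
   [1 / (K + 1)]. *)
Definition near_tiny (K : nat) : {set 'I_n} :=
  [set v | (deg e v <= K)%N || [exists w, e v w && (deg e w <= K)%N]].

(** Each vertex of degree at most [K] contributes itself and at most [K] neighbours. *)
Lemma near_tiny_card (K : nat) :
  (#|near_tiny K| <= K.+1 * #|[set v | (deg e v <= K)%N]|)%N.
Proof.
set A := [set v | _]; pose N := \bigcup_(w in A) [set v | e w v].
have h : near_tiny K \subset A :|: N.
  apply/fintype.subsetP => v; rewrite inE => /orP[hv|/existsP[w /andP[evw hw]]].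
    by rewrite !inE hv.
  by rewrite inE; apply/orP; right; apply/bigcupP; exists w; rewrite inE // adj_sym.
apply: leq_trans (subset_leq_card h) _; apply: leq_trans (leq_card_setU _ _) _.
rewrite mulSn leq_add2l mulnC -sum_nat_const.
apply: leq_trans (_ : \sum_(w in A) deg e w <= _)%N; last first.
  by apply: leq_sum => w; rewrite inE.
rewrite /N; elim/big_rec2: _ => [|w k X _ IH]; first by rewrite cards0.
by apply: leq_trans (leq_card_setU _ _) _; rewrite leq_add2l.
Qed.

Lemma near_tiny_step (K : nat) v w : (forall u, (0 < deg e u)%N) -> v \notin near_tiny K ->
  walk_step R e w v <= K.+1%:R^-1.
Proof.
move=> deg0; rewrite inE negb_or -ltnNge => /andP[hv /existsPn hw].
apply: walk_step_le => // ewv; have := hw w.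
by rewrite adj_sym ewv /= -ltnNge !ler_nat => ->.
Qed.

End GoodGraph.

(** * Constants *)

Lemma exprn_le_expR (R : realType) (r : R) t : 0 <= r ->
  r ^+ t <= expR (- ((1 - r) * t%:R)).
Proof.
move=> r0; rewrite -mulNr expRM_natr lerXn2r ?nnegrE ?expR_ge0 //.
by have := expR_ge1Dx (- (1 - r)); lra.
Qed.

Lemma expRN_small (R : realType) (y : R) : 0 < y ->
  exists X : R, forall x, X <= x -> expR (- x) <= y.
Proof.
move=> y0; exists (- ln y) => x hx.
by rewrite -[leRHS]lnK ?posrE // ler_expR lerNl.
Qed.

Lemma exprn_small (R : realType) (r y : R) : 0 <= r -> r < 1 -> 0 < y ->
  exists t0, forall t, (t0 <= t)%N -> r ^+ t <= y.
Proof.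
move=> r0 r1 y0; have [X hX] := expRN_small y0.
have b0 : 0 < 1 - r by rewrite subr_gt0.
exists (Num.truncn (X / (1 - r))).+1 => t ht.
apply: le_trans (exprn_le_expR t r0) (hX _ _).
rewrite mulrC -ler_pdivrMr //; apply: ltW; apply: lt_le_trans (truncnS_gt _) _.
by rewrite ler_nat.
Qed.

Lemma sqr_le_expR (R : realType) (x : R) : 0 <= x -> x ^+ 2 / 4 <= expR x.
Proof.
move=> x0; have -> : x = x / 2 + x / 2 by field.
rewrite expRD; have h := expR_ge1Dx (x / 2).
have h2 : (1 + x / 2) * (1 + x / 2) <= expR (x / 2) * expR (x / 2).
  by apply: ler_pM => //; rewrite addr_ge0 // divr_ge0.
have e : (x / 2 + x / 2) ^+ 2 / 4 = (x / 2) ^+ 2 by field.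
by rewrite e; move: h2; nra.
Qed.

(** [T] is about [2 / (1 - rho) * ln n], so that [rho ^+ T <= n ^- 2]: one factor [1 / n] offsets
    the total weight and the other tends to 0. That [T / n] is small follows from [sqr_le_expR] at
    [ln n]. *)
Lemma mixing_time_exists (R : realType) (rho kq eps : R) (T0 : nat) :
  0 <= rho -> rho < 1 -> 0 <= kq -> 0 < eps ->
  exists X : R, forall n : nat, (0 < n)%N -> X <= ln n%:R -> exists T : nat,
    [/\ (T0 <= T)%N, 2 * 2^-1 ^+ T <= eps, kq * rho ^+ T * (2 * n%:R) <= eps &
        T%:R * (kq / n%:R) <= eps / 3].
Proof.
move=> r0 r1 k0 e0.
have [T1 hT1] : exists t0, forall t, (t0 <= t)%N -> 2^-1 ^+ t <= eps / 2 :> R.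
  by apply: exprn_small; rewrite ?divr_gt0 ?invr_ge0 // invf_lt1 // ltr1n.
pose b := 1 - rho; have b0 : 0 < b by rewrite subr_gt0.
pose al := 2 / b; have al0 : 0 < al by rewrite divr_gt0.
pose be : R := (1 + T0 + T1)%:R; have be0 : 0 <= be by [].
pose X1 := 2 * kq / eps; pose X2 := 12 * kq * (al + be) / eps.
have X10 : 0 <= X1 by rewrite /X1 divr_ge0 ?mulr_ge0 ?(ltW e0).
have X20 : 0 <= X2 by rewrite /X2 divr_ge0 ?mulr_ge0 ?addr_ge0 ?(ltW e0) ?(ltW al0).
exists (1 + X1 + X2) => n n0; set L := ln _ => hL.
have nr0 : 0 < n%:R :> R by rewrite ltr0n.
have [L1 X1L X2L] : [/\ 1 <= L, X1 <= L & X2 <= L].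
  by move: X10 X20 hL; move: X1 X2 L => u v w; split; lra.
have L0 : 0 <= L by apply: le_trans L1.
have nL : n%:R = expR L by rewrite lnK.
exists (Num.truncn (al * L) + (1 + T0 + T1))%N.
set T := (_ + _)%N.
have TleL : T%:R <= al * L + be.
  by rewrite natrD lerD2r truncn_le // mulr_ge0 // ltW.
have TgeL : al * L <= T%:R.
  by apply: ltW; apply: lt_le_trans (truncnS_gt _) _; rewrite ler_nat /T -addn1 leq_add2l -addnA leq_addr.
split.
- by apply: leq_trans (leq_addl _ _); rewrite addnAC leq_addl.
- have : 2^-1 ^+ T <= eps / 2 by apply: hT1; rewrite /T addnA leq_addl.
  by rewrite ler_pdivlMr // mulrC.
- have h : rho ^+ T <= n%:R^-1 * n%:R^-1.
    apply: le_trans (exprn_le_expR T r0) _.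
    rewrite nL -!expRN -expRD ler_expR -/b.
    have := ler_wpM2l (ltW b0) TgeL.
    have -> : b * (al * L) = 2 * L by rewrite /al; field; rewrite gt_eqF.
    lra.
  apply: le_trans (_ : kq * (n%:R^-1 * n%:R^-1) * (2 * n%:R) <= _).
    by rewrite ler_wpM2r ?mulr_ge0 // ler_wpM2l.
  have -> : kq * (n%:R^-1 * n%:R^-1) * (2 * n%:R) = 2 * kq / n%:R by field; rewrite gt_eqF.
  rewrite ler_pdivrMr // [leRHS]mulrC -ler_pdivrMr //.
  by apply: le_trans X1L _; rewrite nL; apply: le_trans (expR_ge1Dx L); rewrite lerDr.
- rewrite mulrA ler_pdivrMr //.
  apply: le_trans (ler_wpM2r k0 TleL) _.
  have h : L * X2 <= 4 * n%:R.
    have := sqr_le_expR L0; rewrite -nL; have : L * X2 <= L * L by rewrite ler_wpM2l.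
    by rewrite expr2; lra.
  have h2 : L * (12 * kq * (al + be)) <= eps * (4 * n%:R).
    by move: h; rewrite /X2 mulrA ler_pdivrMr // [X in _ <= X]mulrC.
  have h3 : be * kq <= be * kq * L by rewrite ler_peMr ?mulr_ge0.
  lra.
Qed.

(* With minimum-degree threshold [d / 380], degree bound [6 * d] and edge
   expansion [d / 1520] (a quarter of the threshold), the constants below bound
   the weights [Psi], the Poincare constant and the decay rate of the lazy walk.
   The exponent 3800 makes it unlikely, after summing over all sets of at most
   [th_cst * n] vertices, that one has more than [d / 1520] edges per vertex. *)
Section Constants.
Context (R : realType).

Definition kq_cst : R := 6 / 380^-1 + 1.
Definition C_cst : R := poincare_cst 380^-1 6 1520^-1.
Definition rho_cst : R := 1 - (4 * C_cst)^-1.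

Lemma C_cst_ge : 4 <= C_cst.
Proof.
rewrite /C_cst /poincare_cst.
have h : 0 <= (8 * 6 ^+ 2 / 1520^-1 ^+ 2 : R).
  by rewrite divr_ge0 ?sqr_ge0 // mulr_ge0 ?sqr_ge0 // ler0n.
have k : 0 <= (6 / 380^-1 : R) by rewrite divr_ge0 ?invr_ge0 ?ler0n.
move: h k; set B := _ / 1520^-1 ^+ 2; set kk := 6 / 380^-1 => h k.
have : 0 <= (kk + 1) * B by rewrite mulr_ge0 // addr_ge0.
lra.
Qed.

Lemma C_cst_gt0 : 0 < C_cst.
Proof. by apply: lt_le_trans C_cst_ge. Qed.

Lemma rho_cst_bounds : 0 <= rho_cst /\ rho_cst < 1.
Proof.
have c4 := C_cst_ge; have i0 : 0 < (4 * C_cst)^-1 by rewrite invr_gt0; lra.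
have i1 : (4 * C_cst)^-1 <= 1 by rewrite invf_le1; lra.
by rewrite /rho_cst; split; lra.
Qed.

Lemma rho_cst_sqr : 1 - (2 * C_cst)^-1 <= rho_cst ^+ 2.
Proof.
have c0 := C_cst_gt0.
have -> : (2 * C_cst)^-1 = 2 * (4 * C_cst)^-1 by field; rewrite gt_eqF.
rewrite /rho_cst; set x := (4 * C_cst)^-1.
by have := sqr_ge0 x; lra.
Qed.

Lemma kq_cst_ge0 : 0 <= kq_cst.
Proof. by apply: addr_ge0 ler01; rewrite divr_ge0 ?invr_ge0 ?ler0n. Qed.

(** The largest value with [expR l * th <= 1] for [l = 3800], where 3800 is [5 / 2 * 1520] as
    [mean_dense_sets] requires for [M = 1 / 1520]. *)
Definition th_cst : R := expR (- 3800).

(* Each summand is nonnegative, and at least 1 on the bad event it detects. *)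
Definition bad_event_sum (n : nat) (p eps a : R) (K : nat) (E : {set {set 'I_n}}) : R :=
  isolated_count R E + large_degree p E + low_pairs p E +
  dense_sets p th_cst 3800 1520^-1 E + sparse_cuts p th_cst E +
  atypical_sum p eps E + tiny_degree K a E.

Lemma bad_event_sum_mean (eps a : R) (K : nat) (y : R) :
  0 < eps -> eps <= 1 -> 0 < a -> a <= 1 -> 0 < y ->
  exists X : R, forall (n : nat) (p : R), (0 < n)%N -> 0 <= p -> p <= 1 ->
    X <= ln n%:R -> X <= n%:R * p - ln n%:R ->
    Gnp_mean p (@bad_event_sum n p eps a K) <= y.
Proof.
move=> e0 e1 a0 a1 y0.
have th0 : 0 < th_cst by exact: expR_gt0.
have small (z : R) : 0 < z -> exists X : R, forall x, X <= x -> expR (- x) * z <= y / 7.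
  move=> z0; have [|X hX] := @expRN_small R (y / 7 / z); first by rewrite !divr_gt0.
  by exists X => x /hX; rewrite ler_pdivlMr.
have pos2 : 0 < 2 / eps :> R by rewrite divr_gt0.
have [X1 h1] := small (expR 1) (expR_gt0 _).
have [X2 h2] := small 1 ltr01.
have [X3 h3] := small (110 * expR 6) (mulr_gt0 (ltr0Sn _ _) (expR_gt0 _)).
have [X4 h4] := small 2 (ltr0Sn _ _).
have [X5 h5] := small (expR 1) (expR_gt0 _).
have [X6 h6] := small (2 / eps * expR 1) (mulr_gt0 pos2 (expR_gt0 _)).
have [X7 h7] := small (expR (1 - ln a * K%:R)) (expR_gt0 _).
pose q5 := 8 / th_cst; pose q6 := 8 / eps ^+ 2.
have q50 : 0 < q5 by rewrite divr_gt0.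
have q60 : 0 < q6 by rewrite divr_gt0 ?exprn_gt0.
pose X := Num.max 1 (Num.max X1 (Num.max X2 (Num.max (5 / 3 * X3) (Num.max X4
  (Num.max (q5 * X5) (Num.max q5 (Num.max (q6 * X6) (X7 / a)))))))).
exists X => n p n0 p0 p1; set L := ln n%:R; set d := n%:R * p => hL hD.
have [L0 Ld] : 0 <= L /\ L <= d.
  have X1' : 1 <= X by rewrite /X le_max lexx.
  by move: (X) (L) (d) X1' hL hD => x l z h1' h2' h3'; split; lra.
have hd : X <= d := le_trans hL Ld.
have d0 : 0 <= d := le_trans L0 Ld.
have d1 : 1 <= d by apply: le_trans hd; rewrite /X !le_max lexx ?orbT.
have g1 : X1 <= d - L by apply: le_trans hD; rewrite /X !le_max lexx ?orbT.
have g2 : X2 <= d by apply: le_trans hd; rewrite /X !le_max lexx ?orbT.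
have g3 : 5 / 3 * X3 <= d by apply: le_trans hd; rewrite /X !le_max lexx ?orbT.
have g4 : X4 <= d by apply: le_trans hd; rewrite /X !le_max lexx ?orbT.
have g5 : q5 * X5 <= d by apply: le_trans hd; rewrite /X !le_max lexx ?orbT.
have g5' : q5 <= d by apply: le_trans hd; rewrite /X !le_max lexx ?orbT.
have g6 : q6 * X6 <= d by apply: le_trans hd; rewrite /X !le_max lexx ?orbT.
have g7 : X7 / a <= L by apply: le_trans hL; rewrite /X !le_max lexx ?orbT.
have nr0 : 0 < n%:R :> R by rewrite ltr0n.
have nL : n%:R = expR L by rewrite lnK.
have nd : n%:R <= expR d by rewrite nL ler_expR.
have m1 : Gnp_mean p (@isolated_count R n) <= y / 7.
  apply: le_trans (mean_isolated n p0 p1) _; rewrite -/d nL -expRD.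
  by apply: le_trans (h1 _ g1); rewrite -expRD ler_expR; lra.
have m2 : Gnp_mean p (@large_degree R n p) <= y / 7.
  apply: le_trans (mean_large_degree n p0 p1) _; rewrite -/d nL -expRD.
  by apply: le_trans (h2 _ g2); rewrite mulr1 ler_expR; lra.
have m3 : Gnp_mean p (@low_pairs R n p) <= y / 7.
  apply: le_trans (mean_low_pairs n p0 p1) _; rewrite -/d.
  (* The polynomial factor is absorbed by [expR (d / 5)]; the total exponent is then
     [1 + 1 / 5 - 9 / 5 = - 3 / 5] times [d], and 110 = 10 + 100. *)
  have dexp : d <= 10 * expR (d / 10).
    by have := expR_ge1Dx (d / 10); lra.
  have d2exp : d + d ^+ 2 <= 110 * expR (d / 5).
    have -> : d / 5 = d / 10 + d / 10 by field.
    rewrite expRD; have k1 : 1 <= expR (d / 10) by rewrite expR_ge1 // divr_ge0.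
    move: dexp k1; set z := expR _ => dexp k1.
    have z0 : 0 <= z by rewrite expR_ge0.
    have hz : d ^+ 2 <= (10 * z) ^+ 2 by rewrite ler_sqr ?nnegrE ?mulr_ge0.
    have hzz : z <= z * z by rewrite ler_peMr.
    by move: dexp hz hzz; lra.
  apply: le_trans (_ : expR d * (110 * expR (d / 5)) * expR (6 - 9 / 5 * d) <= _).
    by rewrite ler_wpM2r ?expR_ge0 //; apply: ler_pM => //; rewrite addr_ge0 ?sqr_ge0.
  have -> : expR d * (110 * expR (d / 5)) * expR (6 - 9 / 5 * d) =
     expR (- (3 / 5 * d)) * (110 * expR 6).
    have -> : expR d * (110 * expR (d / 5)) * expR (6 - 9 / 5 * d) =
       110 * (expR d * expR (d / 5) * expR (6 - 9 / 5 * d)) by ring.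
    have -> : expR (- (3 / 5 * d)) * (110 * expR 6) = 110 * (expR (- (3 / 5 * d)) * expR 6) by ring.
    by rewrite -!expRD; congr (_ * expR _); lra.
  by apply: h3; lra.
have m4 : Gnp_mean p (@dense_sets R n p th_cst 3800 1520^-1) <= y / 7.
  have k1 : 3800 * 1520^-1 = 5 / 2 :> R by field.
  have k2 : expR 3800 * th_cst <= 1 by rewrite /th_cst -expRD subrr expR0.
  apply: le_trans (mean_dense_sets p0 p1 k1 k2 (ler0n _ _) d1 nd) _.
  by rewrite mulrC; exact: h4.
have m5 : Gnp_mean p (@sparse_cuts R n p th_cst) <= y / 7.
  have t5 : 8 <= th_cst * d by move: g5'; rewrite /q5 ler_pdivrMr // mulrC.
  apply: le_trans (mean_sparse_cuts p0 p1 n0 t5) _; rewrite -/d.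
  apply: le_trans (h5 (th_cst * d / 8) _); first by rewrite -expRD ler_expR; lra.
  have -> : X5 = (th_cst * (q5 * X5)) / 8 by rewrite /q5; field; rewrite gt_eqF.
  by rewrite ler_pM2r // ler_pM2l.
have m6 : Gnp_mean p (@atypical_sum R n p eps) <= y / 7.
  apply: le_trans (mean_atypical_sum p0 p1 n0 e0 e1) _; rewrite -/d.
  apply: le_trans (h6 (eps ^+ 2 * d / 8) _).
    by rewrite [leRHS]mulrCA ler_pM2l // -expRD ler_expR; lra.
  have -> : X6 = (eps ^+ 2 * (q6 * X6)) / 8 by rewrite /q6; field; rewrite gt_eqF.
  by rewrite ler_pM2r // ler_pM2l ?exprn_gt0.
have m7 : Gnp_mean p (@tiny_degree R n K a) <= y / 7.
  apply: le_trans (mean_tiny_degree p0 p1 K n0 a0 a1 Ld) _; rewrite -/L.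
  apply: le_trans (h7 (a * L) _); first by rewrite -expRD ler_expR; lra.
  by move: g7; rewrite ler_pdivrMr // mulrC.
rewrite /bad_event_sum !Gnp_meanD; lra.
Qed.

End Constants.

(** * Cover time on the good event *)

(** Three errors of at most [delta * L / 4] each: [4 * eps * L] from the typical rate,
    [2 * a * M * L] from the exceptional set, and the constant terms. *)
Lemma upper_numeric (R : realType) (eps delta n L W M a k Hn HB : R) :
  0 < eps -> eps <= 4^-1 -> 16 * eps <= delta -> 0 <= n -> 0 <= M -> 8 * a * M <= delta ->
  0 <= W -> W <= (1 + eps ^+ 2) * n -> 0 <= Hn -> Hn <= 1 + L -> 0 <= HB ->
  HB <= 1 + k + 2 * a * L -> 0 <= L ->
  4 * (1 + 4 * eps + M * (1 + k)) <= delta * L ->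
  (2 + eps) * W / (2 * (1 - eps)) * Hn + M * W / (2 * (1 - eps)) * HB <=
  (1 + delta) * (n * L).
Proof.
move=> eps_gt0 eps_le eps_delta n_ge0 M0 aM W0 Wn Hn0 HnL HB0 HBL L0 hL.
have e1 : 0 < 2 * (1 - eps) by lra.
have e16 : eps ^+ 2 <= eps * 4^-1 by rewrite expr2 ler_wpM2l // ltW.
have esq : eps ^+ 2 <= 16^-1 by lra.
have c1 : (2 + eps) * W / (2 * (1 - eps)) <= (1 + 4 * eps) * n.
  rewrite ler_pdivrMr //.
  apply: le_trans (_ : (2 + eps) * ((1 + eps ^+ 2) * n) <= _).
    by rewrite ler_wpM2l //; lra.
  rewrite mulrA [leRHS]mulrAC ler_wpM2r //.
  have : eps * eps ^+ 2 <= eps * 16^-1 by rewrite ler_wpM2l // ltW.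
  lra.
have c2 : W / (2 * (1 - eps)) <= n.
  rewrite ler_pdivrMr //; apply: le_trans Wn _; rewrite mulrC ler_wpM2l //; lra.
have t1 : (2 + eps) * W / (2 * (1 - eps)) * Hn <= (1 + 4 * eps) * n * (1 + L).
  apply: ler_pM => //; rewrite divr_ge0 ?mulr_ge0 ?(ltW e1) //; lra.
have t2 : M * W / (2 * (1 - eps)) * HB <= M * n * (1 + k + 2 * a * L).
  apply: ler_pM => //; last by rewrite -mulrA ler_wpM2l.
  by rewrite divr_ge0 ?(ltW e1) // mulr_ge0.
apply: le_trans (lerD t1 t2) _.
have -> : (1 + 4 * eps) * n * (1 + L) + M * n * (1 + k + 2 * a * L) =
  n * ((1 + 4 * eps) * L + 2 * a * M * L + (1 + 4 * eps + M * (1 + k))) by ring.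
rewrite mulrCA ler_wpM2l //.
have h1 : 16 * eps * L <= delta * L by rewrite ler_wpM2r.
have h2 : 8 * a * M * L <= delta * L by rewrite ler_wpM2r.
have h3 : 0 <= eps * L by rewrite mulr_ge0 // ltW.
lra.
Qed.

Lemma lower_numeric (R : realType) (eps delta n L W HA : R) :
  0 < eps -> eps <= 4^-1 -> 16 * eps <= delta -> 0 <= n -> n <= W ->
  L - 1 <= HA -> 3 <= L -> 4 <= delta * L ->
  (1 - delta) * (n * L) <= (2 - eps) * W / (2 * (1 + 2 * eps)) * ((1 - eps) * HA - 1).
Proof.
move=> eps_gt0 eps_le eps_delta n_ge0 nW HL L3 hL.
have e2 : 0 < 2 * (1 + 2 * eps) by lra.
have e1 : 0 <= 1 - eps by lra.
have esq : 0 <= eps ^+ 2 by rewrite sqr_ge0.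
have c1 : (1 - 3 * eps) * n <= (2 - eps) * W / (2 * (1 + 2 * eps)).
  rewrite ler_pdivlMr //; apply: le_trans (_ : (2 - eps) * n <= _).
    by rewrite mulrAC ler_wpM2r //; lra.
  by rewrite ler_wpM2l //; lra.
have hA : (1 - eps) * (L - 1) - 1 <= (1 - eps) * HA - 1 by rewrite lerD2r ler_wpM2l.
have hA0 : 0 <= (1 - eps) * (L - 1) - 1.
  have : (1 - 4^-1) * (3 - 1) <= (1 - eps) * (L - 1) by apply: ler_pM; lra.
  lra.
apply: le_trans (_ : (1 - 3 * eps) * n * ((1 - eps) * (L - 1) - 1) <= _); last first.
  by apply: ler_pM => //; rewrite mulr_ge0 //; lra.
have -> : (1 - delta) * (n * L) = n * ((1 - delta) * L) by ring.
have -> : (1 - 3 * eps) * n * ((1 - eps) * (L - 1) - 1) =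
   n * ((1 - 3 * eps) * ((1 - eps) * (L - 1) - 1)) by ring.
rewrite ler_wpM2l //.
have h1 : 16 * eps * L <= delta * L by rewrite ler_wpM2r //; lra.
have h2 : 0 <= eps ^+ 2 * (L - 1) by rewrite mulr_ge0 //; lra.
lra.
Qed.

Section BadEventNonneg.
Context (R : realType) (n K : nat) (p eps a : R) (E : {set {set 'I_n}}).
Hypothesis eps_gt0 : 0 < eps.

Lemma bad_event_terms_ge0 :
  [/\ 0 <= isolated_count R E, 0 <= large_degree p E & 0 <= low_pairs p E] /\
  [/\ 0 <= dense_sets p (th_cst R) 3800 1520^-1 E, 0 <= sparse_cuts p (th_cst R) E,
      0 <= atypical_sum p eps E & 0 <= tiny_degree K a E].
Proof.
have s1 : 0 <= isolated_count R E by apply: sumr_ge0 => v _; rewrite exprn_ge0.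
have s2 : 0 <= large_degree p E by apply: sumr_ge0 => v _; rewrite expR_ge0.
have s3 : 0 <= low_pairs p E.
  apply: sumr_ge0 => x _; apply: sumr_ge0 => y _; rewrite addr_ge0 ?mulr_ge0 ?expR_ge0 //.
  by apply: sumr_ge0 => w _; rewrite mulr_ge0 ?expR_ge0.
have s4 : 0 <= dense_sets p (th_cst R) 3800 1520^-1 E.
  by apply: sumr_ge0 => v _; rewrite expR_ge0.
have s5 : 0 <= sparse_cuts p (th_cst R) E by apply: sumr_ge0 => v _; rewrite expR_ge0.
have s6 : 0 <= atypical_sum p eps E.
  rewrite mulr_ge0 ?invr_ge0 ?mulr_ge0 ?(ltW eps_gt0) //.
  by apply: sumr_ge0 => v _; rewrite addr_ge0 ?expR_ge0.
have s7 : 0 <= tiny_degree K a E.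
  by rewrite mulr_ge0 ?expR_ge0 // sumr_ge0 // => v _; rewrite expR_ge0.
by [].
Qed.

Lemma bad_event_sum_ge0 : 0 <= bad_event_sum p eps a K E.
Proof.
have [[s1 s2 s3] [s4 s5 s6 s7]] := bad_event_terms_ge0.
by do 6!apply: addr_ge0 => //.
Qed.

End BadEventNonneg.

Section GoodEvent.
Context (R : realType) (n K : nat) (p eps a : R) (E : {set {set 'I_n}}).
Local Notation d := (n%:R * p).
Local Notation e := (adj E).
Hypothesis n_gt0 : (0 < n)%N.
Hypothesis sE : E \subset all_edges n.
Hypothesis d_ge : 1520 <= d.
Hypothesis eps_gt0 : 0 < eps.
Hypothesis good : bad_event_sum p eps a K E < 1.

Lemma bad_event_sum_lt1 : [/\ isolated_count R E < 1, large_degree p E < 1 & low_pairs p E < 1]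
  /\ [/\ dense_sets p (th_cst R) 3800 1520^-1 E < 1, sparse_cuts p (th_cst R) E < 1,
         atypical_sum p eps E < 1 & tiny_degree K a E < 1].
Proof.
have [[s1 s2 s3] [s4 s5 s6 s7]] := @bad_event_terms_ge0 R n K p eps a E eps_gt0.
move: good s1 s2 s3 s4 s5 s6 s7; rewrite /bad_event_sum.
move: (isolated_count R E) (large_degree p E) (low_pairs p E) => x1 x2 x3.
move: (dense_sets _ _ _ _ _) (sparse_cuts _ _ _) (atypical_sum _ _ _) (tiny_degree _ _ _) => x4 x5 x6 x7.
by move=> *; split; split; lra.
Qed.

Let d_gt0 : 0 < d. Proof. by apply: (lt_le_trans _ d_ge); rewrite ltr0n. Qed.
Let eta_gt0 : 0 < 380^-1 :> R. Proof. by rewrite invr_gt0 ltr0n. Qed.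
Let kap_gt0 : 0 < 1520^-1 :> R. Proof. by rewrite invr_gt0 ltr0n. Qed.
Let six_gt0 : 0 < 6 :> R. Proof. by rewrite ltr0n. Qed.

Lemma good_deg_gt0 v : (0 < deg e v)%N.
Proof. by have [[h _ _] _] := bad_event_sum_lt1; exact: deg_gt0_of_isolated h v. Qed.

Lemma good_deg_le v : (deg e v)%:R <= 6 * d.
Proof. by have [[_ h _] _] := bad_event_sum_lt1; exact: deg_le_of_large h v. Qed.

Lemma good_low_indep v w : v \notin high_deg e d 380^-1 -> e v w ->
  w \in high_deg e d 380^-1.
Proof.
have [[_ _ h] _] := bad_event_sum_lt1 => lv; apply: contraTT => lw.
exact: low_not_adj h _ _ lv lw.
Qed.

Lemma good_low_nbr w : (#|[set u | e w u & u \notin high_deg e d 380^-1]| <= 1)%N.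
Proof. by have [[_ _ h] _] := bad_event_sum_lt1; exact: low_nbr_card h w. Qed.

Lemma good_Psi_le v : Psi R e v <= kq_cst R.
Proof.
exact: (Psi_le good_deg_gt0 d_gt0 eta_gt0 six_gt0 good_deg_le good_low_indep good_low_nbr).
Qed.

Lemma good_poincare f : \sum_x Psi R e x * f x = 0 ->
  \sum_x Psi R e x * f x ^+ 2 <= C_cst R * dirichlet (walk_step R e) (Psi R e) f.
Proof.
have [[_ _ h3] [h4 h5 _ _]] := bad_event_sum_lt1.
exact: (graph_poincare (@adj_sym n E) good_deg_gt0 d_gt0 eta_gt0 kap_gt0 six_gt0
  good_deg_le good_low_indep good_low_nbr (good_expansion sE d_ge h3 h4 h5)).
Qed.

Lemma good_total_weight : eps <= 2^-1 -> \sum_v Psi R e v <= n%:R * (1 + 21 * eps).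
Proof.
move=> e2; have [_ [_ _ h _]] := bad_event_sum_lt1.
have := total_weight_le (@adj_sym n E) good_deg_gt0 d_gt0 eps_gt0 e2 good_deg_le.
rewrite card_ord; have := atypical_card n_gt0 eps_gt0 h; lra.
Qed.

Lemma good_near_tiny : 0 < a -> a <= 1 ->
  #|near_tiny E K|%:R <= K.+1%:R * expR (2 * a * ln n%:R) :> R.
Proof.
move=> a0 a1; have [_ [_ _ _ h]] := bad_event_sum_lt1.
apply: le_trans (_ : (K.+1 * #|[set v | (deg e v <= K)%N]|)%:R <= _).
  by rewrite ler_nat near_tiny_card.
by rewrite natrM ler_wpM2l // tiny_card.
Qed.

End GoodEvent.

Lemma cover_time_of_good_event (R : realType) (delta : R) : 0 < delta ->
  exists (eps a : R) (K : nat) (X : R),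
  [/\ 0 < eps, eps <= 1, 0 < a & a <= 1] /\
  forall (n : nat) (p : R) (E : {set {set 'I_n}}), (0 < n)%N -> X <= ln n%:R ->
    E \subset all_edges n -> 1520 <= n%:R * p -> bad_event_sum p eps a K E < 1 ->
    (((1 - delta) * (n%:R * ln n%:R))%:E <= max_cover_time R (adj E))%E &&
    (max_cover_time R (adj E) <= ((1 + delta) * (n%:R * ln n%:R))%:E)%E.
Proof.
move=> delta0.
have [r0 r1] := rho_cst_bounds R; have rC := rho_cst_sqr R.
have C0 := C_cst_gt0 R; have kq0 := kq_cst_ge0 R.
set rho := rho_cst R in r0 r1 rC; set kq := kq_cst R in kq0.
have r1' : 0 < 1 - rho by rewrite subr_gt0.
pose M := 1 + kq / (1 - rho).
have M1 : 1 <= M by rewrite lerDl divr_ge0 // ltW.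
have M0 : 0 < M by apply: lt_le_trans M1.
have [ep [ep0 ep4 epd]] : exists ep : R, [/\ 0 < ep, ep <= 4^-1 & 16 * ep <= delta].
  exists (Num.min 4^-1 (delta / 16)); split; first by rewrite lt_min invr_gt0 divr_gt0 // ltr0n.
    by rewrite ge_min lexx.
  by rewrite mulrC -ler_pdivlMr // ge_min lexx orbT.
have [a [a0 a4 aM]] : exists a : R, [/\ 0 < a, a <= 4^-1 & 8 * a * M <= delta].
  exists (Num.min 4^-1 (delta / (8 * M))); split.
  - by rewrite lt_min invr_gt0 divr_gt0 ?mulr_gt0 // ltr0n.
  - by rewrite ge_min lexx.
  - by rewrite mulrAC mulrC -ler_pdivlMr ?mulr_gt0 // ge_min lexx orbT.
have [T0 hT0] : exists T0, kq * rho ^+ T0 / (1 - rho) <= ep / 3.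
  have [|t0 ht0] := exprn_small r0 r1 (y := ep / 3 * (1 - rho) / (kq + 1)).
    by rewrite divr_gt0 ?mulr_gt0 ?divr_gt0 // ltr_wpDl.
  exists t0; rewrite ler_pdivrMr //.
  have k1 : 0 < kq + 1 by rewrite ltr_wpDl.
  apply: le_trans (_ : (kq + 1) * rho ^+ t0 <= _).
    by rewrite ler_wpM2r ?exprn_ge0 // lerDl.
  by rewrite mulrC -ler_pdivlMr //; exact: ht0.
(* The degree cutoff is chosen after [T0]: entries into vertices outside [near_tiny] have
   probability at most [1 / (K + 1)], and [T0] of them may cost [ep / 3]. *)
pose K := Num.truncn (T0%:R * 3 / ep).
have hK : T0%:R * K.+1%:R^-1 <= ep / 3.
  have := ltW (truncnS_gt (T0%:R * 3 / ep)); rewrite -/K !ler_pdivrMr //.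
  by move: (K.+1%:R) (T0%:R) => x y; lra.
pose k := ln (K.+1%:R : R).
have k0 : 0 <= k by rewrite ln_ge0 // ler1n.
have [X1 hX1] := mixing_time_exists T0 r0 r1 kq0 ep0.
pose c2 := 4 * (1 + 4 * ep + M * (1 + k)) / delta.
(* Ensures [4 * (K + 1) <= expR (L / 2)]; with [2 * a <= 1 / 2] this gives [#|B| <= n / 4]. *)
pose c3 := 2 * ln (4 * K.+1%:R : R).
pose X := Num.max X1 (Num.max 3 (Num.max (4 / delta) (Num.max c2 c3))).
(* Makes the bound [n * (1 + 21 * eps)] on the total weight equal to [(1 + ep ^+ 2) * n]; here 21 =
   8 + (1 + 2 * 6), from [total_weight_le] with degree bound [6 * d]. *)
pose eps := ep ^+ 2 / 21.
have ep2 : ep ^+ 2 <= 4^-1.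
  by have := ler_wpM2l (ltW ep0) ep4; rewrite -expr2; lra.
have eps0 : 0 < eps by rewrite divr_gt0 ?exprn_gt0 // ltr0n.
have eps1 : eps <= 2^-1.
  by rewrite /eps ler_pdivrMr ?ltr0n //; lra.
exists eps, a, K, X; split.
  by split => //; [apply: le_trans eps1 _|apply: le_trans a4 _]; rewrite invf_le1 // ler1n.
move=> n p E n0; set L := ln n%:R => hX sE d1520 good.
have a1 : a <= 1 by apply: le_trans a4 _; rewrite invf_le1 // ler1n.
have gX1 : X1 <= L by apply: le_trans hX; rewrite /X !le_max lexx.
have gX3 : 3 <= L by apply: le_trans hX; rewrite /X !le_max lexx ?orbT.
have gX4 : 4 / delta <= L by apply: le_trans hX; rewrite /X !le_max lexx ?orbT.
have gc2 : c2 <= L by apply: le_trans hX; rewrite /X !le_max lexx ?orbT.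
have gc3 : c3 <= L by apply: le_trans hX; rewrite /X !le_max lexx ?orbT.
have L0 : 0 <= L by apply: le_trans gX3.
have nr0 : 0 < n%:R :> R by rewrite ltr0n.
have nL : n%:R = expR L :> R by rewrite lnK.
have K0 : 0 < K.+1%:R :> R by rewrite ltr0n.
have [T [T0T hT2 hTm hTs]] := hX1 n n0 gX1.
have deg0 := good_deg_gt0 eps0 good.
have poin := good_poincare sE d1520 eps0 good.
have Psik := good_Psi_le sE d1520 eps0 good.
have W1 : \sum_v Psi R (adj E) v <= (1 + ep ^+ 2) * n%:R.
  apply: le_trans (good_total_weight n0 d1520 eps0 good eps1) _.
  by rewrite mulrC /eps; apply: ler_wpM2r => //; rewrite mulrCA mulfV ?mulr1 // pnatr_eq0.
have nW : n%:R <= \sum_v Psi R (adj E) v.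
  by rewrite -[X in X%:R <= _]card_ord; exact: le_total_weight deg0.
have W0 : 0 <= \sum_v Psi R (adj E) v by apply: le_trans nW.
have W2 : \sum_v Psi R (adj E) v <= 2 * n%:R.
  by apply: le_trans W1 _; rewrite ler_wpM2r //; lra.
have hmix : kq * rho ^+ T * \sum_v Psi R (adj E) v <= ep.
  by apply: le_trans hTm; rewrite ler_wpM2l ?mulr_ge0 ?exprn_ge0.
set B := near_tiny E K.
have Bcard : #|B|%:R <= K.+1%:R * expR (2 * a * L) := good_near_tiny n0 eps0 good a0 a1.
have HB : harmonic_number R #|B| <= 1 + k + 2 * a * L.
  have [->|B0] := posnP #|B|.
    rewrite /harmonic_number big_ord0 !addr_ge0 ?mulr_ge0 // ltW //.
  apply: le_trans (harmonic_number_le R B0) _; rewrite -addrA lerD2l.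
  rewrite -[2 * a * L]expRK -lnM ?posrE ?expR_gt0 // ler_ln ?posrE ?ltr0n //.
  by rewrite mulr_gt0 ?expR_gt0.
have Bsmall : #|B|%:R <= n%:R / 4 :> R.
  apply: le_trans Bcard _; rewrite ler_pdivlMr //.
  have h1 : 4 * K.+1%:R <= expR (L / 2) :> R.
    rewrite -[leLHS]lnK ?posrE ?mulr_gt0 // ler_expR ler_pdivlMr // mulrC //.
  have h2 : expR (2 * a * L) <= expR (L / 2).
    have := ler_wpM2r L0 a4; rewrite ler_expR; lra.
  have -> : n%:R = expR (L / 2) * expR (L / 2).
    by rewrite -expRD nL; congr expR; field.
  have -> : K.+1%:R * expR (2 * a * L) * 4 = 4 * K.+1%:R * expR (2 * a * L) by ring.
  by apply: ler_pM => //; rewrite ?expR_ge0 ?mulr_ge0.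
set A' := [set v | (Psi R (adj E) v <= 1 + ep)%R] :\: B.
have Acard : n%:R / 2 <= #|A'|%:R :> R.
  have := good_card B deg0 ep0; rewrite card_ord => /(_ W1).
  have : ep * n%:R <= 4^-1 * n%:R :> R by rewrite ler_wpM2r.
  by move: Bsmall; rewrite -/A'; lra.
have A0 : (0 < #|A'|)%N.
  by rewrite -(ltr0n R); apply: lt_le_trans Acard; rewrite divr_gt0.
(* Half of the vertices remain in [A'], and [ln 2 <= 1]; [ln_le_harmonic_number] has an index shift
   that matches the predecessor. *)
have HA : L - 1 <= harmonic_number R #|A'|.-1.
  apply: le_trans (ln_le_harmonic_number R _); rewrite prednK //.
  apply: le_trans (_ : ln (n%:R / 2) <= _); last by rewrite ler_ln ?posrE ?divr_gt0 // ltr0n.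
  rewrite ln_div ?posrE // lerD2l lerN2.
  by apply: le_trans (ln_le_subr1 _) _ => //; lra.
have n0' : (0 < #|'I_n|)%N by rewrite card_ord.
have hTs' : T%:R * (kq / #|'I_n|%:R) <= ep / 3 by rewrite card_ord.
apply: (max_cover_time_bounds (@adj_sym n E) deg0 C0 poin Psik r0 rC ep4 n0' hmix).
- by rewrite mulr_ge0 ?addr_ge0 ?mulr_ge0 // ltW.
- move=> u; apply: (le_trans _ (graph_cover_time_lower (@adj_sym n E) deg0 C0 poin Psik r0 r1 rC
    ep0 ep4 n0' (fun v w => near_tiny_step R w deg0) T0T hT2 hmix hTs' hT0 hK u)).
  rewrite lee_fin; apply: lower_numeric => //.
    by move: gX4; rewrite ler_pdivrMr // [L * _]mulrC.
- move=> u; apply: le_trans (graph_cover_time_upper (@adj_sym n E) deg0 C0 poin Psik r0 r1 rC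
    ep0 ep4 n0' (fun v w => near_tiny_step R w deg0) T0T hT2 hmix hTs' hT0 hK u) _.
  rewrite lee_fin -/M; apply: (upper_numeric (a := a) (k := k)) => //.
  - exact: ltW.
  - exact: harmonic_number_ge0.
  - by rewrite card_ord; exact: harmonic_number_le.
  - exact: harmonic_number_ge0.
  - by move: gc2; rewrite /c2 ler_pdivrMr // [L * _]mulrC.
Qed.

Local Open Scope classical_set_scope.

Theorem theorem1 (R : realType) (c p : nat -> R)
  (p_def : forall n : nat, p n = c n * ln n%:R / n%:R)
  (p_range : forall n : nat, 0 <= p n <= 1)
  (omega_infty : (c n - 1) * ln n%:R @[n --> \oo] --> +oo)
  (delta : R) (delta_gt0 : 0 < delta) :
  Gnp_prob (p n) (fun G : rel 'I_n =>
    (((1 - delta) * (n%:R * ln n%:R))%:E <= max_cover_time R G)%E &&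
    (max_cover_time R G <= ((1 + delta) * (n%:R * ln n%:R))%:E)%E)
  @[n --> \oo] --> (1 : R).
Proof.
have [eps [a [K [X1 [[eps0 eps1 a0 a1] hX1]]]]] := cover_time_of_good_event delta_gt0.
apply/cvgrPdist_le => y y0.
have [X2 hX2] := bad_event_sum_mean K eps0 eps1 a0 a1 y0.
pose X := Num.max 1520 (Num.max X1 X2).
have omega_large := (cvgryPge (fun n => (c n - 1) * ln n%:R)).1 omega_infty X.
near=> n.
have n0 : (0 < n)%N by near: n; exact: nbhs_infty_gt.
have nr0 : 0 < n%:R :> R by rewrite ltr0n.
have hL : X <= ln n%:R.
  rewrite -[X]expRK ler_ln ?posrE ?expR_gt0 //; near: n; exact: nbhs_infty_ger.
have hD : X <= n%:R * p n - ln n%:R.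
  have -> : n%:R * p n - ln n%:R = (c n - 1) * ln n%:R.
    by rewrite p_def mulrC divfK ?gt_eqF // mulrBl mul1r.
  by near: n; exact: omega_large.
have /andP[p0 p1] := p_range n.
have X1X : X1 <= X by rewrite /X !le_max lexx ?orbT.
have X2X : X2 <= X by rewrite /X !le_max lexx ?orbT.
have XL : 1520 <= X by rewrite /X le_max lexx.
have L0 : 0 <= ln n%:R :> R by rewrite ln_ge0 // ler1n.
have d1520 : 1520 <= n%:R * p n.
  by apply: (le_trans XL); apply: (le_trans hD); rewrite gerBl.
rewrite ger0_norm ?subr_ge0 ?Gnp_prob_le1 //.
(* The cover time bounds hold whenever the bad-event sum is below 1, so the failure probability is
   at most its mean, which is at most [y]. *)
apply: (le_trans _ (hX2 n (p n) n0 p0 p1 (le_trans X2X hL) (le_trans X2X hD))).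
rewrite lerBlDl -lerBlDr; apply: Gnp_prob_ge => // E sE.
  exact: bad_event_sum_ge0.
exact: hX1 n0 (le_trans X1X hL) sE d1520.
Unshelve. all: by end_near.
Qed.
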